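(* Let $[g_\infty]\in\widehat{\mathcal{M}_f}$. Suppose $\{g^0_k\}$ and $\{g^1_k\}$ are two sequences in $\mathcal{M}$ that both $\omega$-converge to $[g_\infty]$ for $k\to\infty$. Then $$\lim_{k\to\infty}d(g^0_k,g^1_k)=0,$$ that is, $\{g^0_k\}$ and $\{g^1_k\}$ are equivalent as Cauchy sequences of $(\mathcal{M},d)$.
   Context: $M$ is a closed, orientable, $n$-dimensional $C^\infty$ manifold. $\mathcal{S}$ is the Fréchet space of smooth symmetric $(0,2)$-tensor fields on $M$ and $\mathcal{M}\subset\mathcal{S}$ the open subset of smooth Riemannian metrics, so $T_{\tilde g}\mathcal{M}\cong\mathcal{S}$. The $L^2$ metric on $\mathcal{M}$ is the weak Riemannian metric $(h,k)_{\tilde g}=\int_M \mathrm{tr}(\tilde g^{-1}h\tilde g^{-1}k)\,d\mu_{\tilde g}$, and $d$ is its distance function (infimum of lengths of paths in $\mathcal{M}$), which is known to be a metric. Fix a reference metric $g\in\mathcal{M}$; ''nullset'' and ''almost everywhere'' refer to $\mu_g$. A semimetric is a (not necessarily continuous) section $\tilde g$ of $S^2T^*M$ that is positive semidefinite on each $T_xM$. Its deflated set is $X_{\tilde g}=\{x\in M: \tilde g(x)\text{ is not positive definite}\}$. A measurable semimetric $\tilde g$ induces the measure $\mu_{\tilde g}$ given locally by $\sqrt{\det\tilde g}\,dx^1\cdots dx^n$, and $\mathrm{Vol}(Y,\tilde g)=\int_Y d\mu_{\tilde g}$. Let $\mathcal{M}_m$ be the set of measurable semimetrics on $M$ and $\mathcal{M}_f\subset\mathcal{M}_m$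 the subset of those with $\mathrm{Vol}(M,\tilde g)<\infty$. On $\mathcal{M}_m$ put $g_0\sim g_1$ iff $X_{g_0}$ and $X_{g_1}$ differ at most by a nullset and $g_0(x)=g_1(x)$ for a.e. $x\in M\setminus(X_{g_0}\cup X_{g_1})$. Put $\widehat{\mathcal{M}_m}=\mathcal{M}_m/{\sim}$ and $\widehat{\mathcal{M}_f}=\mathcal{M}_f/{\sim}$. For a sequence $\{g_k\}\subset\mathcal{M}$ let $G_k=g^{-1}g_k$ and let $D_{\{g_k\}}=\{x\in M:\forall\delta>0\ \exists k\in\mathbb{N}\text{ with }\det G_k(x)<\delta\}$ be its deflated set. The sequence $\{g_k\}$ $\omega$-converges to $[g_\infty]\in\widehat{\mathcal{M}_m}$ if for every representative $g_\infty$: (1) $\{g_k\}$ is $d$-Cauchy; (2) $X_{g_\infty}$ and $D_{\{g_k\}}$ differ at most by a nullset; (3) $g_k(x)\to g_\infty(x)$ for a.e. $x\in M\setminus D_{\{g_k\}}$; (4) $\sum_{k=1}^\infty d(g_k,g_{k+1})<\infty$. *)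

(* Defs.v *)
From HB Require Import structures.
From mathcomp Require Import all_boot all_order all_algebra.
From mathcomp Require Import all_classical all_reals all_analysis.

Set Implicit Arguments.
Unset Strict Implicit.
Unset Printing Implicit Defensive.

Import Order.TTheory GRing.Theory Num.Theory.
Import numFieldNormedType.Exports.

Local Open Scope classical_set_scope.
Local Open Scope ring_scope.

Notation borel T := (g_sigma_algebraType (@open T)).

Section euclidean_space.
Variables (R : realType) (n : nat).
Implicit Types (f : 'rV[R]_n -> R) (U : set 'rV[R]_n) (P : 'M[R]_n).

(* [partials [:: a1; ...; ap] f] is d/dx^a1 ... d/dx^ap f *)
Definition partials (s : seq 'I_n) f : 'rV[R]_n -> R :=
  foldr (fun a (h : 'rV[R]_n -> R) y => 'D_(delta_mx 0 a) h y) f s.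

Definition smooth_on U f := forall (s : seq 'I_n) y, U y ->
  {for y, continuous (partials s f)} /\
  forall a, derivable (partials s f) y (delta_mx 0 a).

Definition pos_def P := forall v : 'rV[R]_n, v != 0 -> 0 < (v *m P *m v^T) 0 0.
Definition pos_semidef P := forall v : 'rV[R]_n, 0 <= (v *m P *m v^T) 0 0.
Definition symmetric_mx P := P^T = P.

End euclidean_space.

(* Lebesgue measure on R^n, as the n-fold product of lebesgue_measure
   (the integrand is the measure of a section, as in product_measure1);
   only its values on Borel sets are used. *)
Fixpoint lebesgue_rV (R : realType) (n : nat) : set (borel 'rV[R]_n) -> \bar R :=
  match n return set (borel 'rV[R]_n) -> \bar R with
  | 0 => fun A => (\1_A 0)%:E
  | n'.+1 => fun A => (\int[lebesgue_measure]_x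
      lebesgue_rV [set v : 'rV[R]_n' | A (row_mx (x%:M : 'M[R]_1) v)])%E
  end.

(* A smooth atlas, indexed by nat: manifolds are second countable, and charts
   are allowed to have an empty domain, so that finite atlases are covered.
   phi i is the i-th chart, with domain dom i and inverse psi i; both are
   total functions whose values off dom i and phi i @` dom i are junk. *)
Record smooth_atlas (R : realType) (n : nat) (M : topologicalType) := SmoothAtlas {
  dom : nat -> set M;
  phi : nat -> M -> 'rV[R]_n;
  psi : nat -> 'rV[R]_n -> M;
  open_dom : forall i, open (dom i);
  open_codom : forall i, open (phi i @` dom i);
  phiK : forall i x, dom i x -> psi i (phi i x) = x;
  continuous_phi : forall i x, dom i x -> {for x, continuous (phi i)};
  continuous_psi : forall i y, (phi i @` dom i) y -> {for y, continuous (psi i)};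
  dom_cover : forall x, exists i, x \in dom i;
  smooth_transition : forall i j b,
    smooth_on (phi i @` (dom i `&` dom j)) (fun y => phi j (psi i y) 0 b)
}.

Section orientability.
Variables (R : realType) (n : nat) (M : topologicalType).
Implicit Types A B : smooth_atlas R n M.

Definition compatible A B := forall i j b,
  smooth_on (phi A i @` (dom A i `&` dom B j))
            (fun y => phi B j (psi A i y) 0 b) /\
  smooth_on (phi B j @` (dom A i `&` dom B j))
            (fun y => phi A i (psi B j y) 0 b).

Definition oriented_atlas A := forall i j x, dom A i x -> dom A j x ->
  0 < \det ('J (phi A j \o psi A i) (phi A i x)).

Definition orientable A := exists2 B, compatible A B & oriented_atlas B.

End orientability.

Section tensor_fields.
Variables (R : realType) (n : nat) (M : ptopologicalType).
Variable A : smooth_atlas R n M.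

Definition chart_at (x : M) : nat := ex_minn (dom_cover A x).

(* T_xM is identified with R^n by means of the chart chart_at x, so that an
   arbitrary section of T*M (x) T*M is a function into 'M_n. *)
Definition tensor_field := M -> 'M[R]_n.
Implicit Types (t h k : tensor_field) (x : M) (Y : set M).

(* Matrix of t in the coordinates of an arbitrary chart i, at the point of
   coordinates y. 'J acts on row vectors: its rows are the images of the
   coordinate vectors of the chart i. *)
Definition in_chart (i : nat) t (y : 'rV[R]_n) : 'M[R]_n :=
  let x := psi A i y in
  let J := 'J (phi A (chart_at x) \o psi A i) y in
  J *m t x *m J^T.

Definition smooth_section t := forall i a b,
  smooth_on (phi A i @` dom A i) (fun y => in_chart i t y a b).

(* The Frechet space S and its open subset of Riemannian metrics *)
Definition smooth_sym_tensor : set tensor_field :=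
  [set t | (forall x, symmetric_mx (t x)) /\ smooth_section t].

Definition riem_metric : set tensor_field :=
  [set t | smooth_sym_tensor t /\ forall x, pos_def (t x)].

(* Convergence in the Frechet (C^oo) topology: uniform convergence of all
   partial derivatives of all components on compact subsets of the charts. *)
Definition frechet_cvg (T : Type) (F : set_system T) (u : T -> tensor_field) h :=
  forall i (s : seq 'I_n) a b (K : set 'rV[R]_n),
    compact K -> K `<=` phi A i @` dom A i ->
    forall e : R, 0 < e -> \forall r \near F, forall y, K y ->
      `|partials s (fun z => in_chart i (u r) z a b) y -
        partials s (fun z => in_chart i h z a b) y| < e.

(* mu_t, given locally by sqrt(det t) dx^1...dx^n: the sets of points x with
   chart_at x = i form a countable Borel partition of M, the i-th of which is
   contained in dom A i, and there t is given by its matrix in the chart i.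
   The library integral of a nonnegative function is a supremum over Borel
   simple functions below it, hence it is also the Lebesgue integral when t is
   only Lebesgue measurable. *)
Definition vol t (Y : set (borel M)) : \bar R :=
  (\sum_(0 <= i <oo)
     \int[@lebesgue_rV R n]_(y in phi A i @` (Y `&` [set x | chart_at x = i]))
        (Num.sqrt (\det (t (psi A i y))))%:E)%E.

Definition L2_inner g h k : R :=
  fine (\int[vol g]_x (\tr (invmx (g x) *m h x *m invmx (g x) *m k x))%:E)%E.

Definition L2_norm g h : R := Num.sqrt (L2_inner g h h).

(* On [0,1], c is a C^1 path of metrics with derivative dc, for the topology of S
   (one-sided at 0 and 1). *)
Definition C1_path (c dc : R -> tensor_field) := forall r : R, 0 <= r <= 1 ->
  [/\ riem_metric (c r),
      smooth_sym_tensor (dc r),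
      frechet_cvg (within [set` `[0, 1]] (r^'))
        (fun s x => (s - r)^-1 *: (c s x - c r x)) (dc r) &
      frechet_cvg (within [set` `[0, 1]] (nbhs r)) dc (dc r)].

(* l is the length of a piecewise C^1 path from g to h *)
Inductive path_length : tensor_field -> tensor_field -> R -> Prop :=
| path_length_C1 c dc of C1_path c dc :
    path_length (c 0) (c 1)
      (\int[lebesgue_measure]_(r in `[0, 1]) L2_norm (c r) (dc r))
| path_length_cat g h k l l' of path_length g h l & path_length h k l' :
    path_length g k (l + l').

Definition dist g h : R := inf [set l | path_length g h l].

Section reference_metric.
(* the reference metric *)
Variable g : tensor_field.

Definition nullset Y := negligible (vol g) Y.
Definition eq_mod_null Y Y' := nullset (Y `+` Y').

(* measurable for the completion of the Borel sigma-algebra *)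
Definition lebesgue_measurable Y :=
  exists2 B : set (borel M), measurable B & eq_mod_null Y B.

Definition measurable_section t := forall i a b (B : set R), measurable B ->
  lebesgue_measurable (dom A i `&` [set x | B (in_chart i t (phi A i x) a b)]).

Definition semimetric t := forall x, symmetric_mx (t x) /\ pos_semidef (t x).

Definition deflated t : set M := [set x | ~ pos_def (t x)].

Definition Mm : set tensor_field := [set t | semimetric t /\ measurable_section t].
Definition Mf : set tensor_field := [set t | Mm t /\ (vol t setT < +oo)%E].

Definition semimetric_equiv t t' :=
  eq_mod_null (deflated t) (deflated t') /\
  nullset [set x | ~ (deflated t `|` deflated t') x /\ t x <> t' x].

(* The quotients of Mm and Mf, as sets of equivalence classes. Equivalent
   semimetrics have the same volume (det t = 0 on deflated t), so a class in Mf
   is also a class in Mm. *)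
Definition Mm_hat : set (set tensor_field) :=
  [set C | exists2 t, Mm t & C = [set t' | Mm t' /\ semimetric_equiv t t']].
Definition Mf_hat : set (set tensor_field) :=
  [set C | exists2 t, Mf t & C = [set t' | Mf t' /\ semimetric_equiv t t']].

Implicit Type gs : nat -> tensor_field.

Definition deflated_seq gs : set M :=
  [set x | forall delta : R, 0 < delta ->
     exists k : nat, \det (invmx (g x) *m gs k x) < delta].

Definition dist_cauchy gs := forall e : R, 0 < e ->
  exists N, forall p q, (N <= p)%N -> (N <= q)%N -> dist (gs p) (gs q) < e.

Definition omega_cvg gs (C : set tensor_field) := forall ginf, C ginf ->
  [/\ dist_cauchy gs,
      eq_mod_null (deflated ginf) (deflated_seq gs),
      nullset [set x | ~ deflated_seq gs x /\
                       ~ ((fun k : nat => gs k x) @ \oo --> ginf x)] &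
      cvgn (series (fun k : nat => dist (gs k) (gs k.+1)))].

End reference_metric.
End tensor_fields.

(* Main.v *)
Require Import Defs.
From HB Require Import structures.
From mathcomp Require Import all_boot all_order all_algebra.
From mathcomp Require Import perm.
From mathcomp Require Import all_classical all_reals all_analysis measurable_realfun.
From mathcomp Require Import ring lra zify.

Set Implicit Arguments.
Unset Strict Implicit.
Unset Printing Implicit Defensive.

Import Order.TTheory GRing.Theory Num.Theory.
Import numFieldNormedType.Exports.

Local Open Scope classical_set_scope.
Local Open Scope ring_scope.

(** Throughout, densities are taken with respect to a measure nu on M that is the Lebesgue
    measure of one chart on each piece of a countable Borel partition ([base_measure]).
    The volume of a metric g has the density sqrt (det g), and the nullsets of the
    reference metric are nullsets of nu.

    The distance d of the L2 metric is squeezed between two elementary quantities.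

    Lower bound ([nrm2_qdet_le_dist]). The function f_g = (det g)^(1/4) ([qdet]) lies in
    L2(nu), and the norm of f_g - f_h in L2(nu) is at most a constant times d(g, h). At a
    point of M, the derivative of f along a path of metrics is bounded by the integrand of
    the L2 metric ([qdet_lipschitz]); integrating over M and along the path gives the claim,
    provided that the speed of a path is a continuous function of the time
    ([speed_continuous]), which is shown by dominated convergence.

    Upper bound ([dist_upper_bound]). Let q be the pointwise squared distance between g and
    h, measured with g and with h, and let s = 1 / (1 + q). The path from g to s^4 g, then
    linearly to s^4 h, then to h is short where q is small, because g and h are close
    there, and where det g and det h are small, because a deformation of a metric of small
    volume is cheap, however large it is. The result is that d(g, h)^2 is at most a
    constant times the integral of (1 - s) (f_g^2 + f_h^2). This requires the volumes to be
    finite ([vol_finite]), which is not immediate because the closure of a piece need not be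
    contained in the domain of its chart.

    By condition (4) of omega-convergence and the lower bound, the image under f of either
    sequence has a finite total variation in L2(nu), so that the f^2 are dominated by one
    integrable function and f converges almost everywhere ([summable_dist_dominated]). On
    the deflated set the limit of f has to be 0; off the deflated set both sequences converge
    to the same positive definite matrix, so that s tends to 1. In both cases the integrand of
    the upper bound tends to 0, and dominated convergence concludes ([dist_cvg0]). *)

(** * Pointwise linear algebra of positive definite matrices *)

Section linear_algebra.
Context {R : realType}.
Implicit Types n : nat.

Definition metric_mx n (P : 'M[R]_n) := symmetric_mx P /\ pos_def P.

(** Squared norm of h for the inner product that P induces on symmetric (0,2)-tensors. *)
Definition gnorm2 n (P h : 'M[R]_n) := \tr (invmx P *m h *m invmx P *m h).

Lemma entryD m n (X Y : 'M[R]_(m, n)) i j : (X + Y) i j = X i j + Y i j.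
Proof. by rewrite mxE. Qed.

Lemma entryN m n (X : 'M[R]_(m, n)) i j : (- X) i j = - X i j.
Proof. by rewrite mxE. Qed.

Lemma entryZ m n a (X : 'M[R]_(m, n)) i j : (a *: X) i j = a * X i j.
Proof. by rewrite mxE. Qed.

Lemma quad_sumE n (u v : 'rV[R]_n) : (u *m v^T) 0 0 = \sum_i u 0 i * v 0 i.
Proof. by rewrite mxE; apply: eq_bigr => i _; rewrite mxE. Qed.

Lemma quad_ge0 n (u : 'rV[R]_n) : 0 <= (u *m u^T) 0 0.
Proof. by rewrite quad_sumE; apply: sumr_ge0 => i _; rewrite -expr2 sqr_ge0. Qed.

Lemma quad_gt0 n (u : 'rV[R]_n) : u != 0 -> 0 < (u *m u^T) 0 0.
Proof.
move=> u0; rewrite lt0r quad_ge0 andbT; apply: contra u0 => /eqP.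
rewrite quad_sumE => /eqP; rewrite psumr_eq0; last first.
  by move=> i _; rewrite -expr2 sqr_ge0.
move=> /allP u0; apply/eqP/matrixP => i j; rewrite !mxE ord1.
by have := u0 j (mem_index_enum _); rewrite -expr2 sqrf_eq0 => /eqP.
Qed.

(** Gaussian elimination of the first variable: the Schur complement of a
    positive definite matrix is positive definite. *)
Lemma cholesky n (P : 'M[R]_n) : metric_mx P ->
  exists2 L : 'M[R]_n, L \in unitmx & P = L *m L^T.
Proof.
elim: n P => [|n IHn] P [symP posP].
  by exists 1%:M; [exact: unitmx1|apply/matrixP => -[]].
move: P symP posP; rewrite -[n.+1]/(1 + n)%N => P symP posP.
pose al := P 0 0; pose v := ursubmx P; pose Q := drsubmx P.
have EP : P = block_mx al%:M v v^T Q.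
  rewrite -[LHS]submxK; congr block_mx.
  - by rewrite [LHS]mx11_scalar; congr (_%:M); rewrite !mxE; congr (P _ _); exact/val_inj.
  - by rewrite /v trmx_ursub symP.
have symQ : Q^T = Q by rewrite /Q trmx_drsub symP.
have quadP a (w : 'rV[R]_n) : (row_mx a%:M w *m P *m (row_mx a%:M w)^T) 0 0 =
    al * a ^+ 2 + 2 * a * (v *m w^T) 0 0 + (w *m Q *m w^T) 0 0.
  rewrite EP mul_row_block tr_row_mx mul_row_col !mulmxDl tr_scalar_mx.
  rewrite -!scalar_mxM !mul_scalar_mx.
  rewrite -!scalemxAl !mul_mx_scalar.
  have E : (w *m v^T) 0 0 = (v *m w^T) 0 0.
    by rewrite -[in LHS](trmxK w) -trmx_mul mxE.
  rewrite !entryD !entryZ E [(_%:M) 0 0]mxE eqxx mulr1n.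
  by rewrite /=; ring.
have al0 : 0 < al.
  have /posP : row_mx 1%:M (0 : 'rV[R]_n) != 0.
    apply/eqP => /matrixP /(_ 0 (lshift _ 0)); rewrite row_mxEl !mxE /= => /eqP.
    by rewrite oner_eq0.
  by rewrite quadP trmx0 !mulmx0 mxE expr1n mulr1 mulr0 !addr0.
have alN0 : al != 0 by rewrite gt_eqF.
pose S := Q - al^-1 *: (v^T *m v).
have [L' uL' SE] : exists2 L : 'M[R]_n, L \in unitmx & S = L *m L^T.
  apply: IHn; split.
    by rewrite /symmetric_mx linearB linearZ /= trmx_mul trmxK symQ.
  move=> w w0; have : row_mx (- al^-1 * (v *m w^T) 0 0)%:M w != 0.
    by apply: contra w0 => /eqP; rewrite -[X in _ = X]row_mx0 => /eq_row_mx[_ ->].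
  move=> /posP; rewrite quadP /S mulmxBr mulmxBl.
  rewrite -scalemxAr -scalemxAl mulmxA -(mulmxA (w *m _)).
  rewrite entryD entryN entryZ -mulmxA [in (w *m v^T *m _) 0 0](mx11_scalar (v *m w^T)).
  rewrite mul_mx_scalar entryZ.
  have -> : (w *m v^T) 0 0 = (v *m w^T) 0 0.
    by rewrite -[in LHS](trmxK w) -trmx_mul mxE.
  move=> h; apply: lt_le_trans h _; rewrite le_eqVlt; apply/orP; left; apply/eqP.
  by field.
pose L := block_mx (Num.sqrt al)%:M 0 ((Num.sqrt al)^-1 *: v^T) L'.
have sal0 : 0 < Num.sqrt al by rewrite sqrtr_gt0.
exists L.
  by rewrite unitmxE det_lblock det_scalar1 unitrM unitfE (gt_eqF sal0) -unitmxE uL'.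
rewrite EP /L tr_block_mx mulmx_block trmx0 !mulmx0 !mul0mx !addr0.
rewrite tr_scalar_mx linearZ /= trmxK; congr block_mx.
- by rewrite -scalar_mxM -expr2 sqr_sqrtr ?ltW.
- by rewrite mul_scalar_mx scalerA mulfV ?gt_eqF// scale1r.
- by rewrite mul_mx_scalar scalerA mulfV ?gt_eqF// scale1r.
- rewrite -scalemxAr -scalemxAl scalerA -invfM -expr2 sqr_sqrtr ?ltW// -SE /S.
  by rewrite addrC subrK.
Qed.

Lemma metric_mx_unit n (P : 'M[R]_n) : metric_mx P -> P \in unitmx.
Proof. by move=> /cholesky[L uL ->]; rewrite unitmx_mul unitmx_tr uL. Qed.

Lemma metric_mx_det n (P : 'M[R]_n) : metric_mx P -> 0 < \det P.
Proof.
move=> /cholesky[L uL ->]; rewrite det_mulmx det_tr -expr2 exprn_even_gt0//=.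
by rewrite -unitfE -unitmxE.
Qed.

Lemma metric_mxMtr n (L : 'M[R]_n) : L \in unitmx -> metric_mx (L *m L^T).
Proof.
move=> uL; split; first by rewrite /symmetric_mx trmx_mul trmxK.
move=> v v0; rewrite mulmxA -mulmxA -trmx_mul; apply: quad_gt0.
by apply: contra v0 => /eqP vL; rewrite -(mulmxK uL v) vL mul0mx.
Qed.

Lemma metric_mx_congr n (J P : 'M[R]_n) : J \in unitmx -> metric_mx P ->
  metric_mx (J *m P *m J^T).
Proof.
move=> uJ /cholesky[L uL ->].
by rewrite mulmxA -mulmxA -trmx_mul; apply: metric_mxMtr; rewrite unitmx_mul uJ.
Qed.

Lemma metric_mxV n (P : 'M[R]_n) : metric_mx P -> metric_mx (invmx P).
Proof.
move=> mP; have uP := metric_mx_unit mP.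
have -> : invmx P = invmx P *m P *m (invmx P)^T.
  by rewrite trmx_inv mP.1 mulVmx// mul1mx.
by apply: metric_mx_congr; rewrite ?unitmx_inv.
Qed.

Lemma metric_mxZ n (s : R) (P : 'M[R]_n) : 0 < s -> metric_mx P -> metric_mx (s *: P).
Proof.
move=> s0 [sP pP]; split; first by rewrite /symmetric_mx linearZ /= sP.
by move=> v /pP; rewrite -scalemxAr -scalemxAl [X in _ -> _ < X]mxE pmulr_rgt0.
Qed.

Lemma metric_mx_convex n (t : R) (P Q : 'M[R]_n) : 0 <= t <= 1 ->
  metric_mx P -> metric_mx Q -> metric_mx ((1 - t) *: P + t *: Q).
Proof.
move=> /andP[t0 t1] [sP pP] [sQ pQ]; split.
  by rewrite /symmetric_mx linearD !linearZ /= sP sQ.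
move=> v v0; rewrite mulmxDr mulmxDl -!scalemxAr -!scalemxAl !mxE.
have := pP _ v0; have := pQ _ v0; rewrite !mxE; nra.
Qed.

Lemma invmx_mul n (X Y : 'M[R]_n) : X \in unitmx -> Y \in unitmx ->
  invmx (X *m Y) = invmx Y *m invmx X.
Proof.
move=> uX uY; have uXY : X *m Y \in unitmx by rewrite unitmx_mul uX.
by rewrite -[RHS](mulmxK uXY) !mulmxA (mulmxKV uX) mulVmx// mul1mx.
Qed.

Lemma gnorm2_congr n (J P h : 'M[R]_n) : J \in unitmx -> P \in unitmx ->
  gnorm2 (J *m P *m J^T) (J *m h *m J^T) = gnorm2 P h.
Proof.
move=> uJ uP; rewrite /gnorm2 !invmx_mul ?unitmx_mul ?unitmx_tr ?uJ ?uP//.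
have uJt : J^T \in unitmx by rewrite unitmx_tr.
rewrite !mulmxA !(mulmxKV uJ) !(mulmxK uJt) -!mulmxA mxtrace_mulC.
by rewrite !mulmxA (mulmxK uJt).
Qed.

Lemma gnorm2Z n a (P h : 'M[R]_n) : gnorm2 P (a *: h) = a ^+ 2 * gnorm2 P h.
Proof.
by rewrite /gnorm2 -!(scalemxAr, scalemxAl) scalerA linearZ /= expr2.
Qed.

Lemma gnorm2Zl n s (P h : 'M[R]_n) : s != 0 -> P \in unitmx ->
  gnorm2 (s *: P) h = s ^- 2 * gnorm2 P h.
Proof.
move=> s0 uP; rewrite /gnorm2 !invmxZ ?unitmxZ ?unitfE//.
by rewrite -!(scalemxAr, scalemxAl) scalerA linearZ /= expr2 invfM.
Qed.

Lemma gnorm2_self n (P : 'M[R]_n) : P \in unitmx -> gnorm2 P P = n%:R.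
Proof.
by move=> uP; rewrite /gnorm2 mulVmx// mul1mx mulVmx// mxtrace1.
Qed.

Definition frob2 n (K : 'M[R]_n) := \sum_i \sum_j K i j ^+ 2.

Lemma frob2_ge0 n (K : 'M[R]_n) : 0 <= frob2 K.
Proof. by apply: sumr_ge0 => i _; apply: sumr_ge0 => j _; rewrite sqr_ge0. Qed.

Lemma frob2_entry n (K : 'M[R]_n) i j : K i j ^+ 2 <= frob2 K.
Proof.
rewrite /frob2 (bigD1 i)//= (bigD1 j)//= -addrA lerDl addr_ge0//.
  by apply: sumr_ge0 => k _; rewrite sqr_ge0.
by apply: sumr_ge0 => k _; apply: sumr_ge0 => l _; rewrite sqr_ge0.
Qed.

(** The rows of the inverse of a Cholesky factor of P form a P-orthonormal frame, in
    which P is the identity and [gnorm2 P] is the squared Frobenius norm. *)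
Lemma gnorm2_frame n (P : 'M[R]_n) : metric_mx P ->
  exists2 L : 'M[R]_n, L \in unitmx & P = L *m L^T /\
  (forall h, symmetric_mx h -> exists2 K : 'M[R]_n,
     h = L *m K *m L^T & gnorm2 P h = frob2 K).
Proof.
move=> /cholesky[L uL EP]; have uLt : L^T \in unitmx by rewrite unitmx_tr.
exists L => //; split=> // h sh; pose K := invmx L *m h *m invmx L^T.
have hE : h = L *m K *m L^T by rewrite /K !mulmxA mulmxV// mul1mx mulmxKV.
exists K => //.
have sK : K^T = K.
  by rewrite /K !trmx_mul sh !trmx_inv trmxK mulmxA.
rewrite {1}hE EP -[X in gnorm2 (X *m _)]mulmx1 gnorm2_congr ?unitmx1//.
rewrite /gnorm2 invmx1 !mul1mx mulmx1.
rewrite /mxtrace /frob2; apply: eq_bigr => i _; rewrite mxE; apply: eq_bigr => j _.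
have -> : K j i = K i j by rewrite -{1}sK mxE.
by rewrite expr2.
Qed.

Lemma gnorm2_ge0 n (P h : 'M[R]_n) : metric_mx P -> symmetric_mx h -> 0 <= gnorm2 P h.
Proof.
by move=> /gnorm2_frame[L _ [_ H]] /H[K _ ->]; exact: frob2_ge0.
Qed.

Lemma symmetric_mxD n (h k : 'M[R]_n) : symmetric_mx h -> symmetric_mx k ->
  symmetric_mx (h + k).
Proof. by move=> sh sk; rewrite /symmetric_mx linearD /= sh sk. Qed.

Lemma symmetric_mxZ n a (h : 'M[R]_n) : symmetric_mx h -> symmetric_mx (a *: h).
Proof. by move=> sh; rewrite /symmetric_mx linearZ /= sh. Qed.

Lemma symmetric_mxB n (h k : 'M[R]_n) : symmetric_mx h -> symmetric_mx k ->
  symmetric_mx (h - k).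
Proof. by move=> sh sk; rewrite /symmetric_mx linearB /= sh sk. Qed.

(** The parallelogram law gives the constant 2; the estimates below never need a sharp
    triangle inequality for [gnorm2]. *)
Lemma gnorm2D_le n (P h k : 'M[R]_n) : metric_mx P -> symmetric_mx h ->
  symmetric_mx k -> gnorm2 P (h + k) <= 2 * (gnorm2 P h + gnorm2 P k).
Proof.
move=> mP sh sk; have [L uL [_ H]] := gnorm2_frame mP.
have Linj (X Y : 'M[R]_n) : L *m X *m L^T = L *m Y *m L^T -> X = Y.
  move=> /(congr1 (fun Z => invmx L *m Z *m invmx L^T)).
  by rewrite !mulmxA !mulVmx// !mul1mx !mulmxK ?unitmx_tr.
have [K hE ->] := H _ sh; have [K' kE ->] := H _ sk.
have [K'' hkE ->] := H _ (symmetric_mxD sh sk).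
have -> : K'' = K + K'.
  by apply: Linj; rewrite -hkE hE kE mulmxDr mulmxDl.
rewrite /frob2 -big_split mulr_sumr; apply: ler_sum => i _.
rewrite -big_split mulr_sumr; apply: ler_sum => j _ /=; rewrite mxE.
by have := sqr_ge0 (K i j - K' i j); nra.
Qed.

Definition loewner_le n (P Q : 'M[R]_n) :=
  forall v : 'rV[R]_n, (v *m P *m v^T) 0 0 <= (v *m Q *m v^T) 0 0.

(** v Q^-1 v^T is the maximum over u of 2 v u^T - u Q u^T, which decreases as Q
    increases. *)
Lemma loewner_leV n (P Q : 'M[R]_n) : metric_mx P -> metric_mx Q ->
  loewner_le P Q -> loewner_le (invmx Q) (invmx P).
Proof.
move=> mP mQ PQ v; have uP := metric_mx_unit mP; have uQ := metric_mx_unit mQ.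
pose u := v *m invmx Q; pose w := v *m invmx P - u.
have uT : u^T = invmx Q *m v^T by rewrite /u trmx_mul trmx_inv mQ.1.
have Eu : (u *m Q *m u^T) 0 0 = (v *m invmx Q *m v^T) 0 0.
  by rewrite uT /u mulmxKV// mulmxA.
have Ew : (w *m P *m w^T) 0 0 = (v *m invmx P *m v^T) 0 0 +
    (u *m P *m u^T) 0 0 - 2 * (v *m invmx Q *m v^T) 0 0.
  rewrite /w mulmxBl (mulmxKV uP) linearB /= trmx_mul trmx_inv mP.1.
  rewrite mulmxBl !mulmxBr uT !mulmxA (mulmxK uP) -[v *m invmx Q]/u.
  rewrite !entryD !entryN !entryD !entryN.
  by ring.
have w0 : 0 <= (w *m P *m w^T) 0 0.
  have [->|wN0] := eqVneq w 0; first by rewrite !mul0mx mxE.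
  exact/ltW/mP.2.
have := PQ u; rewrite Eu; move: w0; rewrite Ew; lra.
Qed.

(** The trace is linear in each of the two factors P^-1, and increasing in each when
    the other one is positive: they are exchanged one after the other. *)
Lemma gnorm2_mono n (P Q h : 'M[R]_n) : metric_mx P -> metric_mx Q ->
  symmetric_mx h -> loewner_le P Q -> gnorm2 Q h <= gnorm2 P h.
Proof.
move=> mP mQ sh PQ; have VQP := loewner_leV mP mQ PQ.
have step (S : 'M[R]_n) : metric_mx S ->
    \tr (S *m h *m invmx Q *m h) <= \tr (S *m h *m invmx P *m h).
  move=> /cholesky[N _ ->].
  have E (X : 'M[R]_n) : \tr (N *m N^T *m h *m X *m h) =
      \sum_i (row i (N^T *m h) *m X *m (row i (N^T *m h))^T) 0 0.
    rewrite -!mulmxA mxtrace_mulC /mxtrace; apply: eq_bigr => i _.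
    have -> : N^T *m (h *m (X *m h)) *m N = (N^T *m h *m X) *m (h *m N).
      by rewrite !mulmxA.
    rewrite tr_row trmx_mul trmxK sh -row_mul [LHS]mxE [RHS]mxE.
    by apply: eq_bigr => j _; congr (_ * _); rewrite [RHS]mxE.
  by rewrite !E; apply: ler_sum => i _; exact: VQP.
rewrite /gnorm2 (le_trans (step _ (metric_mxV mQ)))//.
rewrite -mulmxA mxtrace_mulC mulmxA; exact/step/metric_mxV.
Qed.

Lemma det_entries_le n (K : 'M[R]_n) (B : R) : (forall i j, `|K i j| <= B) ->
  `|\det K| <= n`!%:R * B ^+ n.
Proof.
move=> KB; rewrite /determinant (le_trans (ler_norm_sum _ _ _))//.
have -> : n`!%:R * B ^+ n = \sum_(s : {perm 'I_n}) B ^+ n.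
  by rewrite sumr_const mulr_natl card_Sn.
apply: ler_sum => s _; rewrite normrM normrX normrN1 expr1n mul1r normr_prod.
rewrite -[X in _ <= B ^+ X]card_ord -prodr_const; apply: ler_prod => i _.
by rewrite normr_ge0 KB.
Qed.

Lemma prod_lipschitz (I : Type) (r : seq I) (a b : I -> R) (B k : R) : 1 <= B ->
  (forall i, `|a i| <= B) -> (forall i, `|b i| <= B) ->
  (forall i, `|a i - b i| <= k) ->
  `|\prod_(i <- r) a i - \prod_(i <- r) b i| <= (size r)%:R * B ^+ size r * k.
Proof.
move=> B1 aB bB abk; elim: r => [|x r IHr] /=.
  by rewrite !big_nil subrr normr0 !mul0r.
have B0 : 0 <= B by rewrite (le_trans ler01).
have k0 : 0 <= k by rewrite (le_trans _ (abk x)).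
have pb : `|\prod_(i <- r) b i| <= B ^+ size r.
  elim: r {IHr} => [|y r IHr]; first by rewrite big_nil normr1.
  by rewrite big_cons normrM exprS ler_pM.
rewrite !big_cons.
have -> : a x * \prod_(j <- r) a j - b x * \prod_(j <- r) b j =
   a x * (\prod_(j <- r) a j - \prod_(j <- r) b j) +
   (a x - b x) * \prod_(j <- r) b j by ring.
rewrite (le_trans (ler_normD _ _))// !normrM.
have h1 := ler_pM (normr_ge0 _) (normr_ge0 _) (aB x) IHr.
have h2 := ler_pM (normr_ge0 _) (normr_ge0 _) (abk x) pb.
have h3 : k * B ^+ size r <= k * (B * B ^+ size r).
  rewrite ler_wpM2l// -[leLHS]mul1r ler_wpM2r// exprn_ge0//.
rewrite (le_trans (lerD h1 (le_trans h2 h3)))// exprS -natr1.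
by rewrite le_eqVlt; apply/orP; left; apply/eqP; ring.
Qed.

(** A Lipschitz constant of the determinant at the identity, for the Frobenius norm on
    its unit ball: n! products of n factors of absolute value at most 2. *)
Definition det_lip n : R := n`!%:R * (n%:R * 2 ^+ n).

Lemma det_lip_ge0 n : 0 <= det_lip n.
Proof. by rewrite /det_lip !mulr_ge0// exprn_ge0. Qed.

Lemma det1D_le n (K : 'M[R]_n) : frob2 K <= 1 ->
  `|\det (1%:M + K) - 1| <= det_lip n * Num.sqrt (frob2 K).
Proof.
move=> K1; rewrite -[X in _ - X](det1 R n) /determinant -sumrB.
rewrite (le_trans (ler_norm_sum _ _ _))//.
have -> : det_lip n * Num.sqrt (frob2 K) =
   \sum_(s : {perm 'I_n}) n%:R * 2 ^+ n * Num.sqrt (frob2 K).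
  by rewrite sumr_const /det_lip -!mulrA mulr_natl card_Sn.
have Kk i j : `|K i j| <= Num.sqrt (frob2 K).
  by rewrite -sqrtr_sqr ler_wsqrtr// frob2_entry.
have K1' i j : `|K i j| <= 1.
  by rewrite (le_trans (Kk i j))// -sqrtr1 ler_wsqrtr.
have d1 i j : `|(1%:M : 'M[R]_n) i j| <= 1.
  by rewrite mxE; case: (_ == _); rewrite ?mulr1n ?mulr0n ?normr1 ?normr0.
apply: ler_sum => s _; rewrite -mulrBr normrM normrX normrN1 expr1n mul1r.
have := @prod_lipschitz 'I_n (index_enum 'I_n)
  (fun i => (1%:M + K) i (s i)) (fun i => (1%:M : 'M[R]_n) i (s i)) 2
  (Num.sqrt (frob2 K)).
have -> : size (index_enum 'I_n) = n by rewrite -sum1_size big_const card_ord iter_addn mul1n addn0.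
apply => //.
- by rewrite ler1n.
- move=> i; rewrite mxE (le_trans (ler_normD _ _))//.
  by rewrite -[2]/(1 + 1) lerD.
- by move=> i; rewrite (le_trans (d1 _ _))// ler1n.
- by move=> i; rewrite mxE addrAC subrr add0r.
Qed.

(** The square root of the volume density of a metric: a square integrable function on M,
    whose rate of change along a path is controlled by the speed of the path. *)
Definition qdet n (P : 'M[R]_n) := Num.sqrt (Num.sqrt (\det P)).

Lemma qdet_ge0 n (P : 'M[R]_n) : 0 <= qdet P.
Proof. exact: sqrtr_ge0. Qed.

Lemma qdetK n (P : 'M[R]_n) : qdet P ^+ 2 = Num.sqrt (\det P).
Proof. by rewrite sqr_sqrtr// sqrtr_ge0. Qed.

Lemma sqrt_sub1_le (y : R) : 0 <= y -> `|Num.sqrt y - 1| <= `|y - 1|.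
Proof.
move=> y0; have s0 := sqrtr_ge0 y.
have -> : y - 1 = (Num.sqrt y - 1) * (Num.sqrt y + 1).
  by rewrite -{1}(sqr_sqrtr y0); ring.
by rewrite normrM ler_peMr// ger0_norm ?addr_ge0// lerDr.
Qed.

(** Both sides scale by the square root of det P under a change of frame, which reduces
    the claim to P = 1, where square roots contract towards 1. The right-hand side is,
    up to the constant, the integrand of the L2 metric. *)
Lemma qdet_lipschitz n (P Q : 'M[R]_n) : metric_mx P -> metric_mx Q ->
  gnorm2 P (Q - P) <= 1 ->
  (qdet Q - qdet P) ^+ 2 <= det_lip n ^+ 2 * (gnorm2 P (Q - P) * Num.sqrt (\det P)).
Proof.
move=> mP mQ; have [L uL [EP H]] := gnorm2_frame mP.
have [K hE ->] := H _ (symmetric_mxB mQ.1 mP.1) => K1.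
have EQ : Q = L *m (1%:M + K) *m L^T.
  by rewrite mulmxDr mulmxDl mulmx1 -hE EP addrC subrK.
have dP0 := metric_mx_det mP; have dQ0 := metric_mx_det mQ.
have dE : \det Q = \det P * \det (1%:M + K).
  by rewrite EQ EP !det_mulmx; ring.
have d1 : 0 < \det (1%:M + K) by rewrite -(pmulr_rgt0 _ dP0) -dE.
rewrite /qdet dE sqrtrM ?(ltW dP0)// sqrtrM ?sqrtr_ge0//.
rewrite -[X in (_ - X) ^+ 2]mulr1 -mulrBr exprMn -/(qdet P) qdetK.
rewrite [leRHS]mulrA [leLHS]mulrC ler_wpM2r ?sqrtr_ge0//.
rewrite -real_normK ?num_real//.
have h1 : `|Num.sqrt (Num.sqrt (\det (1%:M + K))) - 1| <= det_lip n * Num.sqrt (frob2 K).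
  rewrite (le_trans (sqrt_sub1_le (sqrtr_ge0 _)))//.
  by rewrite (le_trans (sqrt_sub1_le (ltW d1)))// det1D_le.
rewrite (le_trans (lerXn2r 2 _ _ h1)) ?nnegrE ?mulr_ge0 ?det_lip_ge0 ?sqrtr_ge0//.
by rewrite exprMn sqr_sqrtr// frob2_ge0.
Qed.

Lemma quad_entries_le n (K : 'M[R]_n) (k : R) (v : 'rV[R]_n) :
  (forall i j, `|K i j| <= k) ->
  `|(v *m K *m v^T) 0 0| <= n%:R * k * (v *m v^T) 0 0.
Proof.
move=> Kk; rewrite (quad_sumE v v) mxE.
have -> : \sum_j (v *m K) 0 j * v^T j 0 =
    \sum_j \sum_i v 0 i * K i j * v 0 j.
  by apply: eq_bigr => j _; rewrite mxE mulr_suml; apply: eq_bigr => i _; rewrite mxE.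
have -> : n%:R * k * \sum_i v 0 i * v 0 i =
    \sum_(j < n) \sum_(i < n) k * 2^-1 * (v 0 i * v 0 i + v 0 j * v 0 j).
  have -> : \sum_(j < n) \sum_(i < n) k * 2^-1 * (v 0 i * v 0 i + v 0 j * v 0 j) =
     k * 2^-1 * (n%:R * (\sum_(i < n) v 0 i * v 0 i) +
                 n%:R * (\sum_(i < n) v 0 i * v 0 i)).
    under eq_bigr => j _ do rewrite -mulr_sumr big_split /= sumr_const card_ord.
    rewrite -mulr_sumr big_split /= sumr_const card_ord -mulr_natl.
    by rewrite sumrMnl !mulr_natl.
  by field.
rewrite (le_trans (ler_norm_sum _ _ _))//; apply: ler_sum => j _.
rewrite (le_trans (ler_norm_sum _ _ _))//; apply: ler_sum => i _.
rewrite !normrM.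
have k0 : 0 <= k by rewrite (le_trans _ (Kk i j)).
have h1 : `|v 0 i| * `|K i j| * `|v 0 j| <= k * (`|v 0 i| * `|v 0 j|).
  rewrite mulrAC mulrC ler_wpM2r// mulr_ge0//.
rewrite (le_trans h1)// -mulrA ler_wpM2l//.
have := sqr_ge0 (`|v 0 i| - `|v 0 j|).
rewrite -!expr2 -(real_normK (num_real (v 0 i))) -(real_normK (num_real (v 0 j))).
by nra.
Qed.

(** Within this squared distance of P, a metric dominates P / 2: in a P-orthonormal frame
    the entries of the difference are at most 1 / (2 (n + 1)), so that the quadratic form
    of the difference is at most half of the standard one. *)
Definition half_radius n : R := (4 * (n.+1)%:R ^+ 2)^-1.

Lemma half_radius_gt0 n : 0 < half_radius n.
Proof. by rewrite invr_gt0 mulr_gt0// exprn_gt0. Qed.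

Lemma half_radius_le1 n : half_radius n <= 1.
Proof.
rewrite invf_le1 ?mulr_gt0 ?exprn_gt0//.
have : 1 <= (n.+1)%:R ^+ 2 :> R by rewrite exprn_ege1// ler1n.
lra.
Qed.

Lemma loewner_half n (P Q : 'M[R]_n) : metric_mx P -> metric_mx Q ->
  gnorm2 P (Q - P) <= half_radius n -> loewner_le (2^-1 *: P) Q.
Proof.
move=> mP mQ; have [L uL [EP H]] := gnorm2_frame mP.
have [K hE ->] := H _ (symmetric_mxB mQ.1 mP.1) => K1 v.
have EQ : Q = P + L *m K *m L^T by rewrite -hE addrC subrK.
pose w := v *m L.
have Ew (X : 'M[R]_n) : v *m (L *m X *m L^T) *m v^T = w *m X *m w^T.
  by rewrite /w trmx_mul !mulmxA.
have EPw : v *m P *m v^T = w *m w^T.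
  by rewrite EP -[X in X *m L^T]mulmx1 Ew mulmx1.
rewrite EQ mulmxDr mulmxDl -scalemxAr -scalemxAl !entryD.
rewrite !entryZ Ew EPw.
have /(quad_entries_le w) : forall i j, `|K i j| <= (2 * (n.+1)%:R)^-1.
  move=> i j; rewrite -(@ler_pXn2r _ 2) ?nnegrE ?invr_ge0//.
  rewrite real_normK ?num_real// (le_trans (frob2_entry _ _ _))//.
  by rewrite (le_trans K1)// /half_radius exprVn exprMn -(natrX _ 2 2).
have w0 := quad_ge0 w; rewrite ler_norml => /andP[wK _].
have nn : n%:R * (2 * (n.+1)%:R)^-1 <= 2^-1 :> R.
  rewrite invfM mulrCA -[leRHS]mulr1 ler_wpM2l// ler_pdivrMr// mul1r ler_nat.
  exact: leqnSn.
have := ler_wpM2r w0 nn; move: wK; set c := _ / _; lra.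
Qed.

Lemma gnorm2_loewner_half n (P Q h : 'M[R]_n) : metric_mx P -> metric_mx Q ->
  symmetric_mx h -> loewner_le (2^-1 *: P) Q -> gnorm2 Q h <= 4 * gnorm2 P h.
Proof.
move=> mP mQ sh PQ.
have mP2 : metric_mx (2^-1 *: P) by apply: metric_mxZ => //; rewrite invr_gt0.
rewrite (le_trans (gnorm2_mono mP2 mQ sh PQ))//.
rewrite gnorm2Zl ?invr_eq0 ?pnatr_eq0 ?metric_mx_unit//.
by rewrite exprVn invrK -natrX.
Qed.

Lemma gnorm2_half n (P Q h : 'M[R]_n) : metric_mx P -> metric_mx Q ->
  symmetric_mx h -> gnorm2 P (Q - P) <= half_radius n ->
  gnorm2 Q h <= 4 * gnorm2 P h.
Proof.
by move=> mP mQ sh PQ; exact: gnorm2_loewner_half (loewner_half mP mQ PQ).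
Qed.

(** In a P-orthonormal frame the entries of 1 + t K are at most 2 + |K|^2, and the Leibniz
    formula bounds the determinant. *)
Lemma sqrt_det_line n (P h : 'M[R]_n) (t : R) : 0 <= t <= 1 -> metric_mx P ->
  symmetric_mx h -> metric_mx (P + t *: h) ->
  Num.sqrt (\det (P + t *: h)) <=
  n`!%:R * (2 + gnorm2 P h) ^+ n * Num.sqrt (\det P).
Proof.
move=> /andP[t0 t1] mP sh mPt; have [L uL [EP H]] := gnorm2_frame mP.
have q0 := gnorm2_ge0 mP sh.
have [K hE qE] := H _ sh; rewrite qE in q0 *.
have dE : \det (P + t *: h) = \det P * \det (1%:M + t *: K).
  have -> : P + t *: h = L *m (1%:M + t *: K) *m L^T.
    by rewrite mulmxDr mulmxDl mulmx1 -EP -scalemxAr -scalemxAl -hE.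
  by rewrite EP !det_mulmx; ring.
have dP0 := metric_mx_det mP.
have := metric_mx_det mPt; rewrite dE pmulr_rgt0// => d0.
rewrite sqrtrM ?(ltW dP0)// [leLHS]mulrC ler_wpM2r ?sqrtr_ge0//.
have B1 : 1 <= n`!%:R * (2 + frob2 K) ^+ n.
  by rewrite mulr_ege1 ?ler1n ?fact_gt0// exprn_ege1//; lra.
have : \det (1%:M + t *: K) <= n`!%:R * (2 + frob2 K) ^+ n.
  rewrite (le_trans (ler_norm _))//; apply: det_entries_le => i j.
  rewrite !mxE (le_trans (ler_normD _ _))//.
  have -> : 2 + frob2 K = 1 + (1 + frob2 K) by ring.
  apply: lerD; first by case: (_ == _); rewrite ?mulr1n ?mulr0n ?normr1 ?normr0.
  rewrite normrM (ger0_norm t0) (@le_trans _ _ `|K i j|)//.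
    by rewrite ler_piMl.
  have := frob2_entry K i j; rewrite -real_normK ?num_real//.
  have := sqr_ge0 (`|K i j| - 1); have := normr_ge0 (K i j); nra.
move=> dB; rewrite -(@ler_pXn2r _ 2) ?nnegrE ?sqrtr_ge0 ?(le_trans ler01)//.
rewrite sqr_sqrtr ?(ltW d0)// (le_trans dB)// expr2 ler_peMl// (le_trans ler01)//.
Qed.

(** Each point of the segment from P to Q dominates half of the nearer end point, and
    [gnorm2] decreases in the metric. *)
Lemma gnorm2_line n (P Q : 'M[R]_n) (t : R) : 0 <= t <= 1 -> metric_mx P ->
  metric_mx Q -> gnorm2 ((1 - t) *: P + t *: Q) (Q - P) <=
  4 * (gnorm2 P (Q - P) + gnorm2 Q (Q - P)).
Proof.
move=> t01 mP mQ; have sh := symmetric_mxB mQ.1 mP.1.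
have mt := metric_mx_convex t01 mP mQ; move/andP: t01 => [t0 t1].
have q0 := gnorm2_ge0 mP sh; have q1 := gnorm2_ge0 mQ sh.
have quad (X : 'M[R]_n) : metric_mx X -> forall v : 'rV[R]_n, 0 <= (v *m X *m v^T) 0 0.
  move=> mX v; have [->|v0] := eqVneq v 0; first by rewrite !mul0mx mxE.
  exact/ltW/mX.2.
have [t2|t2] := leP t 2^-1.
- rewrite (le_trans (gnorm2_loewner_half mP mt sh _))//; last by rewrite ler_wpM2l// lerDl.
  move=> v; rewrite mulmxDr mulmxDl -!(scalemxAr, scalemxAl).
  rewrite !entryD !entryZ.
  by have := quad _ mP v; have := quad _ mQ v; nra.
- rewrite (le_trans (gnorm2_loewner_half mQ mt sh _))//; last by rewrite ler_wpM2l// lerDr.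
  move=> v; rewrite mulmxDr mulmxDl -!(scalemxAr, scalemxAl).
  rewrite !entryD !entryZ.
  by have := quad _ mP v; have := quad _ mQ v; nra.
Qed.

End linear_algebra.

(** * Differential calculus of the functions with continuous partial derivatives *)

Section norm_of_matrices.
Context {R : realType}.

Lemma mx_entry_le m n (v : 'M[R]_(m, n)) i j : `|v i j| <= `|v|.
Proof.
rewrite [leRHS]/Num.norm/= mx_normrE.
by apply: (le_trans _ (le_bigmax _ _ (i, j))).
Qed.

Lemma mx_norm_le m n (v : 'M[R]_(m, n)) e : 0 <= e ->
  (forall i j, `|v i j| <= e) -> `|v| <= e.
Proof.
move=> e0 ve; rewrite [leLHS]/Num.norm/= mx_normrE bigmax_le//= => -[i j] _.
Qed.

Lemma mx_norm_lt m n (v : 'M[R]_(m, n)) e : 0 < e ->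
  (forall i j, `|v i j| < e) -> `|v| < e.
Proof.
move=> e0 ve; rewrite [ltLHS]/Num.norm/= mx_normrE bigmax_lt//= => -[i j] _.
Qed.

Lemma mulmx_norm_le m n p (v : 'M[R]_(m, n)) (J : 'M[R]_(n, p)) :
  `|v *m J| <= n%:R * `|v| * `|J|.
Proof.
apply: mx_norm_le => [|i j]; first by rewrite !mulr_ge0.
rewrite mxE (le_trans (ler_norm_sum _ _ _))//.
have -> : n%:R * `|v| * `|J| = \sum_(k < n) `|v| * `|J|.
  by rewrite sumr_const card_ord -mulrA mulr_natl.
by apply: ler_sum => k _; rewrite normrM ler_pM// mx_entry_le.
Qed.

Lemma mulmxr_continuous m n p (J : 'M[R]_(n, p)) :
  continuous (mulmxr J : 'M[R]_(m, n) -> 'M[R]_(m, p)).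
Proof.
move=> v; apply/(@cvgrPdist_le _ _ _ (nbhs v) (nbhs_filter v)) => e e0.
pose k := n%:R * `|J| + 1; have k0 : 0 < k by rewrite ltr_wpDl// mulr_ge0.
near=> w; rewrite /= -mulmxBl (le_trans (mulmx_norm_le _ _))//.
rewrite mulrAC (@le_trans _ _ (k * `|v - w|))//.
  by rewrite ler_wpM2r// lerDl.
rewrite -ler_pdivlMl// mulrC; near: w.
by apply: cvgr_dist_le; rewrite ?divr_gt0//; exact: cvg_id.
Unshelve. all: by end_near. Qed.

Lemma cvg_mxP (T : Type) (F : set_system T) m n (f : T -> 'M[R]_(m, n)) (l : 'M[R]_(m, n)) :
  Filter F -> (forall i j, f x i j @[x --> F] --> l i j) -> f x @[x --> F] --> l.
Proof.
move=> FF fl; apply/cvgrPdist_lt => e e0.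
have : \forall x \near F, forall ij : 'I_m * 'I_n, `|l ij.1 ij.2 - f x ij.1 ij.2| < e.
  by apply: filter_forall => -[i j]; have /cvgrPdist_lt/(_ e e0) := fl i j.
apply: filterS => x xe; apply: mx_norm_lt => // i j.
by rewrite !mxE; exact: (xe (i, j)).
Qed.

Lemma cvg_entry (T : Type) (F : set_system T) m n (f : T -> 'M[R]_(m, n)) (l : 'M[R]_(m, n))
  i j : Filter F -> f x @[x --> F] --> l -> f x i j @[x --> F] --> l i j.
Proof. move=> FF fl; apply: (@cvg_comp _ _ _ f (fun M : 'M[R]_(m, n) => M i j) F (nbhs l)) => //.
exact: coord_continuous. Qed.

Lemma nbhs0_norm_lt (V : normedModType R) (e : R) : 0 < e ->
  nbhs (0 : V) [set h : V | `|h| < e].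
Proof.
move=> e0; apply/nbhs_ballP; exists e => //= h.
by rewrite -ball_normE /= sub0r normrN.
Qed.

End norm_of_matrices.

Section differentiability.
Context {R : realType}.

Lemma differential_intro (V W : normedModType R) (f : V -> W) (df : {linear V -> W}) x :
  continuous df ->
  (forall e : R, 0 < e -> \forall h \near 0, `|f (h + x) - f x - df h| <= e * `|h|) ->
  differentiable f x /\ 'd f x = df :> (V -> W).
Proof.
move=> cdf H.
have E : f \o shift x = cst (f x) + df +o_ 0 id.
  apply/eqaddoP => e e0; have := H _ e0; apply: filterS => h /=.
  by rewrite !fctE /= opprD addrA.
have dE := diff_unique cdf E; split=> //.
by apply/diff_locallyP; rewrite dE.
Qed.

Lemma mean_value (f df : R -> R) (b : R) :
  (forall t : R, `|t| <= `|b| -> is_derive t (1 : R) f (df t)) ->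
  exists2 c, `|c| <= `|b| & f b - f 0 = df c * b.
Proof.
move=> fd; have cont c d : (forall t, c <= t <= d -> `|t| <= `|b|) ->
    {within `[c, d], continuous f}.
  move=> cd; apply: derivable_within_continuous => t; rewrite in_itv /= => /cd tb.
  by have [] := fd _ tb.
have [b0|b0] := leP 0 b.
- have I t : 0 <= t <= b -> `|t| <= `|b| by move=> /andP[? ?]; rewrite !ger0_norm.
  have [|c] := @MVT_segment _ f df _ _ b0 _ (cont _ _ I).
    by move=> t; rewrite in_itv /= => /andP[/ltW ? /ltW ?]; apply/fd/I/andP.
  by rewrite in_itv /= => /I ? E; exists c => //; rewrite E subr0.
- have I t : b <= t <= 0 -> `|t| <= `|b|.
    by move=> /andP[? ?]; rewrite !ler0_norm ?lerN2// ltW.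
  have [|c] := @MVT_segment _ f df _ _ (ltW b0) _ (cont _ _ I).
    by move=> t; rewrite in_itv /= => /andP[/ltW ? /ltW ?]; apply/fd/I/andP.
  rewrite in_itv /= => /I ? E; exists c => //.
  by rewrite -opprB E sub0r mulrN opprK.
Qed.

Lemma is_derive_line (V : normedModType R) (f : V -> R) (z v : V) (t : R) :
  derivable f (t *: v + z) v ->
  is_derive t (1 : R) (fun s : R => f (s *: v + z)) ('D_v f (t *: v + z)).
Proof.
move=> fd.
have E : (fun h : R => h^-1 *: (((fun s : R => f (s *: v + z)) \o shift t) (h *: 1) -
    f (t *: v + z))) =
    (fun h : R => h^-1 *: ((f \o shift (t *: v + z)) (h *: v) - f (t *: v + z))).
  by apply/funext => h /=; rewrite scalerDl addrA /GRing.scale /= mulr1.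
by split; rewrite ?/derivable ?/derive /= E.
Qed.

(** The increment of f is the sum of its increments along the coordinate axes,
    and the mean value theorem applies to each of them. *)
Lemma C1_expansion n (f : 'rV[R]_n -> R) (y : 'rV[R]_n) :
  (\forall z \near y, forall a, derivable f z (delta_mx 0 a)) ->
  (forall a, {for y, continuous (fun z => 'D_(delta_mx 0 a) f z)}) ->
  forall e : R, 0 < e -> nbhs (0 : 'rV[R]_n) [set h : 'rV[R]_n |
    `|f (h + y) - f y - \sum_a h 0 a * 'D_(delta_mx 0 a) f y| <= e * `|h|].
Proof.
move=> fd cd e e0; pose e' := e / (n.+1)%:R; have e'0 : 0 < e' by rewrite divr_gt0.
have : \forall z \near y, forall a, derivable f z (delta_mx 0 a) /\
    `|'D_(delta_mx 0 a) f y - 'D_(delta_mx 0 a) f z| < e'.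
  near=> z => a; split; first by move: a; near: z.
  move: a; near: z; apply: filter_forall => a.
  by have /cvgrPdist_lt/(_ e' e'0) := cd a.
move=> /nbhs_ballP[r /= r0 ball_y].
apply: filterS (@nbhs0_norm_lt _ _ r r0) => h hr.
pose p k : 'rV[R]_n := \row_a (if (a < k)%N then h 0 a else 0).
have pS (k : 'I_n) : p k.+1 = h 0 k *: delta_mx 0 k + p k.
  apply/rowP => a; rewrite !mxE eqxx /= ltnS.
  have [->|ak] := eqVneq a k; first by rewrite leqnn ltnn mulr1 addr0.
  have -> : (a < k)%N = (a <= k)%N.
    by rewrite ltn_neqAle -[X in X && _]/(~~ (val a == val k)) val_eqE ak.
  by rewrite mulr0 add0r.
have step (k : 'I_n) : `|f (p k.+1 + y) - f (p k + y) -
    h 0 k * 'D_(delta_mx 0 k) f y| <= e' * `|h|.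
  have inball t : `|t| <= `|h 0 k| -> ball y r (t *: delta_mx 0 k + (p k + y)).
    move=> th; rewrite -ball_normE /= addrA opprD addrCA subrr addr0 normrN.
    apply: mx_norm_lt => // i a; rewrite !mxE ord1 eqxx /=.
    have [->|ak] := eqVneq a k.
      by rewrite ltnn addr0 mulr1 (le_lt_trans th)// (le_lt_trans (mx_entry_le _ _ _)).
    rewrite mulr0 add0r; case: ifP => _; last by rewrite normr0.
    by rewrite (le_lt_trans (mx_entry_le _ _ _)).
  have [|c ch E] := @mean_value (fun s => f (s *: delta_mx 0 k + (p k + y)))
      (fun s => 'D_(delta_mx 0 k) f (s *: delta_mx 0 k + (p k + y))) (h 0 k).
    by move=> t th; apply: is_derive_line; case: (ball_y _ (inball _ th) k).
  have -> : f (p k.+1 + y) - f (p k + y) =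
      'D_(delta_mx 0 k) f (c *: delta_mx 0 k + (p k + y)) * h 0 k.
    by rewrite pS -addrA; move: E; rewrite scale0r add0r; exact.
  rewrite mulrC -mulrBr.
  rewrite normrM mulrC ler_pM//; last exact: mx_entry_le.
  by rewrite distrC ltW//; case: (ball_y _ (inball _ ch) k).
have p0 : p 0%N = 0 by apply/rowP => a; rewrite !mxE.
have pn : p n = h by apply/rowP => a; rewrite !mxE ltn_ord.
rewrite /=; have -> : f (h + y) - f y = \sum_(k < n) (f (p k.+1 + y) - f (p k + y)).
  rewrite -(big_mkord predT (fun k => f (p k.+1 + y) - f (p k + y))).
  by rewrite telescope_sumr// p0 pn add0r.
rewrite -sumrB (le_trans (ler_norm_sum _ _ _))//.
apply: (@le_trans _ _ (\sum_(k < n) e' * `|h|)); first exact: ler_sum.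
rewrite sumr_const card_ord -mulrnAl ler_wpM2r// /e' -mulr_natr -mulrA.
rewrite ger_pMr// mulrC ler_pdivrMr// mul1r ler_nat; exact: leqnSn.
Unshelve. all: by end_near. Qed.

Definition partial_mx n m (F : 'rV[R]_n -> 'rV[R]_m) y : 'M[R]_(n, m) :=
  \matrix_(a, b) 'D_(delta_mx 0 a) (fun z => F z 0 b) y.

(** This links the directional derivatives, in terms of which smoothness is defined, to
    the Jacobian matrices, in terms of which tensor fields change charts. *)
Lemma C1_differentiable n m (F : 'rV[R]_n -> 'rV[R]_m) (y : 'rV[R]_n) :
  (forall b, \forall z \near y, forall a,
     derivable (fun z => F z 0 b) z (delta_mx 0 a)) ->
  (forall b a, {for y, continuous (fun z => 'D_(delta_mx 0 a) (fun z => F z 0 b) z)}) ->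
  differentiable F y /\ 'J F y = partial_mx F y.
Proof.
move=> fd cd; have [||dF dE] := @differential_intro _ _ F
    (mulmxr (partial_mx F y) : {linear _ -> _}) y.
- exact: mulmxr_continuous.
- move=> e e0.
  have : nbhs (0 : 'rV[R]_n) [set h : 'rV[R]_n | forall b, `|F (h + y) 0 b - F y 0 b -
      \sum_a h 0 a * 'D_(delta_mx 0 a) (fun z => F z 0 b) y| <= e * `|h| ].
    have H b := C1_expansion (fd b) (cd b) e0.
  exact: (@filter_forall _ _ _ _ (nbhs_filter (0 : 'rV[R]_n)) H).
  apply: filterS => h H; apply: mx_norm_le => [|i b].
    by rewrite mulr_ge0// ltW.
  rewrite ord1 !mxE (le_trans _ (H b))// le_eqVlt; apply/orP; left; apply/eqP.
  by congr (`|_ - _|); apply: eq_bigr => a _; rewrite mxE.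
split=> //; apply/matrixP => a b; rewrite /jacobian /lin1_mx mxE dE /=.
by rewrite -rowE mxE.
Qed.

Lemma differentiable_expansion n m (F : 'rV[R]_n -> 'rV[R]_m) (y : 'rV[R]_n) :
  differentiable F y -> forall e : R, 0 < e -> \forall z \near y,
    `|F z - F y - (z - y) *m 'J F y| <= e * `|z - y|.
Proof.
move=> /diff_locally /eqaddoP H e /H /nbhs_ballP[r /= r0 Hr].
apply/nbhs_ballP; exists r => // z; rewrite -ball_normE /= => yz.
have /Hr : ball (0 : 'rV[R]_n) r (z - y) by rewrite -ball_normE /= sub0r opprB.
by rewrite /= !fctE /= subrK opprD addrA mul_rV_lin1.
Qed.

End differentiability.

(** * Algebra of smooth functions *)

Section smooth_functions.
Context {R : realType} {n : nat}.
Implicit Types (f g : 'rV[R]_n -> R) (U : set 'rV[R]_n) (k : nat).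

(** Smoothness of finite order. An induction on k takes the first derivative first, so that
    the rules for sums and products apply to f itself; an induction on a list of partial
    derivatives would peel off the last one. *)
Fixpoint Ck k U f : Prop :=
  match k with
  | 0 => forall y, U y -> {for y, continuous f}
  | k'.+1 => (forall y, U y -> {for y, continuous f} /\
                forall a, derivable f y (delta_mx 0 a)) /\
             forall a, Ck k' U (fun y => 'D_(delta_mx 0 a) f y)
  end.

Lemma partials_rcons s a f :
  partials (rcons s a) f = partials s (fun y => 'D_(delta_mx 0 a) f y).
Proof. by rewrite /partials foldr_rcons. Qed.

Lemma smooth_on_partial U f a : smooth_on U f ->
  smooth_on U (fun y => 'D_(delta_mx 0 a) f y).
Proof. by move=> sf s y Uy; rewrite -partials_rcons; exact: sf. Qed.

Lemma CkW k U f : Ck k.+1 U f -> Ck k U f.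
Proof.
elim: k f => [|k IHk] f; first by case=> H _ y /H[].
by case=> H D; split=> // a; apply: IHk; exact: D.
Qed.

Lemma Ck_partials s k U f : Ck (size s + k) U f -> Ck k U (partials s f).
Proof.
elim/last_ind: s f => [|s a IHs] f //; rewrite size_rcons addSn partials_rcons.
by case=> _ /(_ a) /IHs.
Qed.

Lemma smooth_onP U f : smooth_on U f <-> forall k, Ck k U f.
Proof.
split=> [sf k|cf s y Uy]; last first.
  have /Ck_partials : Ck (size s + 1) U f by exact: cf.
  by case=> + _ => /(_ _ Uy).
elim: k f sf => [|k IHk] f sf.
  by move=> y Uy; have [] := sf [::] y Uy.
split=> [y Uy|a]; first exact: (sf [::] y Uy).
exact/IHk/smooth_on_partial.
Qed.

Lemma continuous_forD f g y : {for y, continuous f} -> {for y, continuous g} ->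
  {for y, continuous (fun z => f z + g z)}.
Proof. by move=> cf cg; exact: (continuousD cf cg). Qed.

Lemma continuous_forM f g y : {for y, continuous f} -> {for y, continuous g} ->
  {for y, continuous (fun z => f z * g z)}.
Proof. by move=> cf cg; exact: (continuousM cf cg). Qed.

Lemma continuous_forV f y : f y != 0 -> {for y, continuous f} ->
  {for y, continuous (fun z => (f z)^-1)}.
Proof. by move=> f0 cf; exact: (continuousV f0 cf). Qed.

Lemma continuous_for_eq f g y : (\near y, f y = g y) -> {for y, continuous f} ->
  {for y, continuous g}.
Proof.
move=> fg cf; change (g x @[x --> y] --> g y); rewrite -(nbhs_singleton fg).
apply: cvg_trans cf; apply: (@near_eq_cvg _ _ (nbhs y) (nbhs_filter y)).
exact: fg.
Qed.

Lemma Ck_eq k U f g : open U -> (forall y, U y -> f y = g y) ->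
  Ck k U f -> Ck k U g.
Proof.
move=> oU.
have neq f' g' : (forall y, U y -> f' y = g' y) -> forall y, U y -> \near y, f' y = g' y.
  by move=> fg y Uy; have := open_nbhs_nbhs (conj oU Uy); apply: filterS => z /fg.
elim: k f g => [|k IHk] f g fg.
  by move=> H y Uy; apply: continuous_for_eq (H _ Uy); exact: neq.
case=> H D; split=> [y Uy|a].
  have [cf df] := H _ Uy; split; first by apply: continuous_for_eq cf; exact: neq.
  by move=> a; apply: near_eq_derivable (df a); exact: neq.
by apply: IHk (D a) => y Uy; apply: near_eq_derive; exact: neq.
Qed.

Lemma smooth_on_eq U f g : open U -> (forall y, U y -> f y = g y) ->
  smooth_on U f -> smooth_on U g.
Proof. by move=> oU fg /smooth_onP sf; apply/smooth_onP => k; apply: Ck_eq (sf k). Qed.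

Lemma Ck_cst k U (c : R) : Ck k U (fun=> c).
Proof.
elim: k c => [|k IHk] c; first by move=> y _; exact: cst_continuous.
split=> [y _|a].
  by split=> [|a]; [exact: cst_continuous|exact: derivable_cst].
have -> : (fun y : 'rV[R]_n => 'D_(delta_mx 0 a) (fun=> c) y) = (fun=> 0).
  by apply/funext => y; exact: derive_cst.
exact: IHk.
Qed.

Lemma CkD k U f g : open U -> Ck k U f -> Ck k U g -> Ck k U (fun y => f y + g y).
Proof.
move=> oU; elim: k f g => [|k IHk] f g.
  by move=> cf cg y Uy; exact: (continuous_forD (cf _ Uy) (cg _ Uy)).
case=> Hf Df [Hg Dg]; split=> [y Uy|a].
  have [cf df] := Hf _ Uy; have [cg dg] := Hg _ Uy.
  by split=> [|a]; [exact: continuous_forD|exact: derivableD].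
apply: Ck_eq (IHk _ _ (Df a) (Dg a)) => // y Uy.
by rewrite -deriveD//; [case: (Hf _ Uy)|case: (Hg _ Uy)].
Qed.

Lemma CkM k U f g : open U -> Ck k U f -> Ck k U g -> Ck k U (fun y => f y * g y).
Proof.
move=> oU; elim: k f g => [|k IHk] f g.
  by move=> cf cg y Uy; exact: (continuous_forM (cf _ Uy) (cg _ Uy)).
move=> Cf Cg; have Cf' := CkW Cf; have Cg' := CkW Cg.
case: Cf Cg => Hf Df [Hg Dg]; split=> [y Uy|a].
  have [cf df] := Hf _ Uy; have [cg dg] := Hg _ Uy.
  by split=> [|a]; [exact: continuous_forM|exact: derivableM].
apply: Ck_eq (CkD oU (IHk _ _ Cf' (Dg a)) (IHk _ _ Cg' (Df a))) => // y Uy.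
by rewrite deriveM//; [case: (Hf _ Uy)|case: (Hg _ Uy)].
Qed.

Lemma CkV k U f : open U -> (forall y, U y -> f y != 0) -> Ck k U f ->
  Ck k U (fun y => (f y)^-1).
Proof.
move=> oU f0; elim: k => [|k IHk].
  by move=> cf y Uy; exact: (continuous_forV (f0 _ Uy) (cf _ Uy)).
move=> Cf; have Cf' := CkW Cf; case: Cf => Hf Df; split=> [y Uy|a].
  have [cf df] := Hf _ Uy; split=> [|a]; first exact: (continuous_forV (f0 _ Uy) cf).
  by apply: derivableV => //; exact: f0.
have CV := IHk Cf'.
apply: Ck_eq (CkM oU (Ck_cst k U (-1)) (CkM oU (CkM oU CV CV) (Df a))) => // y Uy.
rewrite deriveV ?f0//; last by case: (Hf _ Uy).
by rewrite /GRing.scale /= expr2 invfM; ring.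
Qed.

Section closure.
Variable U : set 'rV[R]_n.
Hypothesis oU : open U.

Lemma smooth_cst (c : R) : smooth_on U (fun=> c).
Proof. by apply/smooth_onP => k; exact: Ck_cst. Qed.

Lemma smoothD f g : smooth_on U f -> smooth_on U g -> smooth_on U (fun y => f y + g y).
Proof.
by move=> /smooth_onP sf /smooth_onP sg; apply/smooth_onP => k; exact: CkD.
Qed.

Lemma smoothM f g : smooth_on U f -> smooth_on U g -> smooth_on U (fun y => f y * g y).
Proof.
by move=> /smooth_onP sf /smooth_onP sg; apply/smooth_onP => k; exact: CkM.
Qed.

Lemma smoothV f : (forall y, U y -> f y != 0) -> smooth_on U f ->
  smooth_on U (fun y => (f y)^-1).
Proof. by move=> f0 /smooth_onP sf; apply/smooth_onP => k; exact: CkV. Qed.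

Lemma smooth_sum (I : Type) (r : seq I) (f : I -> 'rV[R]_n -> R) :
  (forall i, smooth_on U (f i)) -> smooth_on U (fun y => \sum_(i <- r) f i y).
Proof.
move=> sf; elim: r => [|i r IHr].
  have -> : (fun y => \sum_(i <- [::]) f i y) = (fun=> 0).
    by apply/funext => y; rewrite big_nil.
  exact: smooth_cst.
have -> : (fun y => \sum_(i <- i :: r) f i y) = (fun y => f i y + \sum_(i <- r) f i y).
  by apply/funext => y; rewrite big_cons.
exact: (smoothD (sf i) IHr).
Qed.

Lemma smooth_prod (I : Type) (r : seq I) (f : I -> 'rV[R]_n -> R) :
  (forall i, smooth_on U (f i)) -> smooth_on U (fun y => \prod_(i <- r) f i y).
Proof.
move=> sf; elim: r => [|i r IHr].
  have -> : (fun y => \prod_(i <- [::]) f i y) = (fun=> 1).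
    by apply/funext => y; rewrite big_nil.
  exact: smooth_cst.
have -> : (fun y => \prod_(i <- i :: r) f i y) = (fun y => f i y * \prod_(i <- r) f i y).
  by apply/funext => y; rewrite big_cons.
exact: (smoothM (sf i) IHr).
Qed.

Lemma smoothX f m : smooth_on U f -> smooth_on U (fun y => f y ^+ m).
Proof.
move=> sf; elim: m => [|m IHm]; first exact: smooth_cst.
have -> : (fun y => f y ^+ m.+1) = (fun y => f y * f y ^+ m).
  by apply/funext => y; rewrite exprS.
exact: (smoothM sf IHm).
Qed.

Definition smooth_mx m p (F : 'rV[R]_n -> 'M[R]_(m, p)) :=
  forall i j, smooth_on U (fun y => F y i j).

Lemma smooth_mx_eq m p (F G : 'rV[R]_n -> 'M[R]_(m, p)) :
  (forall y, U y -> F y = G y) -> smooth_mx F -> smooth_mx G.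
Proof. by move=> FG sF i j; apply: smooth_on_eq (sF i j) => // y /FG ->. Qed.

Lemma smooth_mxM m p q (F : 'rV[R]_n -> 'M[R]_(m, p)) (G : 'rV[R]_n -> 'M[R]_(p, q)) :
  smooth_mx F -> smooth_mx G -> smooth_mx (fun y => F y *m G y).
Proof.
move=> sF sG i j.
have -> : (fun y => (F y *m G y) i j) = (fun y => \sum_k F y i k * G y k j).
  by apply/funext => y; rewrite mxE.
by apply: smooth_sum => k; exact: (smoothM (sF i k) (sG k j)).
Qed.

Lemma smooth_mxD m p (F G : 'rV[R]_n -> 'M[R]_(m, p)) :
  smooth_mx F -> smooth_mx G -> smooth_mx (fun y => F y + G y).
Proof.
move=> sF sG i j.
have -> : (fun y => (F y + G y) i j) = (fun y => F y i j + G y i j).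
  by apply/funext => y; rewrite mxE.
exact: (smoothD (sF i j) (sG i j)).
Qed.

Lemma smooth_mxZ m p (f : 'rV[R]_n -> R) (F : 'rV[R]_n -> 'M[R]_(m, p)) :
  smooth_on U f -> smooth_mx F -> smooth_mx (fun y => f y *: F y).
Proof.
move=> sf sF i j.
have -> : (fun y => (f y *: F y) i j) = (fun y => f y * F y i j).
  by apply/funext => y; rewrite mxE.
exact: (smoothM sf (sF i j)).
Qed.

Lemma smooth_det m (F : 'rV[R]_n -> 'M[R]_m) : smooth_mx F ->
  smooth_on U (fun y => \det (F y)).
Proof.
move=> sF; rewrite /determinant; apply: smooth_sum => s.
apply: smoothM; first exact: smooth_cst.
by apply: smooth_prod => i; exact: sF.
Qed.

Lemma smooth_tr m (F : 'rV[R]_n -> 'M[R]_m) : smooth_mx F ->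
  smooth_on U (fun y => \tr (F y)).
Proof. by move=> sF; rewrite /mxtrace; apply: smooth_sum => i; exact: sF. Qed.

Lemma smooth_invmx m (F : 'rV[R]_n -> 'M[R]_m) : (forall y, U y -> F y \in unitmx) ->
  smooth_mx F -> smooth_mx (fun y => invmx (F y)).
Proof.
move=> uF sF; apply: (@smooth_mx_eq _ _ (fun y => (\det (F y))^-1 *: \adj (F y))).
  by move=> y /uF uFy; rewrite /invmx uFy.
apply: smooth_mxZ.
  apply: smoothV; last exact: smooth_det.
  by move=> y /uF; rewrite unitmxE unitfE.
move=> i j.
have -> : (fun y => \adj (F y) i j) = (fun y => (-1) ^+ (j + i) * \det (row' j (col' i (F y)))).
  by apply/funext => y; rewrite mxE.
apply: smoothM; first exact: smooth_cst.
apply: smooth_det => k l.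
have -> : (fun y => row' j (col' i (F y)) k l) = (fun y => F y (lift j k) (lift i l)).
  by apply/funext => y; rewrite !mxE.
exact: sF.
Qed.

Lemma smooth_gnorm2 m (P h : 'rV[R]_n -> 'M[R]_m) :
  (forall y, U y -> P y \in unitmx) -> smooth_mx P -> smooth_mx h ->
  smooth_on U (fun y => gnorm2 (P y) (h y)).
Proof.
move=> uP sP sh; rewrite /gnorm2; apply: smooth_tr.
have sPV := smooth_invmx uP sP.
exact: (smooth_mxM (smooth_mxM (smooth_mxM sPV sh) sPV) sh).
Qed.

Lemma smooth_continuous f y : smooth_on U f -> U y -> {for y, continuous f}.
Proof. by move=> sf Uy; case: (sf [::] _ Uy). Qed.

Lemma smooth_differentiable m (F : 'rV[R]_n -> 'rV[R]_m) y :
  (forall b, smooth_on U (fun z => F z 0 b)) -> U y ->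
  differentiable F y /\ 'J F y = partial_mx F y.
Proof.
move=> sF Uy; apply: C1_differentiable => [b|b a].
  have := open_nbhs_nbhs (conj oU Uy); apply: filterS => z Uz a.
  by case: (sF b [::] _ Uz).
by case: (sF b [:: a] _ Uy).
Qed.

End closure.

End smooth_functions.

(** * Tensor fields in charts *)

Lemma jacobian_comp (R : realType) (n m p : nat) (F : 'rV[R]_n -> 'rV[R]_m)
    (G : 'rV[R]_m -> 'rV[R]_p) y : differentiable F y -> differentiable G (F y) ->
  'J (G \o F) y = 'J F y *m 'J G (F y).
Proof.
move=> dF dG; apply/row_matrixP => a; rewrite !rowE mulmxA /jacobian.
by rewrite !mul_rV_lin1 (diff_comp dF dG).
Qed.

Lemma norm_near_le (R : realType) (V : normedModType R) (a b : V) (c : R) :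
  `|a - b| < c -> `|b| <= `|a| + c.
Proof.
move=> /ltW abc; rewrite -lerBlDl (le_trans (lerB_dist _ _))//.
by rewrite distrC.
Qed.

Lemma compact_closed_ball_rV (R : realType) n (y0 : 'rV[R]_n) (r : R) : 0 < r ->
  compact [set y : 'rV[R]_n | `|y0 - y| <= r].
Proof.
move=> r0; apply: bounded_closed_compact.
  exists (`|y0| + r); split; first by rewrite num_real.
  move=> c hc y /= Ky; rewrite (le_trans _ (ltW hc))//.
  by rewrite -lerBlDl (le_trans (lerB_dist _ _))// distrC.
have := @closed_ball_closed R 'rV[R]_n y0 r.
by rewrite closed_ballE.
Qed.

Section tensor_fields_in_charts.
Context {R : realType} {n : nat} {M : ptopologicalType} (A : smooth_atlas R n M).
Implicit Types (t h u : tensor_field R n M) (x : M) (i k : nat) (y : 'rV[R]_n).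

Definition codom i : set 'rV[R]_n := phi A i @` dom A i.

Lemma codom_phi i x : dom A i x -> codom i (phi A i x).
Proof. by move=> ix; exists x. Qed.

Lemma codom_psi i y : codom i y -> dom A i (psi A i y) /\ phi A i (psi A i y) = y.
Proof. by case=> x ix <-; rewrite phiK. Qed.

Lemma codom_open i : open (codom i).
Proof. exact: open_codom. Qed.

Lemma dom_chart_at x : dom A (chart_at A x) x.
Proof. by rewrite /chart_at; case: ex_minnP => m; rewrite inE. Qed.

Lemma chart_at_min x i : dom A i x -> (chart_at A x <= i)%N.
Proof. by move=> ix; rewrite /chart_at; case: ex_minnP => m _; apply; rewrite inE. Qed.

Opaque chart_at.

Lemma psi_nbhs i y (U : set M) : codom i y -> nbhs (psi A i y) U ->
  nbhs y [set z | codom i z /\ U (psi A i z)].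
Proof.
move=> iy Uy; have h1 := open_nbhs_nbhs (conj (@codom_open i) iy).
by have h2 := continuous_psi iy Uy; apply: filterI h1 h2.
Qed.

Lemma overlapE i k : phi A i @` (dom A i `&` dom A k) =
  [set y | codom i y /\ dom A k (psi A i y)].
Proof.
apply/seteqP; split=> y /=.
  by move=> [x [ix kx] <-]; split; [exact: codom_phi|rewrite phiK].
by move=> [iy ky]; have [ipy E] := codom_psi iy; exists (psi A i y).
Qed.

Lemma open_overlap i k : open (phi A i @` (dom A i `&` dom A k)).
Proof.
rewrite overlapE openE => y /= [iy ky]; apply: psi_nbhs => //.
exact: open_nbhs_nbhs (conj (@open_dom _ _ _ A k) ky).
Qed.

Lemma transition_differentiable i k x : dom A i x -> dom A k x ->
  differentiable (phi A k \o psi A i) (phi A i x) /\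
  'J (phi A k \o psi A i) (phi A i x) = partial_mx (phi A k \o psi A i) (phi A i x).
Proof.
move=> ix kx; apply: (@smooth_differentiable R n _ (@open_overlap i k) n
  (phi A k \o psi A i) (phi A i x)).
  exact: smooth_transition.
by exists x.
Qed.

Lemma jacobian_id_near (F : 'rV[R]_n -> 'rV[R]_n) y : differentiable F y ->
  (\near y, F y = y) -> 'J F y = 1%:M.
Proof.
move=> dF Fid; apply/row_matrixP => a; rewrite !rowE mulmx1.
rewrite -(deriveEjacobian _ dF) (near_eq_derive (g := id))//.
by rewrite derive_id.
Qed.

Lemma jacobian_inverse i k x : dom A i x -> dom A k x ->
  'J (phi A i \o psi A k) (phi A k x) *m 'J (phi A k \o psi A i) (phi A i x) = 1%:M.
Proof.
move=> ix kx; have [dF _] := transition_differentiable kx ix.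
have [dG _] := transition_differentiable ix kx.
set F := phi A i \o psi A k; set G := phi A k \o psi A i.
have Fx : F (phi A k x) = phi A i x by rewrite /F /= phiK.
have dG' : differentiable G (F (phi A k x)) by rewrite Fx.
have := jacobian_comp dF dG'; rewrite -/F -/G Fx => <-.
apply: jacobian_id_near; first exact: differentiable_comp.
have : nbhs (phi A k x) (phi A k @` (dom A k `&` dom A i)).
  apply: open_nbhs_nbhs; split; first exact: open_overlap.
  by exists x.
by apply: filterS => _ [z [kz iz] <-]; rewrite /F /G /= !phiK.
Qed.

Lemma jacobian_unit i k x : dom A i x -> dom A k x ->
  'J (phi A k \o psi A i) (phi A i x) \in unitmx.
Proof. by move=> ix kx; case/mulmx1_unit: (jacobian_inverse ix kx). Qed.

Lemma in_chart_frame i y : codom i y -> exists2 J, J \in unitmx &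
  forall t, in_chart A i t y = J *m t (psi A i y) *m J^T.
Proof.
move=> iy; have [ipy E] := codom_psi iy.
exists ('J (phi A (chart_at A (psi A i y)) \o psi A i) y) => //.
by rewrite -{2}E; apply: jacobian_unit => //; exact: dom_chart_at.
Qed.

Lemma in_chart_chart_at t x :
  in_chart A (chart_at A x) t (phi A (chart_at A x) x) = t x.
Proof.
have ix := dom_chart_at x; rewrite /in_chart phiK// jacobian_id_near.
- by rewrite mul1mx trmx1 mulmx1.
- by have [] := transition_differentiable ix ix.
- have := open_nbhs_nbhs (conj (@codom_open (chart_at A x)) (codom_phi ix)).
  by apply: filterS => _ [z iz <-]; rewrite /= phiK.
Qed.

Lemma in_chartD i t u y : in_chart A i (fun x => t x + u x) y =
  in_chart A i t y + in_chart A i u y.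
Proof. by rewrite /in_chart mulmxDr mulmxDl. Qed.

Lemma in_chartZ i (s : M -> R) t y : in_chart A i (fun x => s x *: t x) y =
  s (psi A i y) *: in_chart A i t y.
Proof. by rewrite /in_chart -scalemxAr -scalemxAl. Qed.

Lemma in_chartB i t u y : in_chart A i (fun x => t x - u x) y =
  in_chart A i t y - in_chart A i u y.
Proof. by rewrite /in_chart mulmxBr mulmxBl. Qed.

Lemma in_chartE t i y : in_chart A i t y =
  'J (phi A (chart_at A (psi A i y)) \o psi A i) y *m t (psi A i y) *m
  ('J (phi A (chart_at A (psi A i y)) \o psi A i) y)^T.
Proof. by []. Qed.

Opaque in_chart.

Lemma smooth_in_chart t i : smooth_section A t -> smooth_mx (codom i) (in_chart A i t).
Proof. by move=> st a b; exact: st. Qed.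

Lemma riem_metric_mx t x : riem_metric A t -> metric_mx (t x).
Proof. by case=> -[st _] pt; split; [exact: st|exact: pt]. Qed.

Lemma riem_metric_in_chart t i y : riem_metric A t -> codom i y ->
  metric_mx (in_chart A i t y).
Proof.
move=> mt /in_chart_frame[J uJ ->]; apply: metric_mx_congr => //.
exact: riem_metric_mx.
Qed.

Lemma gnorm2_in_chart t h i y : riem_metric A t -> codom i y ->
  gnorm2 (in_chart A i t y) (in_chart A i h y) = gnorm2 (t (psi A i y)) (h (psi A i y)).
Proof.
move=> mt /in_chart_frame[J uJ E]; rewrite !E gnorm2_congr//.
exact/metric_mx_unit/riem_metric_mx.
Qed.

Lemma smooth_section_continuous t i y : smooth_section A t -> codom i y ->
  in_chart A i t z @[z --> y] --> in_chart A i t y.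
Proof.
move=> st iy; apply: (cvg_mxP (nbhs_filter y)) => a b.
by case: (st i a b [::] _ iy).
Qed.

Lemma gnorm2_le_norm (P h : 'M[R]_n) :
  gnorm2 P h <= n%:R ^+ 4 * `|invmx P| ^+ 2 * `|h| ^+ 2.
Proof.
have tr_le (X : 'M[R]_n) : \tr X <= n%:R * `|X|.
  rewrite /mxtrace (@le_trans _ _ (\sum_(i < n) `|X|))//; last first.
    by rewrite sumr_const card_ord mulr_natl.
  by apply: ler_sum => i _; rewrite (le_trans (ler_norm _))// mx_entry_le.
rewrite (le_trans (tr_le _))// exprS -!mulrA ler_wpM2l//.
rewrite (le_trans (mulmx_norm_le _ _))//.
have h1 := mulmx_norm_le (invmx P) h.
have h2 := mulmx_norm_le (invmx P *m h) (invmx P).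
have n0 : 0 <= n%:R :> R by [].
have h3 := le_trans h2 (ler_wpM2r (normr_ge0 (invmx P)) (ler_wpM2l n0 h1)).
have := ler_wpM2r (normr_ge0 h) (ler_wpM2l n0 h3).
by move=> /le_trans -> //; rewrite le_eqVlt; apply/orP; left; apply/eqP; ring.
Qed.

(** The inverse of the matrix of t is bounded on a compact ball of a chart around x0. So
    the convergence of the components of a tensor field on compact subsets of the charts
    gives convergence for the pointwise norm of t, which does not mention charts. *)
Lemma gnorm2_local_bound t x0 : riem_metric A t ->
  exists i, exists K : set 'rV[R]_n, exists2 C : R, 0 <= C &
  [/\ compact K, K `<=` codom i &
      \forall x \near x0, [/\ dom A i x, K (phi A i x) &
        forall h, gnorm2 (t x) (h x) <= C * `|in_chart A i h (phi A i x)| ^+ 2]].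
Proof.
move=> mt; pose i := chart_at A x0; have ix0 := dom_chart_at x0.
pose y0 := phi A i x0; have iy0 : codom i y0 by exact: codom_phi.
have st : smooth_section A t by case: mt => -[].
have sI : smooth_mx (codom i) (fun y => invmx (in_chart A i t y)).
  apply: smooth_invmx; first exact: codom_open.
    by move=> y iy; exact/metric_mx_unit/riem_metric_in_chart.
  exact: smooth_in_chart.
have cI : invmx (in_chart A i t y) @[y --> y0] --> invmx (in_chart A i t y0).
  by apply: (cvg_mxP (nbhs_filter y0)) => a b; case: (sI a b [::] _ iy0).
pose B := `|invmx (in_chart A i t y0)| + 1.
have : nbhs y0 [set y | codom i y /\ `|invmx (in_chart A i t y)| <= B].
  have h1 := open_nbhs_nbhs (conj (@codom_open i) iy0).
  have /cvgrPdist_lt/(_ 1 ltr01) h2 := cI.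
  apply: filterS (filterI h1 h2) => y /= [iy h]; split=> //.
  exact: norm_near_le.
move=> /nbhs_ballP[r /= r0 ball_r].
pose K := [set y : 'rV[R]_n | `|y0 - y| <= r / 2].
have Kball y : K y -> ball y0 r y.
  move=> Ky; rewrite -ball_normE /= (le_lt_trans Ky)//.
  by rewrite ltr_pdivrMr// ltr_pMr// ltr1n.
exists i, K, (n%:R ^+ 4 * B ^+ 2).
  by rewrite mulr_ge0// ?exprn_ge0// addr_ge0.
split.
- by apply: compact_closed_ball_rV; rewrite divr_gt0.
- by move=> y /Kball /ball_r[].
have ix0' : nbhs x0 (dom A i).
  exact: open_nbhs_nbhs (conj (@open_dom _ _ _ A i) ix0).
have Ky0 : nbhs y0 K.
  apply/nbhs_ballP; exists (r / 2); first by rewrite /= divr_gt0.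
  by move=> y; rewrite -ball_normE /= => /ltW.
have Kx0 : nbhs x0 (phi A i @^-1` K) by exact: (continuous_phi ix0).
apply: filterS (filterI Kx0 ix0') => x [Kx ix]; split=> // h.
have [iy hB] := ball_r _ (Kball _ Kx).
have E := gnorm2_in_chart h mt iy; rewrite phiK// in E; rewrite -E.
rewrite (le_trans (gnorm2_le_norm _ _))// ler_wpM2r ?exprn_ge0//.
by rewrite ler_wpM2l ?exprn_ge0// lerXn2r// nnegrE// (le_trans _ hB).
Qed.

Hypothesis M_compact : compact [set: M].

Lemma near_compact (I : Type) (F : set_system I) (FF : Filter F) (P : I -> M -> Prop) :
  (forall x0, exists2 W, nbhs x0 W & \forall s \near F, forall x, W x -> P s x) ->
  \forall s \near F, forall x, P s x.
Proof.
move=> H; have cov := (compact_near_coveringP [set: M]).1 M_compact.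
apply: (@filterS _ F FF) (cov I F P FF _) => [s HS x|x0 _]; first exact: HS.
have [W Wx0 FW] := H x0; exists (W, [set s | forall x, W x -> P s x]) => //.
by case=> x s /= [Wx]; exact.
Qed.

Lemma frechet_cvg_gnorm2 (I : Type) (F : set_system I) (FF : Filter F)
  (u : I -> tensor_field R n M) h t (e : R) : riem_metric A t -> 0 < e ->
  frechet_cvg A F u h ->
  \forall s \near F, forall x, gnorm2 (t x) (u s x - h x) <= e.
Proof.
move=> mt e0 uh; apply: near_compact => x0.
have [i [K [C C0 [cK Ki H]]]] := gnorm2_local_bound x0 mt.
eexists; first exact: H.
pose e' := Num.sqrt (e / (C + 1)).
have eC : 0 < e / (C + 1) by rewrite divr_gt0// ltr_wpDl.
have e'0 : 0 < e' by rewrite sqrtr_gt0.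
have : \forall s \near F, forall ab : 'I_n * 'I_n, forall y, K y ->
    `|in_chart A i (u s) y ab.1 ab.2 - in_chart A i h y ab.1 ab.2| < e'.
  by apply: filter_forall => -[a b]; exact: (uh i [::] a b K cK Ki e' e'0).
apply: filterS => s Hs x [ix Kx /(_ (fun x => u s x - h x)) /le_trans]; apply.
rewrite in_chartB.
have : `|in_chart A i (u s) (phi A i x) - in_chart A i h (phi A i x)| <= e'.
  apply: mx_norm_le => [|a b]; first exact: ltW.
  by rewrite entryD entryN; exact/ltW/(Hs (a, b) _ Kx).
set N := `|_| => Ne.
have : N ^+ 2 <= e / (C + 1).
  rewrite -(sqr_sqrtr (ltW eC)) -/e' lerXn2r// ?nnegrE ?normr_ge0// ltW//.
have C1 : 0 < C + 1 by rewrite ltr_wpDl.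
rewrite ler_pdivlMr// => NC; apply: le_trans NC.
by have := sqr_ge0 N; nra.
Qed.

Lemma gnorm2_bounded t h : riem_metric A t -> smooth_section A h ->
  exists2 B : R, 0 <= B & forall x, gnorm2 (t x) (h x) <= B.
Proof.
move=> mt sh.
have : \forall s \near +oo, forall x, gnorm2 (t x) (h x) <= s.
  apply: near_compact => x0.
  have [i [K [C C0 [cK Ki H]]]] := gnorm2_local_bound x0 mt.
  have [ix0 _ _] := nbhs_singleton H; have iy0 := codom_phi ix0.
  have cphi := continuous_phi ix0.
  have /cvgrPdist_lt/(_ 1 ltr01) h3 :
      in_chart A i h (phi A i x) @[x --> x0] --> in_chart A i h (phi A i x0).
    exact: (cvg_comp _ _ cphi (smooth_section_continuous sh iy0)).
  exists ([set x | [/\ dom A i x, K (phi A i x) &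
        forall h, gnorm2 (t x) (h x) <= C * `|in_chart A i h (phi A i x)| ^+ 2]] `&`
    [set x | `|in_chart A i h (phi A i x0) - in_chart A i h (phi A i x)| < 1]).
    exact: filterI H h3.
  near=> s => x [[_ _ /(_ h)] /= + hx] => /le_trans; apply.
  apply: (@le_trans _ _ (C * (`|in_chart A i h (phi A i x0)| + 1) ^+ 2)); last first.
    by near: s; apply: nbhs_pinfty_ge; rewrite num_real.
  rewrite ler_wpM2l// lerXn2r ?nnegrE ?addr_ge0//.
  exact: norm_near_le.
move=> H; have [s [s0 Hs]] : exists s : R, 0 <= s /\ forall x, gnorm2 (t x) (h x) <= s.
  near +oo_R => s; exists s; split; last by near: s.
  by near: s; apply: nbhs_pinfty_ge; rewrite num_real.
by exists s.
Unshelve. all: by end_near. Qed.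

Lemma chart_at_bounded : exists N, forall x, (chart_at A x < N)%N.
Proof.
have : \forall N \near \oo, forall x, (chart_at A x < N)%N.
  apply: near_compact => x0; exists (dom A (chart_at A x0)).
    exact: open_nbhs_nbhs (conj (@open_dom _ _ _ A _) (dom_chart_at x0)).
  exists (chart_at A x0).+1 => // N /= hN x /chart_at_min /leq_ltn_trans; exact.
by move=> [N _ H]; exists N; exact: H (leqnn N).
Qed.

End tensor_fields_in_charts.

(** * Lebesgue measure on row vectors *)

Section borel_sets.
Context {R : realType}.

Lemma open_borel (T : ptopologicalType) (U : set T) :
  open U -> measurable (U : set (borel T)).
Proof. by move=> oU; exact: sub_sigma_algebra. Qed.

Lemma open_continuous_measurable (T : ptopologicalType) (D : set T) (f : T -> R) :
  open D -> (forall x, D x -> {for x, continuous f}) ->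
  measurable_fun (D : set (borel T)) (f : borel T -> R).
Proof.
move=> oD cf; apply: (measurability _ (measurable_realfun.RGenOpens.measurableE R)).
move=> _ [_ [a [b ->] <-]]; apply: open_borel; rewrite openE => x [Dx fx].
apply: filterI; first exact: open_nbhs_nbhs.
by apply: (cf _ Dx); apply: open_nbhs_nbhs; split=> //; exact: interval_open.
Qed.

Lemma open_continuous_borel (T T' : ptopologicalType) (D : set T) (f : T -> T') :
  open D -> (forall x, D x -> {for x, continuous f}) ->
  measurable_fun (D : set (borel T)) (f : borel T -> borel T').
Proof.
move=> oD cf; apply: (@measurability _ _ (borel T) (borel T') D f (@open T')) => //.
move=> _ [U oU <-]; apply: open_borel; rewrite openE => x [Dx fx].
apply: filterI; first exact: open_nbhs_nbhs.
by apply: (cf _ Dx); apply: open_nbhs_nbhs.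
Qed.

Definition row_cons n (z : R * 'rV[R]_n) : 'rV[R]_n.+1 :=
  row_mx (z.1%:M : 'M[R]_1) z.2.

Lemma row_cons0 n x (v : 'rV[R]_n) : row_cons (x, v) 0 0 = x.
Proof.
have -> : (0 : 'I_n.+1) = lshift n (0 : 'I_1) :> 'I_(1 + n) by exact/val_inj.
by apply: etrans (row_mxEl _ _ _ _) _; rewrite mxE eqxx mulr1n.
Qed.

Lemma row_consS n x (v : 'rV[R]_n) i : row_cons (x, v) 0 (lift 0 i) = v 0 i.
Proof.
have -> : lift (0 : 'I_n.+1) i = rshift 1 i :> 'I_(1 + n) by exact/val_inj.
exact: row_mxEr.
Qed.

Lemma row_cons_norm_lt n x y (v w : 'rV[R]_n) e : 0 < e ->
  `|x - y| < e -> `|v - w| < e -> `|row_cons (x, v) - row_cons (y, w)| < e.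
Proof.
move=> e0 xy vw; apply: mx_norm_lt => // i j; rewrite ord1 entryD entryN.
have [->|[k ->]] : j = 0 \/ exists k, j = lift 0 k.
- by case: (unliftP 0 j) => [k|] ->; [right; exists k|left].
- by rewrite !row_cons0.
by rewrite !row_consS; have := mx_entry_le (v - w) 0 k; rewrite entryD entryN => /le_lt_trans; apply.
Qed.

(** An open set of row vectors is a countable union of boxes with rational centres
    and radii, and such a box is a measurable rectangle. *)
Lemma measurable_row_cons n :
  measurable_fun setT (@row_cons n : R * borel 'rV[R]_n -> borel 'rV[R]_n.+1).
Proof.
apply: (@measurability _ _ (R * borel 'rV[R]_n)%type (borel 'rV[R]_n.+1) setT
  (@row_cons n) (@open 'rV[R]_n.+1)) => //.
move=> _ [U oU <-]; rewrite setTI.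
pose I := ((rat * 'rV[rat]_n) * rat)%type.
pose box (i : I) : set (R * borel 'rV[R]_n) :=
  [set x : R | `|ratr i.1.1 - x| < ratr i.2] `*`
  [set v : 'rV[R]_n | `|map_mx ratr i.1.2 - v| < ratr i.2].
pose F (i : I) := if `[< 0 < i.2 /\ box i `<=` @row_cons n @^-1` U >] then box i else set0.
have -> : @row_cons n @^-1` U = \bigcup_i F i.
  apply/seteqP; split=> [[x v] Uxv|z [i _]]; last first.
    by rewrite /F; case: asboolP => // -[_ h] /h.
  have /nbhs_ballP[r /= r0 ball_r] := open_nbhs_nbhs (conj oU Uxv).
  have r4 : 0 < r / 4 by rewrite divr_gt0.
  have [q] := rat_in_itvoo r4; rewrite in_itv /= => /andP[q0 qr].
  have [c] : exists c : rat, `|ratr c - x| < ratr q.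
    have [|c] := @rat_in_itvoo R (x - ratr q) (x + ratr q).
      by rewrite ltrD2l gtrN.
    by rewrite in_itv /= => h; exists c; rewrite ltr_norml; lra.
  move=> cx.
  have [w wv] : exists w : 'rV[rat]_n, `|map_mx ratr w - v| < ratr q.
    have /choice[w hw] : forall j : 'I_n, exists c : rat, `|ratr c - v 0 j| < ratr q.
      move=> j; have [|d] := @rat_in_itvoo R (v 0 j - ratr q) (v 0 j + ratr q).
        by rewrite ltrD2l gtrN.
      by rewrite in_itv /= => h; exists d; rewrite ltr_norml; lra.
    by exists (\row_j w j); apply: mx_norm_lt => // i j; rewrite ord1 !mxE.
  exists ((c, w), q) => //; rewrite /F asboolT//; split=> /=.
    by rewrite -(ltr0q R).
  move=> [y u] [/= cy wu]; apply: ball_r; rewrite -ball_normE /=.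
  have h : ratr q < r / 2.
    by rewrite (lt_le_trans qr)// ler_pM2l// lef_pV2// ?posrE// ler_nat.
  have rq2 : ratr q + ratr q < r by rewrite (splitr r) ltrD.
  apply: row_cons_norm_lt => //; apply: le_lt_trans rq2.
    by rewrite -(subrKA (ratr c)) (le_trans (ler_normD _ _))// lerD// ltW// distrC.
  rewrite -(subrKA (map_mx ratr w)) (le_trans (ler_normD _ _))// lerD// ltW//.
  by rewrite distrC.
apply: countable_bigcupT_measurable => [|i]; first exact: countableP.
rewrite /F; case: asboolP => [[i0 _]|_]; last exact: measurable0.
apply: measurableX.
  apply: open_measurable.
  by have := @ball_open R R (ratr i.1.1) (ratr i.2); rewrite -ball_normE; apply.
apply: open_borel; have := @ball_open R 'rV[R]_n (map_mx ratr i.1.2) (ratr i.2).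
by rewrite -ball_normE; apply.
Qed.

End borel_sets.

Section lebesgue_rV_measure.
Context {R : realType}.
Local Notation mu n := (@lebesgue_rV R n).

Lemma pushforward_measure_exists d d' (T1 : measurableType d) (T2 : measurableType d')
    (m : {measure set T1 -> \bar R}) (f : T1 -> T2) : measurable_fun setT f ->
  exists m' : {measure set T2 -> \bar R}, forall A, m' A = m (f @^-1` A).
Proof.
move=> mf; unshelve eexists.
  refine (pushforward m f : {measure set T2 -> \bar R}).
  exact: mf.
by [].
Qed.

Lemma sigma_finite_measure_exists d (T : measurableType d) (m : {measure set T -> \bar R}) :
  sigma_finite setT m -> exists m' : {sigma_finite_measure set T -> \bar R},
  forall A, m' A = m A.
Proof.
move=> sm; unshelve eexists.
  pose H1 := isSFinite.Build _ _ _ _ (sfinite_measure_sigma_finite sm).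
  pose H2 := isSigmaFinite.Build _ _ _ _ sm.
  exact: (HB.pack_for (SigmaFiniteMeasure.type T R) (Measure.sort m) H1 H2).
by [].
Qed.

Definition cube n (r : R) : set (borel 'rV[R]_n) := [set v : 'rV[R]_n | `|v| <= r].

Definition parallelotope n p (A : 'M[R]_(n, p)) (w : 'rV[R]_p) (r : R) :
  set (borel 'rV[R]_n) := [set z : 'rV[R]_n | `|z *m A - w| <= r].

Lemma measurable_parallelotope n p (A : 'M[R]_(n, p)) (w : 'rV[R]_p) (r : R) :
  measurable (parallelotope A w r).
Proof.
rewrite -[X in measurable X]setCK; apply: measurableC.
have -> : ~` parallelotope A w r =
    (fun z => `|z *m A - w|) @^-1` [set x | r < x].
  by apply/seteqP; split=> z /=; rewrite ltNge => /negP.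
apply: open_borel; apply: open_comp; last exact: open_gt.
move=> z _; apply: (continuous_comp (f := fun z : 'rV[R]_n => z *m A - w)
  (g := Num.norm)); last exact: norm_continuous.
exact: (continuousB (@mulmxr_continuous R 1 n p A z) (@cst_continuous _ _ w z)).
Qed.

Lemma measurable_cube n r : measurable (@cube n r).
Proof.
have := @measurable_parallelotope n n 1%:M 0 r; congr (measurable _).
by apply/seteqP; split=> z; rewrite /cube /parallelotope /= mulmx1 subr0.
Qed.

Lemma lebesgue_rVS n (m : {sigma_finite_measure set (borel 'rV[R]_n) -> \bar R}) :
  (forall B, mu n B = m B) -> forall B : set (borel 'rV[R]_n.+1),
  mu n.+1 B = (@lebesgue_measure R \x m)%E (@row_cons R n @^-1` B).
Proof.
move=> E B; rewrite /product_measure1.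
transitivity (\int[lebesgue_measure]_x mu n [set v : 'rV[R]_n | B (row_cons (x, v))])%E.
  by [].
apply: eq_integral => x _.
by rewrite E; congr (m _); apply/seteqP; split=> v /=; rewrite /xsection /= inE.
Qed.

(** The recursive formula defines a product measure as soon as the measure of the previous
    dimension is sigma-finite, which the finiteness on cubes guarantees: existence and
    finiteness are proved together. *)
Lemma lebesgue_rV_exists n :
  exists2 m : {sigma_finite_measure set (borel 'rV[R]_n) -> \bar R},
    (forall B, mu n B = m B) & forall r, (m (cube r) < +oo)%E.
Proof.
have sfin p (m : {measure set (borel 'rV[R]_p) -> \bar R}) :
    (forall r, (m (cube r) < +oo)%E) -> sigma_finite setT m.
  move=> mfin; exists (fun k => cube k%:R) => [|k]; last first.
    by split; [exact: measurable_cube|exact: mfin].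
  apply/seteqP; split=> // v _; exists (Num.bound `|v|) => //=.
  by rewrite /cube /= ltW// archi_boundP.
elim: n => [|n [m mE mfin]].
  have fin0 r : (@dirac _ (borel 'rV[R]_0) (0%R : 'rV[R]_0) R (@cube 0 r) < +oo)%E.
    by rewrite diracE ltry.
  have [m mE] := sigma_finite_measure_exists (sfin 0%N _ fin0).
  by exists m => [B|r]; rewrite mE //; exact: fin0.
have [m1 m1E] := pushforward_measure_exists (@lebesgue_measure R \x m)%E
  (@measurable_row_cons R n).
have fin1 r : (m1 (cube r) < +oo)%E.
  pose J : set R := [set` `[- r, r]].
  rewrite m1E; apply: (@le_lt_trans _ _ ((@lebesgue_measure R \x m) (J `*` @cube n r))%E).
    apply: le_measure; rewrite ?inE.
    - rewrite -[X in measurable X]setTI; apply: measurable_row_cons => //.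
      exact: measurable_cube.
    - by apply: measurableX; [exact: measurable_itv|exact: measurable_cube].
    move=> [x v]; rewrite /cube /= => h; split=> /=.
      by have := le_trans (mx_entry_le _ 0 0) h; rewrite row_cons0 /J /= in_itv /= ler_norml.
    apply: mx_norm_le => [|i j]; first exact: le_trans (normr_ge0 _) h.
    by have := le_trans (mx_entry_le _ 0 (lift 0 j)) h; rewrite row_consS ord1.
  rewrite product_measure1E /J; [|exact: measurable_itv|exact: measurable_cube].
  apply: lte_mul_pinfty; [exact: measure_ge0| |exact: mfin].
  by rewrite /= lebesgue_measure_itv /=; case: ifP => _ //; rewrite -EFinB.
have [m2 m2E] := sigma_finite_measure_exists (sfin _ m1 fin1).
exists m2 => [B|r]; last by rewrite m2E.
by rewrite m2E m1E (lebesgue_rVS mE).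
Qed.

Lemma lebesgue_rV0 n : mu n set0 = 0%E.
Proof. by have [m -> _] := lebesgue_rV_exists n; rewrite measure0. Qed.

Lemma lebesgue_rV_ge0 n B : (0 <= mu n B)%E.
Proof. by have [m -> _] := lebesgue_rV_exists n; rewrite measure_ge0. Qed.

Lemma lebesgue_rV_semi_sigma_additive n : semi_sigma_additive (mu n).
Proof.
have [m mE _] := lebesgue_rV_exists n.
have -> : mu n = m by apply/funext => B.
exact: measure_semi_sigma_additive.
Qed.

HB.instance Definition _ n := isMeasure.Build _ _ _ (mu n)
  (lebesgue_rV0 n) (@lebesgue_rV_ge0 n) (@lebesgue_rV_semi_sigma_additive n).

Lemma measurable_section_rV n (B : set (borel 'rV[R]_n.+1)) : measurable B ->
  measurable_fun setT
    (fun x : R => mu n [set v : 'rV[R]_n | B (row_cons (x, v))]).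
Proof.
move=> mB; have [m mE _] := lebesgue_rV_exists n.
have mB' : measurable (@row_cons R n @^-1` B : set (R * borel 'rV[R]_n)).
  by rewrite -[X in measurable X]setTI; apply: measurable_row_cons.
have := measurable_fun_xsection m mB'; congr (measurable_fun _ _).
apply/funext => x; rewrite mE /=; congr (m _).
by apply/seteqP; split=> v; rewrite /xsection /= inE.
Qed.

(** If z = (x, v) satisfies |z A - w| <= r, then pairing with the vector u of the
    cofactors of the first row confines x to an interval of length
    2 r (sum |u_b|) / |det A|, while for fixed x, dropping a column that maximizes
    |u_b| confines v to a set of the same form in one dimension less. *)
Lemma lebesgue_rV_parallelotope n (A : 'M[R]_n) (w : 'rV[R]_n) (r : R) : 0 <= r ->
  A \in unitmx ->
  (mu n (parallelotope A w r) <= (n`!%:R * (2 * r) ^+ n / `|\det A|)%:E)%E.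
Proof.
move=> r0; elim: n A w => [|n IHn] A w uA.
  by rewrite /= det_mx00 normr1 expr0 !mulr1 invr1 mulr1 lee_fin indicE lern1 leq_b1.
pose u b := cofactor A 0 b.
have duA : \det A = \sum_b A 0 b * u b by rewrite (expand_det_row _ 0).
have dA : \det A != 0 by rewrite -unitfE -unitmxE.
pose j := [arg max_(b > (0 : 'I_n.+1)) `|u b|]%O.
have uj b : `|u b| <= `|u j|.
  by rewrite /j; case: arg_maxP => // k _ /(_ b isT).
have uj0 : 0 < `|u j|.
  rewrite normr_gt0; apply: contra dA => /eqP uj0.
  rewrite duA big1// => b _; have := uj b; rewrite uj0 normr0 normr_le0 => /eqP ->.
  by rewrite mulr0.
pose B := row' 0 (col' j A).
have dB : `|\det B| = `|u j| by rewrite /u /cofactor normrM normrX normrN1 expr1n mul1r.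
have uB : B \in unitmx by rewrite unitmxE unitfE -normr_gt0 dB.
pose K := n`!%:R * (2 * r) ^+ n / `|u j|.
have K0 : 0 <= K by rewrite /K !mulr_ge0 ?invr_ge0// exprn_ge0// mulr_ge0.
pose c := (\sum_b w 0 b * u b) / \det A.
pose s := r * n.+1%:R * `|u j| / `|\det A|.
have s0 : 0 <= s by rewrite /s !mulr_ge0// invr_ge0.
pose I := [set` `[c - s, c + s]] : set R.
have zA (x : R) (v : 'rV[R]_n) b : (row_cons (x, v) *m A) 0 b =
    x * A 0 b + (v *m row' 0 A) 0 b.
  rewrite [LHS]mxE big_ord_recl row_cons0; congr (_ + _).
  by rewrite [RHS]mxE; apply: eq_bigr => i _; rewrite row_consS [in RHS]mxE.
have sec x : (mu n [set v : 'rV[R]_n | parallelotope A w r (row_cons (x, v))] <= (K * \1_I x)%:E)%E.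
  rewrite indicE; case: (boolP (x \in I)) => xI; last first.
    rewrite mulr0 (_ : [set _ | _] = set0) ?measure0//.
    apply/seteqP; split=> // v /= h; move/negP: xI; apply; rewrite inE /I /= in_itv /=.
    suff : `|x - c| <= s by rewrite ler_norml; lra.
    have E : x * \det A - \sum_b w 0 b * u b =
        \sum_b (row_cons (x, v) *m A - w) 0 b * u b.
      under [RHS]eq_bigr => b _ do rewrite entryD entryN mulrBl.
      rewrite sumrB; congr (_ - _).
      have -> : \sum_b (row_cons (x, v) *m A) 0 b * u b =
          (row_cons (x, v) *m (A *m \adj A)) 0 0.
        have adjE b : \adj A b 0 = u b by rewrite mxE.
        by rewrite mulmxA [RHS]mxE; apply: eq_bigr => b _; rewrite adjE.
      rewrite mul_mx_adj mul_mx_scalar entryZ mulrC; congr (_ * _).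
      by rewrite row_cons0.
    have -> : x - c = (x * \det A - \sum_b w 0 b * u b) / \det A.
      by rewrite mulrBl mulfK.
    rewrite normrM normfV ler_wpM2r ?invr_ge0// E.
    rewrite (le_trans (ler_norm_sum _ _ _))//.
    apply: (@le_trans _ _ (\sum_(b < n.+1) r * `|u j|)).
      apply: ler_sum => b _; rewrite normrM ler_pM//.
      exact: le_trans (mx_entry_le _ _ _) h.
    by rewrite sumr_const card_ord -mulr_natr le_eqVlt; apply/orP; left; apply/eqP; ring.
  rewrite mulr1 /K -dB.
  pose w' : 'rV[R]_n := \row_b (w 0 (lift j b) - x * A 0 (lift j b)).
  apply: le_trans (IHn B w' uB).
  apply: le_measure; rewrite ?inE.
  - have -> : [set v : 'rV[R]_n | parallelotope A w r (row_cons (x, v))] =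
        parallelotope (row' 0 A) (w - x *: row 0 A) r.
      rewrite /parallelotope; apply/seteqP; split=> v /=.
        by congr (`|_| <= _); apply/rowP => b; rewrite !entryD !entryN zA entryD entryN entryZ [row 0 A _ _]mxE; ring.
      by congr (`|_| <= _); apply/rowP => b; rewrite !entryD !entryN zA entryD entryN entryZ [row 0 A _ _]mxE; ring.
    exact: measurable_parallelotope.
  - exact: measurable_parallelotope.
  - move=> v /= h; apply: mx_norm_le => // i b; rewrite ord1.
    have := le_trans (mx_entry_le _ 0 (lift j b)) h.
    rewrite !entryD !entryN zA [w' _ _]mxE.
    have -> : (v *m B) 0 b = (v *m row' 0 A) 0 (lift j b).
      by rewrite !mxE; apply: eq_bigr => k _; rewrite !mxE.
    by congr (`|_| <= _); ring.
rewrite [leLHS]/=.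
apply: (@le_trans _ _ (\int[lebesgue_measure]_x (K * \1_I x)%:E)%E).
  apply: ge0_le_integral => //.
  - exact: (measurable_section_rV (measurable_parallelotope A w r)).
  - apply/measurable_EFinP; apply: measurable_funM => //.
    by apply: measurable_indic; exact: measurable_itv.
  - by move=> x _; exact: sec.
under eq_integral => x _ do rewrite EFinM.
rewrite ge0_integralZl//; last first.
  by apply/measurable_EFinP; apply: measurable_indic; exact: measurable_itv.
rewrite (@integral_indic _ _ _ lebesgue_measure setT measurableT I)//; last first.
  exact: measurable_itv.
have muI : @lebesgue_measure R I = (2 * s)%:E.
  rewrite /I lebesgue_measure_itv /= lte_fin; case: ifPn => h.
    by rewrite -EFinD; congr (_%:E); ring.
  by congr (_%:E); move: h; rewrite -leNgt; lra.
rewrite setIT; apply: (@le_trans _ _ (K%:E * (2 * s)%:E)%E).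
  by rewrite -muI; exact: lexx.
rewrite -EFinM lee_fin /K /s factS natrM exprS.
have ujN : `|u j| != 0 by rewrite gt_eqF.
have dAN : `|\det A| != 0 by rewrite normr_eq0.
rewrite le_eqVlt; apply/orP; left; apply/eqP.
by field; rewrite ujN dAN.
Qed.

End lebesgue_rV_measure.

(** * The base measure of an atlas, and volume forms as densities *)

Section density.
Context d (T : measurableType d) (R : realType).
Variables (nu m : {measure set T -> \bar R}) (delta : T -> R).
Hypothesis mdelta : measurable_fun setT delta.
Hypothesis delta0 : forall x, 0 <= delta x.
Hypothesis mE : forall Y, measurable Y -> m Y = (\int[nu]_(x in Y) (delta x)%:E)%E.

Import HBNNSimple.

(** The identity holds for indicators by hypothesis, hence for simple functions, hence by
    monotone convergence for nonnegative functions. *)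
Lemma integral_density_nnsfun (f : {nnsfun T >-> R}) :
  (\int[m]_x (f x)%:E = \int[nu]_x (f x * delta x)%:E)%E.
Proof.
have mf k : measurable (f @^-1` [set k]).
  by rewrite -[X in measurable X]setTI; exact/measurable_funP.
have m1 k : measurable_fun setT (\1_(f @^-1` [set k]) : T -> R).
  exact: measurable_indic.
under eq_integral do rewrite fimfunE -fsumEFin//.
rewrite ge0_integral_fsum//; last 2 first.
- by move=> k; exact/measurable_EFinP/measurable_funM.
- by move=> k x _; rewrite nnfun_muleindic_ge0.
transitivity (\int[nu]_x \sum_(k \in range f)
    (k * \1_(f @^-1` [set k]) x * delta x)%:E)%E; last first.
  apply: eq_integral => x _; rewrite fsumEFin//; congr (_%:E).
  by rewrite -mulr_fsuml -fimfunE.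
rewrite ge0_integral_fsum//; last 2 first.
- move=> k; apply/measurable_EFinP; apply: measurable_funM => //.
  exact: measurable_funM.
- move=> k x _; rewrite EFinM mule_ge0 ?lee_fin//.
  by have := nnfun_muleindic_ge0 f k x; rewrite lee_fin.
apply: eq_fsbigr => k _; rewrite integralZl_indic_nnsfun// integral_indic// setIT mE//.
have [k0|k0] := ltP k 0.
  rewrite preimage_nnfun0// integral_set0 mule0 integral0_eq// => x _.
  by rewrite indic0 mulr0 mul0r.
under [RHS]eq_integral => x _ do rewrite -mulrA EFinM.
rewrite ge0_integralZl//; last 2 first.
- by apply/measurable_EFinP; exact: measurable_funM.
- by move=> x _; rewrite lee_fin mulr_ge0.
congr (_ * _)%E; rewrite integral_mkcond; apply: eq_integral => x _.
by rewrite patchE indicE; case: ifPn => _; rewrite ?mul1r ?mul0r.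
Qed.

Lemma integral_density (f : T -> \bar R) : measurable_fun setT f ->
  (forall x, (0 <= f x)%E) ->
  (\int[m]_x f x = \int[nu]_x (f x * (delta x)%:E))%E.
Proof.
move=> mf f0; pose f_ := nnsfun_approx measurableT mf.
have cvf x : (EFin \o f_^~ x) @ \oo --> f x by exact: cvg_nnsfun_approx.
transitivity (limn (fun k => \int[m]_x (f_ k x)%:E))%E.
  rewrite -monotone_convergence//.
  - apply: eq_integral => x _; apply/esym/cvg_lim => //; exact: cvf.
  - by move=> k; exact/measurable_EFinP/measurable_funP.
  - by move=> k x _; rewrite lee_fin.
  - by move=> x _ k l kl; rewrite lee_fin; exact/lefP/nd_nnsfun_approx.
have -> : (fun k => \int[m]_x (f_ k x)%:E)%E =
    (fun k => \int[nu]_x (f_ k x * delta x)%:E)%E.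
  by apply/funext => k; exact: integral_density_nnsfun.
rewrite -monotone_convergence//.
- apply: eq_integral => x _; apply/cvg_lim => //.
  under eq_fun do rewrite EFinM.
  by apply: cvgeZr => //; exact: cvf.
- by move=> k; apply/measurable_EFinP; apply: measurable_funM => //; exact: measurable_funP.
- by move=> k x _; rewrite lee_fin mulr_ge0.
- move=> x _ k l kl; rewrite lee_fin ler_wpM2r//.
  exact/lefP/nd_nnsfun_approx.
Qed.

End density.

Lemma integral_mrestr d (T : measurableType d) (R : realType)
    (m : {measure set T -> \bar R}) (D : set T) (mD : measurable D) (f : T -> \bar R) :
  measurable_fun setT f -> (forall x, (0 <= f x)%E) ->
  (\int[mrestr m mD]_x f x = \int[m]_(x in D) f x)%E.
Proof.
move=> mf f0; rewrite (@integral_density _ _ _ m _ (\1_D : T -> R))//.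
- rewrite [RHS]integral_mkcond; apply: eq_integral => x _.
  by rewrite patchE indicE; case: ifPn => _; rewrite ?mule1 ?mule0.
- by move=> Y mY; rewrite integral_indic// /mrestr setIC.
Qed.

Section base_measure.
Context {R : realType} {n : nat} {M : ptopologicalType} (A : smooth_atlas R n M).
Local Notation lambda := (@lebesgue_rV R n).

Definition chart_piece i : set (borel M) := [set x | chart_at A x = i].
Definition piece i : set (borel 'rV[R]_n) := phi A i @` chart_piece i.

Lemma dom_chart_piece i : chart_piece i `<=` dom A i.
Proof. by move=> x <-; exact: dom_chart_at. Qed.

Lemma chart_pieceE i : chart_piece i =
  dom A i `\` \bigcup_(j < i) dom A j.
Proof.
apply/seteqP; split=> x.
  move=> xi; split; first exact: dom_chart_piece.
  by move=> [j /= ji /chart_at_min]; rewrite xi leqNgt ji.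
move=> [ix nx]; apply/eqP; rewrite eqn_leq chart_at_min//= leqNgt.
by apply/negP => h; apply: nx; exists (chart_at A x) => //; exact: dom_chart_at.
Qed.

Lemma measurable_chart_piece i : measurable (chart_piece i).
Proof.
rewrite chart_pieceE; apply: measurableD; first exact: (open_borel (@open_dom _ _ _ A _)).
by apply: bigcup_measurable => j _; exact: (open_borel (@open_dom _ _ _ A _)).
Qed.

(** The inverse chart, sent to a fixed point outside of the image of the chart, where its
    values are arbitrary, to make it measurable. *)
Definition psi_total i : borel 'rV[R]_n -> borel M :=
  fun y => if y \in codom A i then psi A i y else point.

Lemma measurable_psi_total i : measurable_fun setT (psi_total i).
Proof.
have mc : measurable (codom A i : set (borel 'rV[R]_n)) by exact: (open_borel (@codom_open _ _ _ A _)).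
have mpsi : measurable_fun (codom A i : set (borel 'rV[R]_n)) (psi A i : _ -> borel M).
  by apply: open_continuous_borel; [exact: codom_open|move=> y; exact: continuous_psi].
move=> _ B mB; rewrite setTI.
have -> : psi_total i @^-1` B = (codom A i `&` psi A i @^-1` B) `|`
    (~` codom A i `&` [set _ | B point]).
  apply/seteqP; split=> y; rewrite /psi_total /=.
    case: ifPn => yi By; [left; split=> //; exact: set_mem|right; split=> //].
    by move/mem_set; exact/negP.
  case=> -[yi]; first by rewrite mem_set.
  by rewrite memNset.
apply: measurableU; first exact: mpsi.
have [Bp|Bp] := pselect (B point).
  rewrite (_ : [set _ | _] = setT) ?setIT; first exact: measurableC.
  by apply/seteqP; split.
rewrite (_ : [set _ | _] = set0) ?setI0//.
by apply/seteqP; split.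
Qed.

Lemma image_chart_piece i (Y : set (borel M)) :
  phi A i @` (Y `&` chart_piece i) = piece i `&` psi_total i @^-1` Y.
Proof.
apply/seteqP; split=> y /=.
  move=> [x [Yx xi] <-]; split; first by exists x.
  have ix := dom_chart_piece xi.
  by rewrite /psi_total mem_set ?phiK//; exact: codom_phi.
move=> [[x xi <-]]; have ix := dom_chart_piece xi.
rewrite /psi_total mem_set ?phiK//; last exact: codom_phi.
by exists x.
Qed.

Lemma pieceE i : piece i = codom A i `&` psi_total i @^-1` chart_piece i.
Proof.
apply/seteqP; split=> y /=.
  move=> [x xi <-]; have ix := dom_chart_piece xi.
  by split; [exact: codom_phi|rewrite /psi_total mem_set ?phiK//; exact: codom_phi].
move=> [[x ix <-]]; rewrite /psi_total mem_set ?phiK//; last exact: codom_phi.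
by exists x.
Qed.

Lemma measurable_piece i : measurable (piece i).
Proof.
rewrite pieceE; apply: measurableI; first exact: (open_borel (@codom_open _ _ _ A _)).
by rewrite -[X in measurable X]setTI; apply: measurable_psi_total => //;
  exact: measurable_chart_piece.
Qed.

Lemma psi_piece i y : piece i y -> [/\ codom A i y, chart_piece i (psi A i y) &
  psi_total i y = psi A i y].
Proof.
move=> [x xi <-]; have ix := dom_chart_piece xi; rewrite phiK//.
have iy := codom_phi ix; split=> //.
by rewrite /psi_total mem_set// phiK.
Qed.

(** chart_at partitions M into Borel pieces, each of which is given the Lebesgue
    measure of its chart. *)
Definition chart_measure (i : nat) : {measure set (borel M) -> \bar R}.
Proof.
refine (pushforward (mrestr lambda (measurable_piece i)) (psi_total i)
  : {measure set (borel M) -> \bar R}).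
exact: measurable_psi_total.
Defined.

Definition base_measure : {measure set (borel M) -> \bar R} := mseries chart_measure 0.

Lemma integral_base_measure (F : borel M -> \bar R) : measurable_fun setT F ->
  (forall x, (0 <= F x)%E) ->
  (\int[base_measure]_x F x =
   \sum_(0 <= i <oo) \int[lambda]_(y in piece i) F (psi A i y))%E.
Proof.
move=> mF F0; rewrite /base_measure ge0_integral_measure_series//.
apply: eq_eseriesr => i _; rewrite /chart_measure /=.
rewrite ge0_integral_pushforward//; last exact: measurable_psi_total.
rewrite preimage_setT integral_mrestr; first last.
- by move=> y; exact: F0.
- by apply: measurableT_comp => //; exact: measurable_psi_total.
by apply: eq_integral => y /set_mem /psi_piece[_ _ /= ->].
Qed.

(** A tensor field jumps between two pieces, but on each piece it is its own matrix in one
    chart, which is smooth. *)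
Lemma measurable_smooth_chartwise (f : borel M -> R) :
  (forall i, exists2 F : 'rV[R]_n -> R, smooth_on (codom A i) F &
     forall x, chart_piece i x -> f x = F (phi A i x)) ->
  measurable_fun setT f.
Proof.
move=> H _ B mB; rewrite setTI.
have -> : f @^-1` B = \bigcup_i (chart_piece i `&` f @^-1` B).
  apply/seteqP; split=> [x Bx|x [i _ []]//].
  by exists (chart_at A x).
apply: bigcup_measurable => i _; have [F sF FE] := H i.
have mF : measurable_fun (dom A i : set (borel M)) (F \o phi A i : borel M -> R).
  apply: open_continuous_measurable; first exact: open_dom.
  move=> x ix; apply: continuous_comp; first exact: continuous_phi.
  exact: (smooth_continuous sF (codom_phi ix)).
have -> : chart_piece i `&` f @^-1` B =
    chart_piece i `&` (dom A i `&` (F \o phi A i) @^-1` B).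
  apply/seteqP; split=> x /=.
    by move=> [xi Bx]; split=> //; split; [exact: dom_chart_piece|rewrite -FE].
  by move=> [xi [_ Bx]]; split=> //; rewrite FE.
apply: measurableI; first exact: measurable_chart_piece.
by apply: mF => //; exact: (open_borel (@open_dom _ _ _ A _)).
Qed.

Lemma in_chart_piece t i x : chart_piece i x -> in_chart A i t (phi A i x) = t x.
Proof. by move=> <-; exact: in_chart_chart_at. Qed.

Lemma measurable_det (t : tensor_field R n M) : smooth_section A t ->
  measurable_fun setT ((fun x => \det (t x)) : borel M -> R).
Proof.
move=> st; apply: measurable_smooth_chartwise => i.
exists (fun y => \det (in_chart A i t y)).
  by apply: smooth_det; [exact: codom_open|exact: smooth_in_chart].
by move=> x xi; rewrite in_chart_piece.
Qed.

Lemma measurable_gnorm2 (t h : tensor_field R n M) : riem_metric A t ->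
  smooth_section A h -> measurable_fun setT ((fun x => gnorm2 (t x) (h x)) : borel M -> R).
Proof.
move=> mt sh; apply: measurable_smooth_chartwise => i.
exists (fun y => gnorm2 (in_chart A i t y) (in_chart A i h y)).
  apply: smooth_gnorm2; first exact: codom_open.
  - by move=> y iy; exact/metric_mx_unit/riem_metric_in_chart.
  - by apply: smooth_in_chart; case: mt => -[].
  - exact: smooth_in_chart.
by move=> x xi; rewrite !in_chart_piece.
Qed.

Lemma measurable_sqrt_fun (f : borel M -> R) : measurable_fun setT f ->
  measurable_fun setT ((fun x => Num.sqrt (f x)) : borel M -> R).
Proof.
move=> mf; apply: (measurableT_comp _ mf).
by apply: continuous_measurable_fun; exact: sqrt_continuous.
Qed.

(** The density of the volume of t with respect to [base_measure]: on each piece, both are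
    expressed in the same chart. *)
Definition voldens (t : tensor_field R n M) : borel M -> R := fun x => Num.sqrt (\det (t x)).

Lemma voldens_ge0 t x : 0 <= voldens t x.
Proof. exact: sqrtr_ge0. Qed.

Lemma measurable_voldens t : smooth_section A t -> measurable_fun setT (voldens t).
Proof. by move=> st; apply: measurable_sqrt_fun; exact: measurable_det. Qed.

Lemma volE t (Y : set (borel M)) : smooth_section A t -> measurable Y ->
  vol A t Y = (\int[base_measure]_(x in Y) (voldens t x)%:E)%E.
Proof.
move=> st mY; rewrite [RHS]integral_mkcond integral_base_measure; first last.
- by move=> x; rewrite patchE; case: ifP => _ //; rewrite lee_fin voldens_ge0.
- have mv : measurable_fun setT (fun x : borel M => (voldens t x)%:E).
    by apply/measurable_EFinP; exact: measurable_voldens.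
  exact: ((measurable_restrictT _ mY).1 (measurable_funTS mv)).
rewrite /vol; apply: eq_eseriesr => i _.
have E0 := image_chart_piece i Y; rewrite /chart_piece in E0.
rewrite E0 integral_mkcondr; apply: eq_integral => y /set_mem py.
have [iy _ E] := psi_piece py.
rewrite !patchE; suff -> : (y \in psi_total i @^-1` Y) = (psi A i y \in Y) by [].
by apply/idP/idP => /set_mem h; apply/mem_set; move: h; rewrite /= E.
Qed.

Lemma vol_ge0 t Y : (0 <= vol A t Y)%E.
Proof.
apply: nneseries_ge0 => i _ _; apply: integral_ge0 => y _.
by rewrite lee_fin sqrtr_ge0.
Qed.

Lemma vol_measure_exists t : smooth_section A t ->
  exists m : {measure set (borel M) -> \bar R}, (m : set (borel M) -> \bar R) = vol A t.
Proof.
move=> st.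
have v0 : vol A t set0 = 0%E by rewrite volE// integral_set0.
have vs : semi_sigma_additive (vol A t).
  move=> F mF tF mUF; rewrite volE//.
  have mv : measurable_fun (\bigcup_k F k) (fun x => (voldens t x)%:E).
    by apply: measurable_funTS; apply/measurable_EFinP; exact: measurable_voldens.
  rewrite ge0_integral_bigcup//; last by move=> x _; rewrite lee_fin voldens_ge0.
  rewrite (_ : (fun k => \sum_(0 <= i < k) vol A t (F i))%E =
      (fun k => \sum_(0 <= i < k) \int[base_measure]_(x in F i) (voldens t x)%:E)%E).
    apply: is_cvg_nneseries => i _ _; apply: integral_ge0 => x _.
    by rewrite lee_fin voldens_ge0.
  by apply/funext => k; apply: eq_bigr => i _; rewrite volE.
pose H := isMeasure.Build _ _ _ (vol A t) v0 (vol_ge0 t) vs.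
by exists (HB.pack_for {measure set (borel M) -> \bar R} (vol A t) H).
Qed.

Lemma integral_vol t (f : borel M -> \bar R) : smooth_section A t ->
  measurable_fun setT f -> (forall x, (0 <= f x)%E) ->
  (\int[vol A t]_x f x = \int[base_measure]_x (f x * (voldens t x)%:E))%E.
Proof.
move=> st mf f0; have [m mE] := vol_measure_exists st; rewrite -mE.
apply: integral_density => //.
- exact: measurable_voldens.
- exact: voldens_ge0.
- by move=> Y mY; rewrite mE volE.
Qed.

(** A Riemannian metric has a positive density, hence the nullsets of the base
    measure. *)
Lemma nullset_base_measure g Y : riem_metric A g -> nullset A g Y ->
  base_measure.-negligible Y.
Proof.
move=> mg [B [mB B0 YB]]; exists B; split=> //.
have sg : smooth_section A g by case: mg => -[].
move: B0; rewrite volE// => B0.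
have : ae_eq base_measure B (fun x => (voldens g x)%:E) (cst 0%E).
  apply/ae_eq_integral_abs => //.
    by apply: measurable_funTS; apply/measurable_EFinP; exact: measurable_voldens.
  rewrite -[RHS]B0; apply: eq_integral => x _.
  by rewrite gee0_abs// lee_fin voldens_ge0.
move=> [N [mN N0 BN]].
apply/eqP; rewrite eq_le measure_ge0 andbT -N0; apply: le_measure; rewrite ?inE//.
move=> x Bx; apply: BN => /= /(_ Bx) /eqP; rewrite eqe /voldens sqrtr_eq0 leNgt.
by move/negP; apply; exact: (metric_mx_det (riem_metric_mx x mg)).
Qed.

End base_measure.

(** * Finiteness of the volume *)

Lemma near_le (R : realType) (a b c : R) : `|a - b| < c -> b <= a + c.
Proof. by rewrite ltr_norml => /andP[h _]; lra. Qed.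

Section measure_bounds.
Context d (T : measurableType d) (R : realType).
Variable m : {measure set T -> \bar R}.

Lemma measure_bigsetU_le (I : Type) (r : seq I) (F : I -> set T) (c : R) :
  (forall i, measurable (F i)) -> (forall i, (m (F i) <= c%:E)%E) ->
  (m (\big[setU/set0]_(i <- r) F i) <= ((size r)%:R * c)%:E)%E.
Proof.
move=> mF Fc; elim: r => [|i r IHr]; first by rewrite big_nil measure0 mul0r.
have mr : measurable (\big[setU/set0]_(i <- r) F i).
  by elim/big_ind : _ => //; exact: measurableU.
rewrite big_cons (le_trans (measureU2 _ (mF i) mr))//.
by rewrite /= -natr1 mulrDl mul1r addrC EFinD leeD.
Qed.

(** The set of the points that belong to E k for all k >= N increases with N, and it is
    contained in E N. *)
Lemma measure_liminf_le (E : nat -> set T) (W : set T) (c : R) :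
  (forall k, measurable (E k)) -> measurable W -> (forall k, (m (E k) <= c%:E)%E) ->
  (forall x, W x -> \forall k \near \oo, E k x) -> (m W <= c%:E)%E.
Proof.
move=> mE mW Ec WE; pose G N := \bigcap_(k in [set k | (N <= k)%N]) E k.
have mG N : measurable (G N) by apply: bigcap_measurable => //; exists N => /=.
have GE N : G N `<=` E N by move=> x; apply => /=.
apply: (@le_trans _ _ (m (\bigcup_N G N))).
  have mUG : measurable (\bigcup_N G N) by exact: bigcupT_measurable.
  by apply: le_measure; rewrite ?inE.
have cv : (m \o G) x @[x --> \oo] --> m (\bigcup_N G N).
  apply: nondecreasing_cvg_mu => //; first exact: bigcupT_measurable.
  move=> k l kl; apply/subsetPset => x Gx j /= lj; apply: Gx => /=.
  exact: leq_trans lj.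
rewrite -(cvg_lim _ cv)//; apply: lime_le; first by apply/cvg_ex; eexists; exact: cv.
apply: nearW => N /=; apply: le_trans (Ec N); apply: le_measure; rewrite ?inE//.
Qed.

End measure_bounds.

Section finite_volume.
Context {R : realType} {n : nat} {M : ptopologicalType} (A : smooth_atlas R n M).
Local Notation lambda := (@lebesgue_rV R n).
Local Notation nu := (base_measure A).

Lemma base_measure_chart_piece i (V : set (borel M)) : measurable V ->
  V `<=` chart_piece A i -> (nu V <= lambda (phi A i @` V))%E.
Proof.
move=> mV Vi.
have VE k : chart_measure A k V = lambda (phi A k @` (V `&` chart_piece A k)).
  by rewrite image_chart_piece setIC.
have V0 k : k != i -> chart_measure A k V = 0%E.
  move=> ki; rewrite VE (_ : V `&` _ = set0) ?image_set0 ?measure0//.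
  apply/seteqP; split=> // x [/Vi xi xk]; move/eqP: ki; apply.
  exact: (etrans (esym xk) xi).
rewrite /base_measure /= /mseries; apply: lime_le.
  by apply: is_cvg_nneseries => k _ _; exact: measure_ge0.
apply: nearW => N; have VEi : chart_measure A i V = lambda (phi A i @` V).
  by rewrite VE (setIidl Vi).
have [iN|iN] := ltnP i N.
  rewrite (bigD1_seq i)/= ?mem_index_iota ?iota_uniq// VEi big1 ?adde0//.
rewrite big_nat big1 ?measure_ge0// => k /andP[_ kN]; apply: V0.
by rewrite neq_ltn (leq_trans kN iN).
Qed.

(** Cubes of side s. For s = 2 w / K, these K ^ n cubes cover the ball of radius w around
    y0. *)
Definition grid_cube (y0 : 'rV[R]_n) (w s : R) K (c : {ffun 'I_n -> 'I_K}) : set 'rV[R]_n :=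
  [set y | forall a, (c a)%:R * s <= y 0 a - y0 0 a + w <= (c a).+1%:R * s].

Lemma grid_cube_diam y0 w s K (c : {ffun 'I_n -> 'I_K}) y z : 0 <= s ->
  grid_cube y0 w s c y -> grid_cube y0 w s c z -> `|y - z| <= s.
Proof.
move=> s0 cy cz; apply: mx_norm_le => // i a; rewrite ord1 !mxE.
have /andP[h1 h2] := cy a; have /andP[h3 h4] := cz a.
move: h2 h4; rewrite -natr1 mulrDl mul1r ler_norml; lra.
Qed.

Lemma grid_cube_cover y0 w K y : 0 < w -> (0 < K)%N -> `|y0 - y| < w ->
  exists c : {ffun 'I_n -> 'I_K}, grid_cube y0 w (2 * w / K%:R) c y.
Proof.
move=> w0 K0 yw; pose s := 2 * w / K%:R.
have s0 : 0 < s by rewrite !mulr_gt0// ?invr_gt0 ?ltr0n.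
have H a : exists c : 'I_K, c%:R * s <= y 0 a - y0 0 a + w <= c.+1%:R * s.
  have := le_lt_trans (mx_entry_le _ 0 a) yw; rewrite entryD entryN ltr_norml.
  move=> /andP[h1 h2]; set u := y 0 a - y0 0 a + w.
  have u0 : 0 <= u / s by rewrite divr_ge0 ?(ltW s0)// /u; lra.
  have uK : (Num.truncn (u / s) < K)%N.
    rewrite truncn_lt_nat// ltr_pdivrMr// /s mulrCA mulfV ?gt_eqF ?ltr0n//.
    by rewrite mulr1 /u; lra.
  exists (Ordinal uK) => /=; have /andP[h3 h4] := truncn_itv u0.
  by rewrite -ler_pdivlMr// h3 -ler_pdivrMr// ltW.
have [c cE] := choice H; exists [ffun a => c a] => a; rewrite ffunE; exact: cE.
Qed.

Lemma smooth_section_sqrt_det t i y : smooth_section A t -> codom A i y ->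
  {for y, continuous (fun z => Num.sqrt (\det (in_chart A i t z)))}.
Proof.
move=> st iy.
have cd : {for y, continuous (fun z => \det (in_chart A i t z))}.
  have sd := smooth_det (@codom_open _ _ _ A i) (@smooth_in_chart _ _ _ A t i st).
  exact: smooth_continuous sd iy.
apply: continuous_comp; first exact: cd.
exact: sqrt_continuous.
Qed.

Lemma sqrt_det_in_chart_piece t i j x : dom A j x -> chart_piece A i x ->
  Num.sqrt (\det (in_chart A j t (phi A j x))) =
  `|\det ('J (phi A i \o psi A j) (phi A j x))| * Num.sqrt (\det (t x)).
Proof.
move=> jx pix; have xi : chart_at A x = i by [].
rewrite in_chartE (phiK jx) xi !det_mulmx det_tr mulrAC -expr2.
by rewrite sqrtrM ?sqr_ge0// sqrtr_sqr.
Qed.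

Lemma transition_ball_sub_parallelotope (B : 'M[R]_n) (s : R) (u v : 'rV[R]_n) :
  B \in unitmx -> 0 < s -> `|u| <= s ->
  `|v - u *m B| <= (n%:R * `|invmx B| + 1)^-1 * `|u| -> `|v *m invmx B| <= 2 * s.
Proof.
move=> uB s0 hs hx; set e := (_ + 1)^-1 in hx.
have k0 : 0 < n%:R * `|invmx B| + 1 by rewrite ltr_wpDl// mulr_ge0.
have e0 : 0 < e by rewrite invr_gt0.
have -> : v *m invmx B = u + (v - u *m B) *m invmx B.
  by rewrite mulmxBl (mulmxK uB) addrC subrK.
rewrite (le_trans (ler_normD _ _))//.
have -> : 2 * s = s + s by ring.
apply: lerD => //; rewrite (le_trans (mulmx_norm_le _ _))//.
apply: le_trans (_ : n%:R * (e * s) * `|invmx B| <= _).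
  rewrite ler_wpM2r// ler_wpM2l// (le_trans hx)// ler_wpM2l// ltW//.
have eb : e * (n%:R * `|invmx B|) <= 1 by rewrite ler_pdivrMl// mulr1 lerDl.
have -> : n%:R * (e * s) * `|invmx B| = e * (n%:R * `|invmx B|) * s by ring.
by rewrite -[leRHS]mul1r ler_wpM2r// ltW.
Qed.

Lemma nbhs_preim (S T : topologicalType) (f : S -> T) x y (G : set T) :
  f x = y -> {for x, continuous f} -> nbhs y G -> nbhs x (f @^-1` G).
Proof. by move=> <- cf; exact: cf. Qed.

(** The volume of a piece is computed in the chart of the piece, whereas finiteness has to
    be shown around a point that need not be in the domain of this chart. Hence the
    comparison with a chart j around that point, at each x1 of the piece separately. *)
Lemma transition_near t i j x1 (e : R) : riem_metric A t -> dom A j x1 ->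
  chart_piece A i x1 -> 0 < e ->
  exists2 r : R, 0 < r & forall x, dom A j x -> chart_piece A i x ->
    `|phi A j x - phi A j x1| < r ->
    `|phi A i x - phi A i x1 - (phi A j x - phi A j x1) *m
        'J (phi A i \o psi A j) (phi A j x1)| <= e * `|phi A j x - phi A j x1| /\
    voldens t x <= 2 * Num.sqrt (\det (t x1)).
Proof.
move=> mt jx1 pix1 e0; have ix1 := dom_chart_piece pix1.
have st : smooth_section A t by case: mt => -[].
have [dS _] := transition_differentiable jx1 ix1.
have val0 : 0 < Num.sqrt (\det (t x1)).
  by rewrite sqrtr_gt0; exact: (metric_mx_det (riem_metric_mx x1 mt)).
have h1 := differentiable_expansion dS e0.
have Sy1 : (phi A i \o psi A j) (phi A j x1) = phi A i x1 by rewrite /= phiK.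
have cS : {for phi A j x1, continuous (phi A i \o psi A j)}.
  exact: differentiable_continuous dS.
pose G : set 'rV[R]_n :=
  [set z | Num.sqrt (\det (in_chart A i t z)) <= 2 * Num.sqrt (\det (t x1))].
have h2 : nbhs (phi A i x1) G.
  have /cvgrPdist_lt/(_ _ val0) := smooth_section_sqrt_det st (codom_phi ix1).
  apply: filterS => z; rewrite in_chart_piece// /G /=.
  by rewrite mulr_natl mulr2n; exact: near_le.
have /nbhs_ballP[r1 /= r10 ball1] := h1.
have /nbhs_ballP[r2 /= r20 ball2] := nbhs_preim Sy1 cS h2.
exists (Order.min r1 r2); first by rewrite lt_min r10 r20.
move=> x jx pix; rewrite lt_min => /andP[xr1 xr2].
have b1 : ball (phi A j x1) r1 (phi A j x) by rewrite -ball_normE /= distrC.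
have b2 : ball (phi A j x1) r2 (phi A j x) by rewrite -ball_normE /= distrC.
have := ball1 _ b1; have := ball2 _ b2.
rewrite /G /= (phiK jx) (phiK jx1) in_chart_piece// => h3 h4; split=> //.
Qed.

(** The transition to chart i maps a small cube of chart j around x1 into a parallelotope
    whose measure is comparable to s ^ n times the Jacobian, and the product of the
    Jacobian and the density in chart i is the density in chart j. The radius r depends on
    x1, the constant does not. *)
Lemma vol_small_cube t i j x1 (C0 : R) : riem_metric A t -> dom A j x1 ->
  chart_piece A i x1 ->
  Num.sqrt (\det (in_chart A j t (phi A j x1))) <= C0 ->
  exists2 r : R, 0 < r & forall s (V : set (borel M)), 0 < s -> s < r -> measurable V ->
    V `<=` dom A j `&` chart_piece A i ->
    (forall x, V x -> `|phi A j x - phi A j x1| <= s) ->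
    (vol A t V <= (2 * n`!%:R * 4 ^+ n * C0 * s ^+ n)%:E)%E.
Proof.
move=> mt jx1 pix1 hC0.
have st : smooth_section A t by case: mt => -[].
have ix1 := dom_chart_piece pix1.
pose z1 := phi A i x1; pose B := 'J (phi A i \o psi A j) (phi A j x1).
have uB : B \in unitmx by exact: jacobian_unit jx1 ix1.
pose val := Num.sqrt (\det (t x1)).
have val0 : 0 < val by rewrite sqrtr_gt0; exact: (metric_mx_det (riem_metric_mx x1 mt)).
have Bval : `|\det B| * val <= C0 by rewrite -(sqrt_det_in_chart_piece t jx1 pix1).
have e0 : 0 < (n%:R * `|invmx B| + 1)^-1 by rewrite invr_gt0 ltr_wpDl// mulr_ge0.
have [r r0 Hr] := transition_near mt jx1 pix1 e0.
exists r => // s V s0 sr mV VW Vs.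
have HV x : V x -> `|phi A i x - z1 - (phi A j x - phi A j x1) *m B| <=
    (n%:R * `|invmx B| + 1)^-1 * `|phi A j x - phi A j x1| /\ voldens t x <= 2 * val.
  by move=> Vx; have [jx pix] := VW _ Vx; exact: Hr jx pix (le_lt_trans (Vs _ Vx) sr).
pose Z := parallelotope (invmx B) (z1 *m invmx B) (2 * s).
have VZ : phi A i @` V `<=` Z.
  move=> _ [x Vx <-]; have [hx _] := HV _ Vx.
  rewrite /Z /parallelotope /= -mulmxBl.
  exact: transition_ball_sub_parallelotope uB s0 (Vs _ Vx) hx.
have -> : vol A t V = (\int[nu]_(x in V) (voldens t x)%:E)%E by rewrite volE.
have mv : measurable_fun V (fun x => (voldens t x)%:E).
  by apply: measurable_funTS; apply/measurable_EFinP; exact: (measurable_voldens st).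
apply: (@le_trans _ _ (\int[nu]_(x in V) (2 * val)%:E)%E).
  apply: ge0_le_integral => //.
  - by move=> x _; rewrite lee_fin voldens_ge0.
  - by move=> x Vx; rewrite lee_fin; case: (HV _ Vx).
rewrite integral_cst//.
apply: (@le_trans _ _ ((2 * val)%:E * (n`!%:R * (2 * (2 * s)) ^+ n / `|\det (invmx B)|)%:E)%E).
  apply: lee_wpmul2l; first by rewrite lee_fin mulr_ge0// ltW.
  have Vi : V `<=` chart_piece A i by move=> x Vx; case: (VW _ Vx).
  apply: le_trans (base_measure_chart_piece mV Vi) _.
  apply: le_trans (lebesgue_rV_parallelotope (z1 *m invmx B) _ _); last 2 first.
  - by rewrite mulr_ge0// ltW.
  - by rewrite unitmx_inv.
  apply: le_measure; rewrite ?inE//; last exact: measurable_parallelotope.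
  have -> : V = V `&` chart_piece A i.
    by apply/seteqP; split=> [x Vx|x []//]; split=> //; case: (VW _ Vx).
  rewrite image_chart_piece; apply: measurableI; first exact: measurable_piece.
  by rewrite -[X in measurable X]setTI; exact: measurable_psi_total.
rewrite -EFinM lee_fin det_inv normfV invrK.
have -> : 2 * val * (n`!%:R * (2 * (2 * s)) ^+ n * `|\det B|) =
    2 * n`!%:R * 4 ^+ n * (`|\det B| * val) * s ^+ n.
  have -> : 2 * (2 * s) = 4 * s by ring.
  by rewrite exprMn; ring.
rewrite ler_wpM2r ?exprn_ge0 ?(ltW s0)// ler_wpM2l// !mulr_ge0// exprn_ge0//.
Qed.

(** In a chart j around x0, cut a ball into cubes of side s K, and drop those whose volume
    exceeds the bound of [vol_small_cube]. The other ones have a total volume that is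
    bounded independently of K, and they contain every given point of the ball when K is
    large. *)
Lemma vol_locally_finite t i x0 : riem_metric A t ->
  exists2 W : set M, open W /\ W x0 & (vol A t (W `&` chart_piece A i) < +oo)%E.
Proof.
move=> mt; have st : smooth_section A t by case: mt => -[].
have [m mE] := vol_measure_exists st.
pose j := chart_at A x0; have jx0 := dom_chart_at A x0.
pose y0 := phi A j x0; have jy0 : codom A j y0 by exact: codom_phi.
pose C0 := Num.sqrt (\det (in_chart A j t y0)) + 1.
have /cvgrPdist_lt/(_ 1 ltr01) h := smooth_section_sqrt_det st jy0.
have h' := open_nbhs_nbhs (conj (@codom_open _ _ _ A j) jy0).
have /nbhs_ballP[w /= w0 ball_w] : nbhs y0 ([set z |
    `|Num.sqrt (\det (in_chart A j t y0)) - Num.sqrt (\det (in_chart A j t z))| < 1]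
    `&` codom A j).
  exact: filterI h h'.
pose W := dom A j `&` phi A j @^-1` (ball y0 w).
have oW : open W.
  rewrite openE => x [jx wx]; apply: filterI.
    exact: open_nbhs_nbhs (conj (@open_dom _ _ _ A j) jx).
  apply: (continuous_phi jx); apply: open_nbhs_nbhs; split=> //.
  exact: ball_open.
exists W; first by split=> //; split=> //; exact: ballxx.
pose C := 2 * n`!%:R * 4 ^+ n * C0.
suff : (m (W `&` chart_piece A i) <= (C * (2 * w) ^+ n)%:E)%E.
  by rewrite mE => /le_lt_trans; apply; rewrite ltry.
pose s K : R := 2 * w / K.+1%:R.
have s0 K : 0 < s K by rewrite !mulr_gt0// invr_gt0.
have C00 : 0 <= C by rewrite /C !mulr_ge0// ?exprn_ge0// addr_ge0// sqrtr_ge0.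
have mcube K (c : {ffun 'I_n -> 'I_K.+1}) :
    measurable (grid_cube y0 w (s K) c : set (borel 'rV[R]_n)).
  have -> : grid_cube y0 w (s K) c = \bigcap_(a in [set: 'I_n])
      (fun y : 'rV[R]_n => y 0 a - y0 0 a + w) @^-1`
      [set u | (c a)%:R * s K <= u <= (c a).+1%:R * s K].
    by apply/seteqP; split=> [y cy a _|y cy a]; [exact: cy|exact: cy].
  apply: fin_bigcap_measurable => // a _.
  have mf : measurable_fun setT ((fun y => y 0 a - y0 0 a + w) : borel 'rV[R]_n -> R).
    have -> : (fun y : 'rV[R]_n => y 0 a - y0 0 a + w) = (fun y => y 0 a + (w - y0 0 a)).
      by apply/funext => z; ring.
    apply: open_continuous_measurable; first exact: openT.
    move=> y _.
    have c1 : {for y, continuous (fun y : 'rV[R]_n => y 0 a)} by exact: coord_continuous.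
    have c2 : {for y, continuous (fun _ : 'rV[R]_n => w - y0 0 a)} by exact: cst_continuous.
    exact: continuous_forD c1 c2.
  have -> : [set u | (c a)%:R * s K <= u <= (c a).+1%:R * s K] =
      [set` `[(c a)%:R * s K, (c a).+1%:R * s K]] :> set R.
    by apply/seteqP; split=> u; rewrite /= in_itv.
  rewrite -[X in measurable X]setTI; apply: mf => //; exact: measurable_itv.
pose V K (c : {ffun 'I_n -> 'I_K.+1}) : set (borel M) :=
  (W `&` chart_piece A i) `&` phi A j @^-1` (grid_cube y0 w (s K) c).
have mW : measurable (W `&` chart_piece A i : set (borel M)).
  by apply: measurableI; [exact: open_borel|exact: measurable_chart_piece].
have mphi : measurable_fun (dom A j : set (borel M)) (phi A j : borel M -> borel 'rV[R]_n).
  by apply: open_continuous_borel; [exact: open_dom|move=> x; exact: continuous_phi].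
have mV K c : measurable (@V K c).
  rewrite /V (_ : _ `&` _ = (W `&` chart_piece A i) `&`
      (dom A j `&` phi A j @^-1` (grid_cube y0 w (s K) c))).
    by apply: measurableI => //; apply: mphi => //; exact: (open_borel (@open_dom _ _ _ A _)).
  apply/seteqP; split=> x; last by move=> [? [_ ?]]; split.
  by move=> [[Wx ?] ?]; split=> //; split=> //; case: Wx.
pose good K (c : {ffun 'I_n -> 'I_K.+1}) := (m (V K c) <= (C * s K ^+ n)%:E)%E.
pose E K := \big[setU/set0]_(c <- [seq c <- enum {ffun 'I_n -> 'I_K.+1} | good K c]) V K c.
apply: (@measure_liminf_le _ _ _ m E) => //.
- by move=> K; rewrite /E; elim/big_ind : _ => //; exact: measurableU.
- move=> K; pose F c := if good K c then V K c else set0.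
  have -> : E K = \big[setU/set0]_(c <- enum {ffun 'I_n -> 'I_K.+1}) F c.
    by rewrite /E big_filter big_mkcond.
  apply: le_trans (measure_bigsetU_le _ (_ : forall c, measurable (F c))
      (_ : forall c, (m (F c) <= (C * s K ^+ n)%:E)%E)) _.
  + by move=> c; rewrite /F; case: ifP.
  + move=> c; rewrite /F; case: ifP => // _; rewrite measure0 lee_fin mulr_ge0//.
    by rewrite exprn_ge0// ltW.
  + rewrite -cardE card_ffun !card_ord lee_fin natrX mulrCA -exprMn /s.
    by rewrite mulrCA mulfV ?gt_eqF// mulr1.
move=> x [[jx wx] pix].
have [/= hx jy] := ball_w _ wx.
have hC0 : Num.sqrt (\det (in_chart A j t (phi A j x))) <= C0.
  exact: near_le hx.
have [r r0 Hr] := vol_small_cube mt jx pix hC0.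
near=> K.
have hK : r^-1 * (2 * w) < K%:R by near: K; exact: nbhs_infty_gtr.
have sKr : s K < r.
  by rewrite /s ltr_pdivrMr// -ltr_pdivrMl// (lt_trans hK)// ltr_nat.
have [||c cx] := @grid_cube_cover y0 w K.+1 (phi A j x) w0.
- by [].
- by move: wx; rewrite -ball_normE.
have gc : good K c.
  rewrite /good mE; apply: Hr => //.
    by move=> z [[[]]].
  move=> z [_ cz]; apply: grid_cube_diam cz cx; exact: ltW.
rewrite /E -bigcup_seq; exists c; first by rewrite /= mem_filter gc mem_enum.
by [].
Unshelve. all: by end_near. Qed.

Lemma vol_finite t : compact [set: M] -> riem_metric A t -> (vol A t setT < +oo)%E.
Proof.
move=> cM mt; have st : smooth_section A t by case: mt => -[].
have [m mE] := vol_measure_exists st; have [N HN] := chart_at_bounded A cM.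
have nbd x0 : exists W : set M, [/\ open W, W x0 & (m W < +oo)%E].
  have H i : exists W : set M, [/\ open W, W x0 & (m (W `&` chart_piece A i) < +oo)%E].
    by have [W [oW Wx] fW] := vol_locally_finite i x0 mt; exists W; rewrite mE.
  have [V HV] := choice H; pose W := \bigcap_(i in [set i | (i < N)%N]) V i.
  have oW : open W.
    rewrite /W bigcap_mkord; elim/big_ind: _ => [|X Y|i _]; first exact: openT.
      exact: openI.
    by case: (HV i).
  exists W; split=> //; first by move=> i _; case: (HV i).
  have mVi i : measurable (V i `&` chart_piece A i : set (borel M)).
    apply: measurableI; last exact: measurable_chart_piece.
    by apply: open_borel; case: (HV i).
  apply: (@le_lt_trans _ _ (m (\big[setU/set0]_(i < N) (V i `&` chart_piece A i)))).
    apply: le_measure; rewrite ?inE.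
    - exact: open_borel.
    - by apply: bigsetU_measurable => i _.
    - move=> x Wx; rewrite -(@bigcup_mkord _ N (fun i => V i `&` chart_piece A i)).
      by exists (chart_at A x); [exact: HN|split=> //; apply: Wx; exact: HN].
  elim: N {HN W oW} => [|N IHN]; first by rewrite big_ord0 measure0.
  have mS : measurable (\big[setU/set0]_(i < N) (V i `&` chart_piece A i : set (borel M))).
    by apply: bigsetU_measurable.
  rewrite big_ord_recr /=; apply: le_lt_trans (measureU2 _ mS (mVi N)) _.
  by apply: lte_add_pinfty => //; case: (HV N).
have [W HW] := choice nbd.
have : cover_compact [set: M] by rewrite -compact_cover.
move=> /(_ _ setT W) [].
- by move=> x _; case: (HW x).
- by move=> x _; exists x => //; case: (HW x).
move=> D _ DW; rewrite -mE.
apply: (@le_lt_trans _ _ (m (\big[setU/set0]_(x <- finmap.enum_fset D) (W x : set (borel M))))).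
  apply: le_measure; rewrite ?inE//.
  - by apply: bigsetU_measurable => x _; apply: open_borel; case: (HW x).
  - by move=> x /DW [y Dy Wy]; rewrite -bigcup_seq; exists y.
elim: (finmap.enum_fset D) => [|x r IHr]; first by rewrite big_nil measure0.
have mW y : measurable (W y : set (borel M)) by apply: open_borel; case: (HW y).
have mr : measurable (\big[setU/set0]_(y <- r) (W y : set (borel M))).
  by apply: bigsetU_measurable.
rewrite big_cons; apply: le_lt_trans (measureU2 _ (mW x) mr) _.
by apply: lte_add_pinfty => //; case: (HW x).
Qed.

End finite_volume.

(** * The space of square integrable functions *)

Section square_integrable.
Context d (T : measurableType d) (R : realType).
Variable nu : {measure set T -> \bar R}.
Implicit Types f g : T -> R.

Definition sqr_integrable f :=
  measurable_fun setT f /\ (\int[nu]_x (f x ^+ 2)%:E < +oo)%E.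

Definition nrm2 f : R := Num.sqrt (fine (\int[nu]_x (f x ^+ 2)%:E)%E).

Lemma nrm2_ge0 f : 0 <= nrm2 f. Proof. exact: sqrtr_ge0. Qed.

Lemma integral_sqr_ge0 f : (0 <= \int[nu]_x (f x ^+ 2)%:E)%E.
Proof. by apply: integral_ge0 => x _; rewrite lee_fin sqr_ge0. Qed.

Lemma nrm2K f : sqr_integrable f -> (\int[nu]_x (f x ^+ 2)%:E)%E = (nrm2 f ^+ 2)%:E.
Proof.
move=> [_ ff]; have f0 := integral_sqr_ge0 f.
by rewrite sqr_sqrtr ?fine_ge0// fineK// ge0_fin_numE.
Qed.

Lemma measurable_sqr f : measurable_fun setT f ->
  measurable_fun setT (fun x => (f x ^+ 2)%:E).
Proof. by move=> mf; apply/measurable_EFinP; exact: measurable_funX. Qed.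

Lemma nrm2_le f (c : R) : 0 <= c -> (\int[nu]_x (f x ^+ 2)%:E <= (c ^+ 2)%:E)%E ->
  nrm2 f <= c.
Proof.
move=> c0 h; have f0 := integral_sqr_ge0 f.
rewrite -[leRHS]ger0_norm// -sqrtr_sqr ler_wsqrtr//.
rewrite -lee_fin fineK// ge0_fin_numE//; exact: le_lt_trans h (ltry _).
Qed.

Lemma young_sqr (a b l : R) : 0 < l ->
  (a + b) ^+ 2 <= (1 + l) * a ^+ 2 + (1 + l^-1) * b ^+ 2.
Proof.
move=> l0; rewrite -subr_ge0.
have -> : (1 + l) * a ^+ 2 + (1 + l^-1) * b ^+ 2 - (a + b) ^+ 2 =
    l * (a - l^-1 * b) ^+ 2.
  by field; rewrite gt_eqF.
by rewrite mulr_ge0 ?sqr_ge0// ltW.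
Qed.

Lemma integral_sqrD_le f g (l : R) : sqr_integrable f -> sqr_integrable g -> 0 < l ->
  (\int[nu]_x ((f x + g x) ^+ 2)%:E <=
   ((1 + l) * nrm2 f ^+ 2 + (1 + l^-1) * nrm2 g ^+ 2)%:E)%E.
Proof.
move=> Lf Lg l0; have [mf _] := Lf; have [mg _] := Lg.
have l1 : 0 <= 1 + l by rewrite addr_ge0// ltW.
have l2 : 0 <= 1 + l^-1 by rewrite addr_ge0// invr_ge0 ltW.
have mf2 := measurable_sqr mf; have mg2 := measurable_sqr mg.
rewrite EFinD (EFinM (1 + l)) (EFinM (1 + l^-1)) -(nrm2K Lf) -(nrm2K Lg).
rewrite -!ge0_integralZl_EFin//; last 2 first.
- by move=> x _; rewrite lee_fin sqr_ge0.
- by move=> x _; rewrite lee_fin sqr_ge0.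
rewrite -ge0_integralD//; last 4 first.
- by move=> x _; rewrite -EFinM lee_fin mulr_ge0// sqr_ge0.
- by apply: measurable_funeM.
- by move=> x _; rewrite -EFinM lee_fin mulr_ge0// sqr_ge0.
- by apply: measurable_funeM.
apply: ge0_le_integral => //.
- by move=> x _; rewrite lee_fin sqr_ge0.
- by apply: measurable_sqr; exact: measurable_funD.
- by apply: emeasurable_funD; exact: measurable_funeM.
- by move=> x _; rewrite -!EFinM -EFinD lee_fin; exact: young_sqr.
Qed.

Lemma sqr_integrableD f g : sqr_integrable f -> sqr_integrable g ->
  sqr_integrable (fun x => f x + g x).
Proof.
move=> Lf Lg; split; first by apply: measurable_funD; [case: Lf|case: Lg].
exact: le_lt_trans (integral_sqrD_le Lf Lg ltr01) (ltry _).
Qed.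

(** Optimizing over l the inequality of [integral_sqrD_le] gives the triangle inequality. *)
Lemma nrm2D_le f g : sqr_integrable f -> sqr_integrable g ->
  nrm2 (fun x => f x + g x) <= nrm2 f + nrm2 g.
Proof.
move=> Lf Lg; apply/ler_addgt0Pr => e e0.
pose a := nrm2 f + e / 2; pose b := nrm2 g + e / 2.
have e2 : 0 < e / 2 by rewrite divr_gt0.
have a0 : 0 < a by rewrite ltr_wpDl ?nrm2_ge0.
have b0 : 0 < b by rewrite ltr_wpDl ?nrm2_ge0.
have -> : nrm2 f + nrm2 g + e = a + b by rewrite /a /b; field.
apply: nrm2_le; first by rewrite addr_ge0// ltW.
have l0 : 0 < b / a by rewrite divr_gt0.
apply: le_trans (integral_sqrD_le Lf Lg l0) _; rewrite lee_fin.
have -> : (a + b) ^+ 2 = (1 + b / a) * a ^+ 2 + (1 + (b / a)^-1) * b ^+ 2.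
  by field; rewrite !gt_eqF.
have fa : nrm2 f ^+ 2 <= a ^+ 2 by rewrite lerXn2r ?nnegrE ?nrm2_ge0 ?(ltW a0)// lerDl ltW.
have gb : nrm2 g ^+ 2 <= b ^+ 2 by rewrite lerXn2r ?nnegrE ?nrm2_ge0 ?(ltW b0)// lerDl ltW.
apply: lerD; apply: ler_wpM2l => //.
- by rewrite addr_ge0// ltW.
- by rewrite addr_ge0// invr_ge0 ltW.
Qed.

Lemma sqr_integrableN f : sqr_integrable f -> sqr_integrable (fun x => - f x).
Proof.
move=> [mf ff]; split; first exact: measurableT_comp.
by under eq_integral do rewrite sqrrN.
Qed.

Lemma sqr_integrableB f g : sqr_integrable f -> sqr_integrable g ->
  sqr_integrable (fun x => f x - g x).
Proof. by move=> Lf Lg; apply: sqr_integrableD => //; exact: sqr_integrableN. Qed.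

Lemma nrm2_dist_triangle f g h : sqr_integrable f -> sqr_integrable g -> sqr_integrable h ->
  nrm2 (fun x => f x - h x) <= nrm2 (fun x => f x - g x) + nrm2 (fun x => g x - h x).
Proof.
move=> Lf Lg Lh; apply: le_trans (nrm2D_le (sqr_integrableB Lf Lg) (sqr_integrableB Lg Lh)).
by rewrite le_eqVlt; apply/orP; left; apply/eqP; congr nrm2; apply/funext => x; ring.
Qed.

Lemma nrm2_distC f g : nrm2 (fun x => f x - g x) = nrm2 (fun x => g x - f x).
Proof.
by congr (Num.sqrt (fine _)); apply: eq_integral => x _; congr EFin; ring.
Qed.

End square_integrable.

(** * Growth along a path *)

Section growth.
Context {R : realType}.
Implicit Types (f v : R -> R) (r s : R).

(** The hypothesis compares f s with f r at the given point r only. The supremum of the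
    points where f is at most f 0 satisfies the same inequality, and could be exceeded if
    it were less than 1. *)
Lemma locally_nonincreasing_le f :
  (forall r, 0 <= r <= 1 -> \forall s \near r, 0 <= s <= 1 ->
     (r <= s -> f s <= f r) /\ (s <= r -> f r <= f s)) ->
  f 1 <= f 0.
Proof.
move=> H; pose S := [set r | 0 <= r <= 1 /\ f r <= f 0].
have S0 : S 0 by split; rewrite // lexx ler01.
have Sb : has_ubound S by exists 1 => r [/andP[]].
have Ssup : has_sup S by split=> //; exists 0.
pose m := sup S.
have m0 : 0 <= m by exact: ub_le_sup.
have m1 : m <= 1 by apply: ge_sup; [exists 0|move=> r [/andP[]]].
have m01 : 0 <= m <= 1 by rewrite m0.
have /nbhs_ballP[e /= e0 He] := H m m01.
have hb s : `|m - s| < e -> 0 <= s <= 1 -> (m <= s -> f s <= f m) /\ (s <= m -> f m <= f s).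
  by move=> h; apply: He; rewrite /ball/=.
have fm : f m <= f 0.
  have [r [/andP[r0 r1] fr] mr] := sup_adherent e0 Ssup.
  have rm : r <= m by apply: ub_le_sup => //; split=> //; rewrite r0.
  apply: le_trans fr; apply: (hb r _ _).2 => //; last by rewrite r0.
  rewrite ger0_norm ?subr_ge0//; rewrite -/m in mr; lra.
have [m_1|m_1] := leP 1 m; first by have -> : 1 = m by apply/le_anti; rewrite m_1 m1.
pose s := Order.min 1 (m + e / 2).
have ms : m < s by rewrite lt_min m_1 ltrDl divr_gt0.
have s1 : s <= 1 by rewrite ge_min lexx.
have s01 : 0 <= s <= 1 by rewrite (le_trans m0 (ltW ms)).
have se : s <= m + e / 2 by rewrite ge_min lexx orbT.
suff : s <= m by rewrite leNgt ms.
apply: ub_le_sup => //; split=> //; apply: le_trans fm.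
apply: (hb s _ _).1 => //; last exact: ltW.
by rewrite ler0_norm ?subr_le0 ?(ltW ms)//; lra.
Qed.

Lemma derivable_expansion f (l r e : R) : derivable f r 1 -> derive1 f r = l -> 0 < e ->
  \forall s \near r, `|f s - f r - (s - r) * l| <= e * `|s - r|.
Proof.
move=> df fl e0.
have : h^-1 *: ((f \o shift r) (h *: 1) - f r) @[h --> 0^'] --> l.
  by rewrite -fl derive1E; exact: df.
move=> /cvgrPdist_le/(_ _ e0) /nbhs_ballP[d /= d0 hd].
apply/nbhs_ballP; exists d => //= s; rewrite /ball /= distrC => sr.
have [->|sr0] := eqVneq s r; first by rewrite !subrr mul0r subrr normr0 mulr0.
have h0 : s - r != 0 by rewrite subr_eq0.
have bs : ball (0 : R) d (s - r) by rewrite /ball /= sub0r normrN.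
have := hd _ bs h0; rewrite /= [_ *: 1]mulr1 subrK => h.
rewrite -ler_pdivrMr ?normr_gt0// -normfV -normrM -normrN.
suff -> : - ((f s - f r - (s - r) * l) / (s - r)) = l - (s - r)^-1 * (f s - f r) by [].
by field.
Qed.

(** Apply [locally_nonincreasing_le] to f minus a primitive of v, tilted by a small linear
    term that absorbs the errors e. *)
Lemma growth_le_integral f v (K : R) : 0 <= K -> continuous v ->
  (forall (r e : R), 0 <= r <= 1 -> 0 < e -> \forall s \near r, 0 <= s <= 1 ->
     `|f s - f r| <= K * (`|s - r| * (v r + e))) ->
  f 1 - f 0 <= K * \int[lebesgue_measure]_(r in `[0, 1]) v r.
Proof.
move=> K0 cv Hf.
pose V y : R := (\int[lebesgue_measure]_(t in `[(-1)%R, y]) v t)%R.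
have iv : lebesgue_measure.-integrable `[(-1)%R, 2] (EFin \o v).
  apply: continuous_compact_integrable; first exact: segment_compact.
  exact: continuous_subspaceT.
have dV r : 0 <= r <= 1 -> derivable V r 1 /\ derive1 V r = v r.
  move=> /andP[r0 r1]; apply: (@continuous_FTC1_closed _ v (-1) r 2) => //.
  - by rewrite (le_lt_trans r1)// ltr1n.
  - by rewrite (lt_le_trans _ r0)// ltrN10.
  - exact: cv.
have -> : \int[lebesgue_measure]_(r in `[0, 1]) v r = V 1 - V 0.
  rewrite /Rintegral (@continuous_FTC2 _ v V 0 1)//.
  - exact: continuous_subspaceT.
  - split.
    + move=> x; rewrite in_itv /= => /andP[x0 x1].
      by have [] := dV x _; rewrite ?(ltW x0) ?(ltW x1).
    + apply: cvg_at_right_filter; apply: differentiable_continuous.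
      by apply/derivable1_diffP; have [] := dV 0 _; rewrite ?lexx ?ler01.
    + apply: cvg_at_left_filter; apply: differentiable_continuous.
      by apply/derivable1_diffP; have [] := dV 1 _; rewrite ?lexx ?ler01.
  - move=> x; rewrite in_itv /= => /andP[x0 x1].
    by have [] := dV x _; rewrite ?(ltW x0) ?(ltW x1).
suff H e : 0 < e -> f 1 - f 0 <= K * (V 1 - V 0) + e.
  by apply/ler_addgt0Pr => e /H.
move=> e0; pose e' := e / (2 * K + 1).
have K2 : 0 < 2 * K + 1 by rewrite ltr_wpDl// mulr_ge0.
have e'0 : 0 < e' by rewrite divr_gt0.
pose G s := f s - K * (V s + 2 * e' * s).
have : G 1 <= G 0.
  apply: locally_nonincreasing_le => r r01; have [dr vr] := dV r r01.
  have h1 := Hf r e' r01 e'0; have h2 := derivable_expansion dr vr e'0.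
  apply: filterS2 h1 h2 => s h1 h2 /h1 {}h1; rewrite /G; split=> sr.
    have E : `|s - r| = s - r by rewrite ger0_norm// subr_ge0.
    rewrite E in h1 h2.
    move: h1 h2; rewrite !ler_norml => /andP[_ h1] /andP[h2 _].
    have : K * ((s - r) * (v r + e')) <= K * (V s - V r + 2 * e' * (s - r)).
      by apply: ler_wpM2l => //; lra.
    lra.
  have E : `|s - r| = - (s - r) by rewrite ler0_norm// subr_le0.
  rewrite E in h1 h2.
  move: h1 h2; rewrite !ler_norml => /andP[h1 _] /andP[_ h2].
  have : K * (- (s - r) * (v r + e')) <= K * (V r - V s + 2 * e' * (r - s)).
    by apply: ler_wpM2l => //; lra.
  lra.
have -> : e = (2 * K + 1) * e' by rewrite /e' mulrC divfK ?gt_eqF.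
by rewrite /G; lra.
Qed.

End growth.

(** * Limits of matrices *)

Section matrix_limits.
Context {R : realType} {T : Type} {F : set_system T} {FF : Filter F}.

Lemma cvg_sumr (I : Type) (r : seq I) (f : I -> T -> R) (l : I -> R) :
  (forall i, f i x @[x --> F] --> l i) ->
  \sum_(i <- r) f i x @[x --> F] --> \sum_(i <- r) l i.
Proof. by move=> fl; apply: cvg_big => //; exact: add_continuous. Qed.

Lemma cvg_prodr (I : Type) (r : seq I) (f : I -> T -> R) (l : I -> R) :
  (forall i, f i x @[x --> F] --> l i) ->
  \prod_(i <- r) f i x @[x --> F] --> \prod_(i <- r) l i.
Proof. by move=> fl; apply: cvg_big => //; exact: mul_continuous. Qed.

Lemma cvg_det n (f : T -> 'M[R]_n) (l : 'M[R]_n) :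
  (forall i j, f x i j @[x --> F] --> l i j) -> \det (f x) @[x --> F] --> \det l.
Proof.
move=> fl; apply: cvg_sumr => s; apply: cvgM; first exact: cvg_cst.
by apply: cvg_prodr => i.
Qed.

Lemma cvg_mulmx m n p (f : T -> 'M[R]_(m, n)) (g : T -> 'M[R]_(n, p))
    (l : 'M[R]_(m, n)) (k : 'M[R]_(n, p)) :
  (forall i j, f x i j @[x --> F] --> l i j) ->
  (forall i j, g x i j @[x --> F] --> k i j) ->
  forall i j, (f x *m g x) i j @[x --> F] --> (l *m k) i j.
Proof.
move=> fl gk i j; rewrite mxE; under eq_fun do rewrite mxE.
by apply: cvg_sumr => a; exact: cvgM.
Qed.

Lemma invmxE n (P : 'M[R]_n) i j : P \in unitmx ->
  invmx P i j = (\det P)^-1 * cofactor P j i.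
Proof. by move=> uP; rewrite /invmx uP !mxE. Qed.

Lemma cvg_invmx n (f : T -> 'M[R]_n) (l : 'M[R]_n) : l \in unitmx ->
  (forall x, f x \in unitmx) -> (forall i j, f x i j @[x --> F] --> l i j) ->
  forall i j, invmx (f x) i j @[x --> F] --> invmx l i j.
Proof.
move=> ul uf fl i j; rewrite invmxE//.
have -> : (fun x => invmx (f x) i j) = (fun x => (\det (f x))^-1 * cofactor (f x) j i).
  by apply/funext => x; rewrite invmxE.
have ld : \det l != 0 by rewrite -unitfE.
apply: cvgM; first by apply: cvgV => //; exact: cvg_det.
rewrite /cofactor; apply: cvgM; first exact: cvg_cst.
by apply: cvg_det => a b; rewrite !mxE; under eq_fun do rewrite !mxE; exact: fl.
Qed.

Lemma cvg_gnorm2 n (P h : T -> 'M[R]_n) (Q k : 'M[R]_n) : Q \in unitmx ->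
  (forall x, P x \in unitmx) -> (forall i j, P x i j @[x --> F] --> Q i j) ->
  (forall i j, h x i j @[x --> F] --> k i j) ->
  gnorm2 (P x) (h x) @[x --> F] --> gnorm2 Q k.
Proof.
move=> uQ uP PQ hk; apply: cvg_sumr => i.
have PQV := cvg_invmx uQ uP PQ.
have C1 := cvg_mulmx PQV hk.
have C2 := cvg_mulmx C1 PQV.
have C3 := cvg_mulmx C2 hk.
exact: (C3 i i).
Qed.

Lemma cvg_sqrtr (f : T -> R) (l : R) : f x @[x --> F] --> l ->
  Num.sqrt (f x) @[x --> F] --> Num.sqrt l.
Proof. by move=> fl; apply: continuous_cvg fl; exact: sqrt_continuous. Qed.

End matrix_limits.

(** A fixed P-orthonormal frame is a bounded change of coordinates. *)
Lemma norm_le_gnorm2 {R : realType} n (P : 'M[R]_n) : metric_mx P ->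
  exists2 C : R, 0 <= C & forall h, symmetric_mx h -> `|h| ^+ 2 <= C * gnorm2 P h.
Proof.
move=> mP; have [L uL [_ HL]] := gnorm2_frame mP.
pose c : R := n%:R * (n%:R * `|L|) * `|L^T|.
have c0 : 0 <= c by rewrite !mulr_ge0.
exists (c ^+ 2); first by rewrite sqr_ge0.
move=> h /HL [K -> ->].
have hK : `|L *m K *m L^T| <= c * Num.sqrt (frob2 K).
  apply: le_trans (mulmx_norm_le _ _) _.
  have -> : c * Num.sqrt (frob2 K) = n%:R * (n%:R * `|L| * Num.sqrt (frob2 K)) * `|L^T|.
    by rewrite /c; ring.
  rewrite ler_wpM2r// ler_wpM2l// (le_trans (mulmx_norm_le _ _))// ler_wpM2l ?mulr_ge0//.
  apply: mx_norm_le => [|i j]; first exact: sqrtr_ge0.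
  by rewrite -sqrtr_sqr ler_wsqrtr// frob2_entry.
rewrite -(sqr_sqrtr (frob2_ge0 K)) -exprMn lerXn2r ?nnegrE//.
by rewrite mulr_ge0// sqrtr_ge0.
Qed.

Lemma cvg_mx_gnorm2 {R : realType} n (P : 'M[R]_n) T (F : set_system T) (FF : Filter F)
    (h : T -> 'M[R]_n) (k : 'M[R]_n) : metric_mx P -> symmetric_mx k ->
  (forall x, symmetric_mx (h x)) ->
  (forall e : R, 0 < e -> \forall x \near F, gnorm2 P (h x - k) <= e) ->
  forall i j, h x i j @[x --> F] --> k i j.
Proof.
move=> mP sk sh H i j; have [C C0 HC] := norm_le_gnorm2 mP.
apply/cvgrPdist_le => e e0.
have C1 : 0 < C + 1 by rewrite ltr_wpDl.
have e' : 0 < e ^+ 2 / (C + 1) by rewrite divr_gt0// exprn_gt0.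
apply: filterS (H _ e') => x hx.
have := HC _ (symmetric_mxB (sh x) sk) => h2.
have : `|h x - k| ^+ 2 <= e ^+ 2.
  apply: le_trans h2 _; apply: le_trans (ler_wpM2l C0 hx) _.
  by rewrite mulrCA ler_piMr ?sqr_ge0// ler_pdivrMr// mul1r lerDl.
rewrite ler_pXn2r ?nnegrE ?normr_ge0 ?(ltW e0)// => h3.
by rewrite distrC -entryN -entryD; apply: le_trans (mx_entry_le _ i j) _.
Qed.

(** * The length of a path bounds the variation of the volume density *)

Lemma abs_sub_le (R : realDomainType) (a b c : R) :
  a <= c + b -> b <= c + a -> `|a - b| <= c.
Proof. by move=> h1 h2; rewrite ler_norml; apply/andP; split; lra. Qed.

Lemma cvg_sequential (R : realType) (f : R -> R) (p l : R) :
  (forall u : nat -> R, u k @[k --> \oo] --> p -> f (u k) @[k --> \oo] --> l) ->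
  f x @[x --> p] --> l.
Proof.
move=> H; apply/cvgrPdist_lt => e e0; apply: contrapT => nfe.
have P k : exists x, `|p - x| < k.+1%:R^-1 /\ ~ `|l - f x| < e.
  apply: contrapT => nx; apply: nfe; apply/nbhs_ballP; exists k.+1%:R^-1 => /=.
    by rewrite invr_gt0.
  move=> x px; apply: contrapT => nlx; apply: nx; exists x; split=> //.
have [u Hu] := choice P.
have up : u k @[k --> \oo] --> p.
  apply/cvgrPdist_lt => d d0; near=> k; apply: lt_trans (Hu k).1 _.
  by near: k; exact: (near_infty_natSinv_lt (PosNum d0)).
have /cvgrPdist_lt/(_ _ e0)[N _ HN] := H u up.
by case: (Hu N) => _; apply; apply: HN => /=.
Unshelve. all: by end_near. Qed.

Section lower_bound.
Context {R : realType} {n : nat} {M : ptopologicalType} (A : smooth_atlas R n M).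
Hypothesis M_compact : compact [set: M].
Local Notation nu := (base_measure A).

Lemma gnorm20 (P : 'M[R]_n) : gnorm2 P 0 = 0.
Proof. by rewrite -(scale0r (0 : 'M[R]_n)) gnorm2Z expr0n mul0r. Qed.

Lemma riem_metric_smooth t : riem_metric A t -> smooth_section A t.
Proof. by case=> -[]. Qed.

Lemma measurable_qdet t : smooth_section A t ->
  measurable_fun setT ((fun x => qdet (t x)) : borel M -> R).
Proof. by move=> st; apply: measurable_sqrt_fun; exact: (measurable_voldens st). Qed.

Lemma integral_voldens t : riem_metric A t ->
  (\int[nu]_x (voldens t x)%:E)%E = (fine (vol A t setT))%:E.
Proof.
move=> mt; have st := riem_metric_smooth mt.
rewrite fineK; first by rewrite volE.
by rewrite ge0_fin_numE ?vol_ge0//; exact: (vol_finite M_compact mt).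
Qed.

Lemma sqr_integrable_qdet t : riem_metric A t ->
  sqr_integrable nu ((fun x => qdet (t x)) : borel M -> R).
Proof.
move=> mt; have st := riem_metric_smooth mt.
split; first exact: (measurable_qdet st).
under eq_integral do rewrite qdetK.
by rewrite (integral_voldens mt) ltry.
Qed.

Lemma integral_voldens_scale t (B : R) : riem_metric A t -> 0 <= B ->
  (\int[nu]_x (B * voldens t x)%:E)%E = (B * fine (vol A t setT))%:E.
Proof.
move=> mt B0; have st := riem_metric_smooth mt.
under eq_integral do rewrite EFinM.
rewrite ge0_integralZl_EFin//; first by rewrite (integral_voldens mt).
- by move=> x _; rewrite lee_fin voldens_ge0.
- by apply/measurable_EFinP; exact: (measurable_voldens st).
Qed.

Lemma gnorm2_voldens_ge0 t h x : riem_metric A t -> smooth_sym_tensor A h ->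
  0 <= gnorm2 (t x) (h x) * voldens t x.
Proof.
move=> mt [sh _]; rewrite mulr_ge0 ?voldens_ge0//.
exact: gnorm2_ge0 (riem_metric_mx x mt) (sh x).
Qed.

Lemma measurable_gnorm2_voldens t h : riem_metric A t -> smooth_section A h ->
  measurable_fun setT ((fun x => gnorm2 (t x) (h x) * voldens t x) : borel M -> R).
Proof.
move=> mt sh; have st := riem_metric_smooth mt.
by apply: measurable_funM; [exact: (measurable_gnorm2 mt sh)|exact: (measurable_voldens st)].
Qed.

Lemma L2_normE t h : riem_metric A t -> smooth_sym_tensor A h ->
  L2_norm A t h = Num.sqrt (fine (\int[nu]_x (gnorm2 (t x) (h x) * voldens t x)%:E)%E).
Proof.
move=> mt [sym sh]; have st := riem_metric_smooth mt.
rewrite /L2_norm /L2_inner integral_vol//.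
- by apply/measurable_EFinP; exact: (measurable_gnorm2 mt sh).
- by move=> x; rewrite lee_fin; exact: gnorm2_ge0 (riem_metric_mx x mt) (sym x).
Qed.

Lemma integral_gnorm2_finite t h : riem_metric A t -> smooth_sym_tensor A h ->
  (\int[nu]_x (gnorm2 (t x) (h x) * voldens t x)%:E < +oo)%E.
Proof.
move=> mt hh; have [sym sh] := hh; have st := riem_metric_smooth mt.
have [B B0 HB] := gnorm2_bounded M_compact mt sh.
apply: (@le_lt_trans _ _ (\int[nu]_x (B * voldens t x)%:E)%E).
  apply: ge0_le_integral => //.
  - by move=> x _; rewrite lee_fin; exact: gnorm2_voldens_ge0.
  - by apply/measurable_EFinP; exact: (measurable_gnorm2_voldens mt sh).
  - apply/measurable_EFinP; by apply: measurable_funM => //; exact: (measurable_voldens st).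
  - by move=> x _; rewrite lee_fin ler_wpM2r ?voldens_ge0.
by rewrite (integral_voldens_scale mt B0) ltry.
Qed.

Lemma L2_normK t h : riem_metric A t -> smooth_sym_tensor A h ->
  (\int[nu]_x (gnorm2 (t x) (h x) * voldens t x)%:E)%E = (L2_norm A t h ^+ 2)%:E.
Proof.
move=> mt hh; have f0 : (0 <= \int[nu]_x (gnorm2 (t x) (h x) * voldens t x)%:E)%E.
  by apply: integral_ge0 => x _; rewrite lee_fin; exact: gnorm2_voldens_ge0.
rewrite L2_normE// sqr_sqrtr ?fine_ge0// fineK// ge0_fin_numE//.
exact: integral_gnorm2_finite.
Qed.

Section path.
Variables (c dc : R -> tensor_field R n M).
Hypothesis Hc : C1_path A c dc.

Lemma C1_path_metric r : 0 <= r <= 1 -> riem_metric A (c r).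
Proof. by move=> /Hc[]. Qed.

Lemma C1_path_deriv r : 0 <= r <= 1 -> smooth_sym_tensor A (dc r).
Proof. by move=> /Hc[]. Qed.

Lemma C1_path_sym r x : 0 <= r <= 1 -> symmetric_mx (c r x).
Proof. by move=> /C1_path_metric[[sc _] _]. Qed.

(** The difference quotient of c at r tends to dc r uniformly for the pointwise norm of
    c r; the factor 2 is the one of [gnorm2D_le]. *)
Lemma C1_path_gnorm2_near (r e : R) : 0 <= r <= 1 -> 0 < e ->
  \forall s \near r, 0 <= s <= 1 -> forall x,
    gnorm2 (c r x) (c s x - c r x) <= (s - r) ^+ 2 * (2 * (gnorm2 (c r x) (dc r x) + e)).
Proof.
move=> r01 e0; have [mr [sdr _] Hd _] := Hc r01.
have h : nbhs r [set s | s != r -> (`[0, 1]%classic : set R) s -> forall x,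
    gnorm2 (c r x) ((s - r)^-1 *: (c s x - c r x) - dc r x) <= e].
  exact: (frechet_cvg_gnorm2 M_compact (within_filter _ _) mr e0 Hd).
apply: filterS h => s h s01 x.
have [->|sr] := eqVneq s r; first by rewrite !subrr gnorm20 expr0n mul0r.
have sr0 : s - r != 0 by rewrite subr_eq0.
have s01' : (`[0, 1]%classic : set R) s by rewrite /= in_itv.
have := h sr s01' x => hx.
have sym : symmetric_mx ((s - r)^-1 *: (c s x - c r x)).
  by apply: symmetric_mxZ; apply: symmetric_mxB; exact: C1_path_sym.
have -> : c s x - c r x = (s - r) *: (dc r x + ((s - r)^-1 *: (c s x - c r x) - dc r x)).
  by rewrite [dc r x + _]addrC subrK scalerA divff// scale1r.
rewrite gnorm2Z ler_wpM2l ?sqr_ge0//.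
have mrx := riem_metric_mx x mr.
apply: le_trans (gnorm2D_le mrx (sdr x) (symmetric_mxB sym (sdr x))) _.
by rewrite ler_wpM2l// lerD2l.
Qed.

Lemma C1_path_continuous (r e : R) : 0 <= r <= 1 -> 0 < e ->
  \forall s \near r, 0 <= s <= 1 -> forall x, gnorm2 (c r x) (c s x - c r x) <= e.
Proof.
move=> r01 e0; have mr := C1_path_metric r01; have [_ sdr] := C1_path_deriv r01.
have [B B0 HB] := gnorm2_bounded M_compact mr sdr.
pose k := e / (2 * (B + 1)); have k0 : 0 < k by rewrite divr_gt0// mulr_gt0// ltr_wpDl.
have h1 := C1_path_gnorm2_near r01 ltr01.
have h2 : \forall s \near r, `|s - r| <= Order.min 1 k.
  apply/nbhs_ballP; exists (Order.min 1 k) => /=; first by rewrite lt_min ltr01.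
  by move=> s; rewrite /ball /= distrC => /ltW.
apply: filterS2 h1 h2 => s h1 h2 /h1 {}h1 x; apply: le_trans (h1 x) _.
move: h2; rewrite le_min => /andP[h2 h3].
have h4 : (s - r) ^+ 2 <= k.
  by rewrite -(real_normK (num_real (s - r))) expr2 -[leRHS]mul1r ler_pM.
apply: (@le_trans _ _ (k * (2 * (B + 1)))).
  apply: ler_pM => //; first exact: sqr_ge0.
    rewrite mulr_ge0// addr_ge0//.
    exact: gnorm2_ge0 (riem_metric_mx x mr) ((C1_path_deriv r01).1 x).
  by rewrite ler_wpM2l// lerD2r.
by rewrite /k divfK// gt_eqF// mulr_gt0// ltr_wpDl.
Qed.

Lemma C1_path_deriv_continuous (r e : R) : 0 <= r <= 1 -> 0 < e ->
  \forall s \near r, 0 <= s <= 1 -> forall x, gnorm2 (c r x) (dc s x - dc r x) <= e.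
Proof.
move=> r01 e0; have [mr [sdr _] _ Hd] := Hc r01.
have h : nbhs r [set s | (`[0, 1]%classic : set R) s -> forall x,
    gnorm2 (c r x) (dc s x - dc r x) <= e].
  exact: (frechet_cvg_gnorm2 M_compact (within_filter _ _) mr e0 Hd).
by apply: filterS h => s h s01 x; apply: h; rewrite /= in_itv.
Qed.

(** Domination for the passage to the limit under the integral sign in [speed_cvg]: the
    metric c s dominates c q / 2, and its density is compared to the one of c q along a
    segment. *)
Lemma speed_density_le (q s B : R) x : 0 <= q <= 1 -> 0 <= s <= 1 ->
  gnorm2 (c q x) (dc q x) <= B ->
  gnorm2 (c q x) (c s x - c q x) <= half_radius n ->
  gnorm2 (c q x) (dc s x - dc q x) <= 1 ->
  gnorm2 (c s x) (dc s x) * voldens (c s) x <=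
  (8 * (B + 1)) * (n`!%:R * 3 ^+ n) * voldens (c q) x.
Proof.
move=> q01 s01 hB h1 h2.
have mq := riem_metric_mx x (C1_path_metric q01).
have ms := riem_metric_mx x (C1_path_metric s01).
have sq := (C1_path_deriv q01).1 x; have ss := (C1_path_deriv s01).1 x.
rewrite -mulrA; apply: ler_pM; rewrite ?voldens_ge0//; first exact: gnorm2_ge0.
  apply: le_trans (gnorm2_half mq ms ss h1) _.
  have := gnorm2D_le mq sq (symmetric_mxB ss sq); rewrite addrC subrK => h; lra.
have cE : c q x + 1 *: (c s x - c q x) = c s x by rewrite scale1r addrC subrK.
have symB := symmetric_mxB (C1_path_sym x s01) (C1_path_sym x q01).
have := sqrt_det_line (_ : 0 <= (1 : R) <= 1) mq symB.
rewrite cE => /(_ _ ms); rewrite ler01 lexx => /(_ isT) h.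
apply: le_trans h _; rewrite ler_wpM2r ?sqrtr_ge0// ler_wpM2l//.
have g0 := gnorm2_ge0 mq symB; have r1 : half_radius n <= 1 :> R := half_radius_le1 n.
have h3 : 2 + gnorm2 (c q x) (c s x - c q x) <= 3 by lra.
by rewrite lerXn2r ?nnegrE ?addr_ge0.
Qed.

Lemma speed_cvg (w : nat -> R) (q : R) : 0 <= q <= 1 -> (forall k, 0 <= w k <= 1) ->
  w k @[k --> \oo] --> q ->
  L2_norm A (c (w k)) (dc (w k)) @[k --> \oo] --> L2_norm A (c q) (dc q).
Proof.
move=> q01 w01 wq.
have mq := C1_path_metric q01; have dq := C1_path_deriv q01.
have mw k := C1_path_metric (w01 k); have dw k := C1_path_deriv (w01 k).
have [B B0 HB] := gnorm2_bounded M_compact mq dq.2.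
have near_c (e : R) : 0 < e -> \forall k \near \oo, forall x,
    gnorm2 (c q x) (c (w k) x - c q x) <= e.
  move=> e0; have h : \forall k \near \oo, 0 <= w k <= 1 -> _ := wq _ (C1_path_continuous q01 e0).
  by apply: filterS h => k h; exact: h (w01 k).
have near_dc (e : R) : 0 < e -> \forall k \near \oo, forall x,
    gnorm2 (c q x) (dc (w k) x - dc q x) <= e.
  move=> e0; have h : \forall k \near \oo, 0 <= w k <= 1 -> _ := wq _ (C1_path_deriv_continuous q01 e0).
  by apply: filterS h => k h; exact: h (w01 k).
have [N _ HN] := filterI (near_c _ (half_radius_gt0 n)) (near_dc _ ltr01).
pose S k := (\int[nu]_x (gnorm2 (c (w (k + N)%N) x) (dc (w (k + N)%N) x) *
  voldens (c (w (k + N)%N)) x)%:E)%E.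
pose Sq := (\int[nu]_x (gnorm2 (c q x) (dc q x) * voldens (c q) x)%:E)%E.
suff SSq : S k @[k --> \oo] --> Sq.
  rewrite -(cvg_shiftn N); have -> : (fun k => L2_norm A (c (w (k + N)%N)) (dc (w (k + N)%N))) =
      (fun k => Num.sqrt (fine (S k))).
    by apply/funext => k; exact: L2_normE (mw _) (dw _).
  rewrite L2_normE//; apply: cvg_sqrtr; apply: fine_cvg.
  rewrite fineK//; rewrite ge0_fin_numE; first exact: integral_gnorm2_finite.
  by apply: integral_ge0 => x _; rewrite lee_fin; exact: gnorm2_voldens_ge0.
pose K := (8 * (B + 1)) * (n`!%:R * 3 ^+ n).
have K0 : 0 <= K by rewrite /K !mulr_ge0// ?addr_ge0// exprn_ge0.
apply: (@dominated_cvg _ _ _ nu setT measurableT _ _ (fun x => (K * voldens (c q) x)%:E)).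
- by move=> k; apply/measurable_EFinP; apply: (measurable_gnorm2_voldens (mw _) (dw _).2).
- move=> x _; apply: cvg_EFin; first exact: nearW.
  have xq := riem_metric_mx x mq.
  have cx i j : c (w k) x i j @[k --> \oo] --> c q x i j.
    apply: (cvg_mx_gnorm2 _ xq) => //; first by case: xq.
    + by move=> k; case: (riem_metric_mx x (mw k)).
    + by move=> e e0; apply: filterS (near_c e e0) => k.
  have dx i j : dc (w k) x i j @[k --> \oo] --> dc q x i j.
    apply: (cvg_mx_gnorm2 _ xq) => //; first exact: dq.1.
    + by move=> k; exact: (dw k).1.
    + by move=> e e0; apply: filterS (near_dc e e0) => k.
  have lim : gnorm2 (c (w k) x) (dc (w k) x) * voldens (c (w k)) x @[k --> \oo] -->
      gnorm2 (c q x) (dc q x) * voldens (c q) x.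
    apply: cvgM; last by apply: cvg_sqrtr; exact: cvg_det.
    apply: cvg_gnorm2 => //; first exact: metric_mx_unit.
    by move=> k; exact: metric_mx_unit (riem_metric_mx x (mw k)).
  by move: lim; rewrite -(cvg_shiftn N).
- by move=> x _.
- apply/integrableP; split.
    apply/measurable_EFinP; apply: measurable_funM => //.
    exact: (measurable_voldens (riem_metric_smooth mq)).
  have -> : (\int[nu]_x `|(K * voldens (c q) x)%:E|)%E =
      (\int[nu]_x (K * voldens (c q) x)%:E)%E.
    by apply: eq_integral => x _; rewrite gee0_abs// lee_fin mulr_ge0// voldens_ge0.
  by rewrite (integral_voldens_scale mq K0) ltry.
- move=> k x _; rewrite gee0_abs; last first.
    by rewrite lee_fin; exact: (gnorm2_voldens_ge0 x (mw _) (dw _)).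
  rewrite lee_fin.
  have [] := HN (k + N)%N; first by rewrite /= leq_addl.
  by move=> h1 h2; apply: speed_density_le.
Qed.

(** A path is only known on [0, 1]; clamping the time makes its speed continuous on R. *)
Definition clamp (r : R) : R := Order.max 0 (Order.min 1 r).

Lemma clamp01 r : 0 <= clamp r <= 1.
Proof. by rewrite /clamp le_max lexx /= ge_max ler01 ge_min lexx. Qed.

Lemma clamp_id r : 0 <= r <= 1 -> clamp r = r.
Proof. by move=> /andP[r0 r1]; rewrite /clamp min_r// max_r. Qed.

Lemma speed_continuous : continuous (fun r => L2_norm A (c (clamp r)) (dc (clamp r))).
Proof.
move=> p; apply: cvg_sequential => u up; apply: (@speed_cvg (clamp \o u)).
- exact: clamp01.
- by move=> k; exact: clamp01.
- suff cc : continuous clamp by exact: (cvg_comp _ _ up (cc p)).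
  move=> r; apply: continuous_max; first exact: cst_continuous.
  by apply: continuous_min; [exact: cst_continuous|exact: cvg_id].
Qed.

(** [qdet_lipschitz] integrated over M: the variation of [qdet] in the L2 norm is bounded by
    the speed for the L2 metric. The factor 2 absorbs the constant of [gnorm2D_le]. *)
Lemma nrm2_qdet_near (r e : R) : 0 <= r <= 1 -> 0 < e -> \forall s \near r, 0 <= s <= 1 ->
  nrm2 nu ((fun x => qdet (c s x) - qdet (c r x)) : borel M -> R) <=
  2 * det_lip n * (`|s - r| * (L2_norm A (c r) (dc r) + e)).
Proof.
move=> r01 e0; have mr := C1_path_metric r01; have dr := C1_path_deriv r01.
pose V := fine (vol A (c r) setT); have V0 : 0 <= V by rewrite fine_ge0// vol_ge0.
pose e' := e ^+ 2 / (V + 1).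
have V1 : 0 < V + 1 by rewrite ltr_wpDl.
have e'0 : 0 < e' by rewrite divr_gt0// exprn_gt0.
have h1 := C1_path_gnorm2_near r01 e'0; have h2 := C1_path_continuous r01 ltr01.
apply: filterS2 h1 h2 => s h1 h2 s01; have ms := C1_path_metric s01.
set v := L2_norm A (c r) (dc r); have v0 : 0 <= v by exact: sqrtr_ge0.
have L0 : 0 <= det_lip n :> R := det_lip_ge0 n.
apply: nrm2_le; first by rewrite !mulr_ge0// addr_ge0// ltW.
pose k := det_lip n ^+ 2 * ((s - r) ^+ 2 * 2); have k0 : 0 <= k.
  by rewrite mulr_ge0 ?sqr_ge0// mulr_ge0 ?sqr_ge0.
apply: (@le_trans _ _ (\int[nu]_x (k%:E * ((gnorm2 (c r x) (dc r x) * voldens (c r) x)%:E +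
    (e' * voldens (c r) x)%:E)))%E).
  apply: ge0_le_integral => //.
  - by move=> x _; rewrite lee_fin sqr_ge0.
  - apply: measurable_sqr; apply: measurable_funB.
      exact: (measurable_qdet (riem_metric_smooth ms)).
    exact: (measurable_qdet (riem_metric_smooth mr)).
  - apply: measurable_funeM; apply/measurable_EFinP; apply: measurable_funD.
      exact: (measurable_gnorm2_voldens mr dr.2).
    by apply: measurable_funM => //; exact: (measurable_voldens (riem_metric_smooth mr)).
  - move=> x _; rewrite -EFinD -EFinM lee_fin.
    have mrx := riem_metric_mx x mr; have msx := riem_metric_mx x ms.
    apply: le_trans (qdet_lipschitz mrx msx (h2 s01 x)) _.
    rewrite -[Num.sqrt (\det (c r x))]/(voldens (c r) x).
    set b := voldens _ _; have b0 : 0 <= b by exact: voldens_ge0.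
    have -> : k * (gnorm2 (c r x) (dc r x) * b + e' * b) = det_lip n ^+ 2 *
        ((s - r) ^+ 2 * (2 * (gnorm2 (c r x) (dc r x) + e')) * b) by rewrite /k; ring.
    by rewrite ler_wpM2l ?sqr_ge0// ler_wpM2r//; exact: h1.
rewrite ge0_integralZl_EFin//; last 2 first.
- move=> x _; rewrite -EFinD lee_fin addr_ge0 ?gnorm2_voldens_ge0//.
  by rewrite mulr_ge0 ?voldens_ge0// ltW.
- apply/measurable_EFinP; apply: measurable_funD.
    exact: (measurable_gnorm2_voldens mr dr.2).
  by apply: measurable_funM => //; exact: (measurable_voldens (riem_metric_smooth mr)).
rewrite ge0_integralD//; last 4 first.
- by move=> x _; rewrite lee_fin gnorm2_voldens_ge0.
- by apply/measurable_EFinP; exact: (measurable_gnorm2_voldens mr dr.2).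
- by move=> x _; rewrite lee_fin mulr_ge0 ?voldens_ge0// ltW.
- apply/measurable_EFinP; apply: measurable_funM => //.
  exact: (measurable_voldens (riem_metric_smooth mr)).
rewrite (L2_normK mr dr) (integral_voldens_scale mr (ltW e'0)) -EFinD -EFinM lee_fin.
rewrite -/V -/v /k.
have eV : e' * V <= e ^+ 2.
  by rewrite /e' mulrAC ler_pdivrMr// ler_wpM2l ?sqr_ge0// lerDl.
have -> : (2 * det_lip n * (`|s - r| * (v + e))) ^+ 2 =
    det_lip n ^+ 2 * ((s - r) ^+ 2 * 2) * (2 * (v + e) ^+ 2).
  by rewrite -(real_normK (num_real (s - r))); ring.
rewrite ler_wpM2l//.
have ve : 0 <= v * e by rewrite mulr_ge0// ltW.
have := sqr_ge0 v; have := sqr_ge0 e; rewrite sqrrD -mulr_natr; lra.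
Qed.

Lemma nrm2_qdet_C1_path :
  nrm2 nu ((fun x => qdet (c 1 x) - qdet (c 0 x)) : borel M -> R) <=
  2 * det_lip n * \int[lebesgue_measure]_(r in `[0, 1]) L2_norm A (c r) (dc r).
Proof.
pose f s := nrm2 nu ((fun x => qdet (c s x) - qdet (c 0 x)) : borel M -> R).
have f0 : f 0 = 0.
  apply/le_anti; rewrite nrm2_ge0 andbT; apply: nrm2_le => //.
  under eq_integral do rewrite subrr expr0n.
  by rewrite integral0 expr0n.
have -> : \int[lebesgue_measure]_(r in `[0, 1]) L2_norm A (c r) (dc r) =
    \int[lebesgue_measure]_(r in `[0, 1]) L2_norm A (c (clamp r)) (dc (clamp r)).
  by apply: eq_Rintegral => r; rewrite inE /= in_itv /= => r01; rewrite clamp_id.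
pose v r := L2_norm A (c (clamp r)) (dc (clamp r)).
have K0 : 0 <= 2 * det_lip n :> R by rewrite mulr_ge0// det_lip_ge0.
suff : f 1 - f 0 <= 2 * det_lip n * \int[lebesgue_measure]_(r in `[0, 1]) v r.
  by rewrite f0 subr0.
apply: (@growth_le_integral R f v _ K0 speed_continuous).
- move=> r e r01 e0; apply: filterS (nrm2_qdet_near r01 e0) => s h s01.
  rewrite /v (clamp_id r01); apply: le_trans (h s01).
  have I z : 0 <= z <= 1 -> sqr_integrable nu ((fun x => qdet (c z x)) : borel M -> R).
    by move=> /C1_path_metric; exact: sqr_integrable_qdet.
  have I0 := I 0 (_ : 0 <= 0 <= 1); rewrite lexx ler01 in I0; have {}I0 := I0 isT.
  have h1 := nrm2_dist_triangle (I s s01) (I r r01) I0.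
  have h2 := nrm2_dist_triangle (I r r01) (I s s01) I0.
  apply: abs_sub_le; first exact: h1.
  by rewrite (nrm2_distC nu (fun x => qdet (c s x)) (fun x => qdet (c r x))); exact: h2.
Qed.

End path.

Lemma path_length_bound g h l : path_length A g h l ->
  [/\ riem_metric A g, riem_metric A h, 0 <= l &
      nrm2 nu ((fun x => qdet (g x) - qdet (h x)) : borel M -> R) <= 2 * det_lip n * l].
Proof.
elim=> {g h l} [c dc Hc|g h k l l' _ [mg mh l0 hl] _ [_ mk l'0 hl']].
- split.
  + by apply: (C1_path_metric Hc); rewrite lexx ler01.
  + by apply: (C1_path_metric Hc); rewrite lexx ler01.
  + by apply: Rintegral_ge0 => r _; exact: sqrtr_ge0.
  + by rewrite nrm2_distC; exact: nrm2_qdet_C1_path.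
- split=> //; first exact: addr_ge0.
  have I := sqr_integrable_qdet.
  apply: le_trans (nrm2_dist_triangle (I _ mg) (I _ mh) (I _ mk)) _.
  by rewrite mulrDr lerD.
Qed.

Lemma dist_le_length g h l : path_length A g h l -> dist A g h <= l.
Proof.
move=> gl; apply: ge_inf => //; exists 0 => l' /path_length_bound[].
by [].
Qed.

Lemma dist_ge0 g h : 0 <= dist A g h.
Proof.
have [E|/set0P ne] := eqVneq [set l | path_length A g h l] set0.
  by rewrite /dist E inf0.
by apply: lb_le_inf => // l /path_length_bound[].
Qed.

(** Paths have to exist, because the infimum of the empty set is 0. The term 1 makes the
    constant positive in dimension 0 too. *)
Lemma nrm2_qdet_le_dist g h : (exists l, path_length A g h l) ->
  nrm2 nu ((fun x => qdet (g x) - qdet (h x)) : borel M -> R) <=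
  (2 * det_lip n + 1) * dist A g h.
Proof.
move=> [l0 gl0]; have K0 : 0 < 2 * det_lip n + 1 :> R.
  by rewrite ltr_wpDl// mulr_ge0// det_lip_ge0.
rewrite -ler_pdivrMl//; apply: lb_le_inf; first by exists l0.
move=> l /path_length_bound[_ _ l_0 hl]; rewrite ler_pdivrMl//.
by apply: le_trans hl _; rewrite ler_wpM2r// lerDl.
Qed.

End lower_bound.

(** * Paths that are combinations of fixed tensor fields *)

Section combinations.
Context {R : realType} {n : nat}.
Variable (U : set 'rV[R]_n).
Hypothesis oU : open U.

Lemma partials0 s : partials s (fun _ : 'rV[R]_n => 0 : R) = (fun=> 0).
Proof. by elim: s => [|a s IHs] //=; rewrite IHs; apply/funext => y; rewrite derive_cst. Qed.

Lemma partials_lin s (k : R) (f g : 'rV[R]_n -> R) y : smooth_on U f -> smooth_on U g -> U y ->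
  partials s (fun z => k * f z + g z) y = k * partials s f y + partials s g y.
Proof.
move=> sf sg; elim: s y => [//|a s IHs] y Uy /=.
have df : derivable (partials s f) y (delta_mx 0 a) by exact: (sf s y Uy).2.
have dg : derivable (partials s g) y (delta_mx 0 a) by exact: (sg s y Uy).2.
have dkf : derivable (k \*: partials s f) y (delta_mx 0 a) by exact: derivableZ.
rewrite -[k * _](@deriveZ _ _ _ _ k _ _ df) -(deriveD dkf dg).
apply: near_eq_derive; have := open_nbhs_nbhs (conj oU Uy).
by apply: filterS => z Uz; rewrite IHs.
Qed.

Lemma partials_sum (J : Type) (r : seq J) (k : J -> R) (f : J -> 'rV[R]_n -> R) s y :
  (forall j, smooth_on U (f j)) -> U y ->
  partials s (fun z => \sum_(j <- r) k j * f j z) y = \sum_(j <- r) k j * partials s (f j) y.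
Proof.
move=> sf Uy; elim: r => [|j r IHr].
  rewrite big_nil (_ : (fun z => _) = (fun=> 0)) ?partials0//.
  by apply/funext => z; rewrite big_nil.
rewrite big_cons -IHr -partials_lin//.
  by congr (partials s _ y); apply/funext => z; rewrite big_cons.
by apply: (smooth_sum oU) => i; apply: (smoothM oU); [exact: smooth_cst|exact: sf].
Qed.

Lemma smooth_bounded_on_compact s (f : 'rV[R]_n -> R) K : smooth_on U f -> compact K ->
  K `<=` U -> exists2 B : R, 0 <= B & forall y, K y -> `|partials s f y| <= B.
Proof.
move=> sf cK KU; have [->|/set0P K0] := eqVneq K set0; first by exists 0.
have cf : {within K, continuous (fun y => `|partials s f y|)}.
  apply: continuous_in_subspaceT => y /set_mem /KU Uy.
  have c1 : {for y, continuous (partials s f)} by case: (sf s _ Uy).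
  exact: (continuous_comp c1 (@norm_continuous _ _ _)).
have [y _ Hy] := compact_EVT_max K0 cK cf.
by exists `|partials s f y| => // z Kz; apply: Hy; rewrite inE.
Qed.

End combinations.

Section combination_paths.
Context {R : realType} {n : nat} {M : ptopologicalType} (A : smooth_atlas R n M).
Variables (J : Type) (r : seq J) (B : J -> tensor_field R n M).
Hypothesis sB : forall j, smooth_sym_tensor A (B j).

Definition combination (k : J -> R) : tensor_field R n M :=
  fun x => \sum_(j <- r) k j *: B j x.

Lemma in_chart_combination k i y :
  in_chart A i (combination k) y = \sum_(j <- r) k j *: in_chart A i (B j) y.
Proof.
rewrite /combination; elim: r => [|j s IHs].
  rewrite big_nil in_chartE big_nil mulmx0 mul0mx//.
rewrite big_cons -IHs -(in_chartZ A i (fun=> k j)) -in_chartD.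
by congr (in_chart A i _ y); apply/funext => x; rewrite big_cons.
Qed.

Lemma smooth_sym_combination k : smooth_sym_tensor A (combination k).
Proof.
split=> [x|i a b].
  rewrite /combination; elim/big_ind : _ => [|P Q|j _].
  - by rewrite /symmetric_mx trmx0.
  - exact: symmetric_mxD.
  - by apply: symmetric_mxZ; exact: (sB j).1.
have -> : (fun y => in_chart A i (combination k) y a b) =
    (fun y => \sum_(j <- r) k j * in_chart A i (B j) y a b).
  by apply/funext => y; rewrite in_chart_combination summxE; under eq_bigr do rewrite entryZ.
have oU := @codom_open _ _ _ A i.
apply: (smooth_sum oU) => j; apply: (smoothM oU); first exact: smooth_cst.
exact: (sB j).2.
Qed.

(** On a compact subset of a chart, the partial derivatives of each of the finitely many
    B j are bounded, so that only the coefficients have to converge. *)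
Lemma frechet_cvg_combination (I : Type) (F : set_system I) (FF : Filter F)
    (k : I -> J -> R) (k0 : J -> R) :
  (forall j, k s j @[s --> F] --> k0 j) ->
  frechet_cvg A F (fun s => combination (k s)) (combination k0).
Proof.
move=> kk0 i s a b K cK Ki e e0.
have oU := @codom_open _ _ _ A i.
have E h y : codom A i y -> partials s (fun z => in_chart A i (combination h) z a b) y =
    \sum_(j <- r) h j * partials s (fun z => in_chart A i (B j) z a b) y.
  move=> iy; rewrite -(partials_sum oU r h (f := fun j z => in_chart A i (B j) z a b))//.
    congr (partials s _ y); apply/funext => z.
    by rewrite in_chart_combination summxE; under eq_bigr do rewrite entryZ.
  by move=> j; exact: (sB j).2.
have H j : exists C : R, 0 <= C /\ forall y, K y ->
    `|partials s (fun z => in_chart A i (B j) z a b) y| <= C.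
  have [c c0 Hc] := smooth_bounded_on_compact s ((sB j).2 i a b) cK Ki.
  by exists c.
have [C HC] := choice H.
have lim : \sum_(j <- r) `|k0 j - k t j| * C j @[t --> F] --> \sum_(j <- r) (0 * C j).
  apply: cvg_sumr => j; apply: cvgM; last exact: cvg_cst.
  rewrite -(normr0 R) -(subrr (k0 j)); apply: cvg_norm; apply: cvgB; first exact: cvg_cst.
  exact: kk0.
rewrite big1 in lim; last by move=> *; rewrite mul0r.
have /cvgrPdist_lt/(_ _ e0) := lim.
apply: filterS => t; rewrite sub0r normrN => ht y Ky.
rewrite !E; [|exact: Ki|exact: Ki].
apply: le_lt_trans (le_lt_trans (ler_norm _) ht); rewrite -sumrB.
apply: le_trans (ler_norm_sum _ _ _) _; apply: ler_sum => j _.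
by rewrite -mulrBl normrM distrC ler_wpM2l//; case: (HC j) => _; apply.
Qed.

Lemma C1_path_combination (p dp : R -> J -> R) :
  (forall r j, derivable (p ^~ j) r 1 /\ derive1 (p ^~ j) r = dp r j) ->
  (forall j, continuous (dp ^~ j)) ->
  (forall r, 0 <= r <= 1 -> riem_metric A (combination (p r))) ->
  C1_path A (fun r => combination (p r)) (fun r => combination (dp r)).
Proof.
move=> dpE cdp mp q q01; split; first exact: mp.
- exact: smooth_sym_combination.
- have -> : (fun s x => (s - q)^-1 *: (combination (p s) x - combination (p q) x)) =
      (fun s => combination (fun j => (p s j - p q j) / (s - q))).
    apply/funext => s; apply/funext => x; rewrite /combination -sumrB scaler_sumr.
    by apply: eq_bigr => j _; rewrite -scalerBl scalerA mulrC.
  apply: frechet_cvg_combination => j; apply: cvg_within_filter.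
  have [d1 d2] := dpE q j; apply/cvgrPdist_le => e e0.
  have := derivable_expansion d1 d2 e0; rewrite /dnbhs /within /=.
  apply: filterS => s h sq; have s0 : s - q != 0 by rewrite subr_eq0.
  rewrite -ler_pdivrMr ?normr_gt0// -normfV -normrM -normrN in h.
  suff -> : dp q j - (p s j - p q j) / (s - q) =
    - ((p s j - p q j - (s - q) * dp q j) / (s - q)) by [].
  by field.
- apply: frechet_cvg_combination => j; apply: cvg_within_filter; exact: cdp.
Qed.

End combination_paths.

(** * An upper bound for the distance of two metrics *)

Section speed_estimates.
Context {R : realType}.

(** With the exponent 4, a conformal factor multiplies the density by an integral power of
    u in every dimension. *)
Lemma sqrt_det_scale n (P : 'M[R]_n) (u : R) : 0 <= u ->
  Num.sqrt (\det (u ^+ 4 *: P)) = u ^+ (2 * n) * Num.sqrt (\det P).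
Proof.
move=> u0; rewrite detZ sqrtrM ?exprn_ge0// -exprM.
have -> : (4 * n = (2 * n) * 2)%N by lia.
by rewrite exprM sqrtr_sqr ger0_norm// exprn_ge0.
Qed.

(** In dimension 0 both sides vanish; otherwise the power of u in the density
    compensates the two negative powers of u in the norm. *)
Lemma scale_speed n (P : 'M[R]_n) (u v : R) : metric_mx P -> 0 < u -> u <= 1 ->
  gnorm2 (u ^+ 4 *: P) ((4 * u ^+ 3 * v) *: P) * Num.sqrt (\det (u ^+ 4 *: P)) <=
  16 * n%:R * v ^+ 2 * Num.sqrt (\det P).
Proof.
move=> mP u0 u1; have uP := metric_mx_unit mP.
have u4 : u ^+ 4 != 0 by rewrite expf_neq0// gt_eqF.
rewrite gnorm2Z (gnorm2Zl _ u4 uP) (gnorm2_self uP) (sqrt_det_scale P (ltW u0)).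
rewrite mulrA; apply: ler_wpM2r; first exact: sqrtr_ge0.
have -> : (4 * u ^+ 3 * v) ^+ 2 * ((u ^+ 4) ^- 2 * n%:R) * u ^+ (2 * n) =
    16 * v ^+ 2 * (n%:R * (u ^- 2 * u ^+ (2 * n))).
  by field; rewrite gt_eqF.
have -> : 16 * n%:R * v ^+ 2 = 16 * v ^+ 2 * n%:R by ring.
apply: ler_wpM2l; first by rewrite mulr_ge0 ?sqr_ge0.
case: (n) => [|m]; first by rewrite mul0r.
rewrite mulnS exprD mulKf ?expf_neq0 ?gt_eqF//.
by rewrite ler_piMr// exprn_ile1// ltW.
Qed.

Lemma shrink_ratio (q q' : R) : 0 <= q -> 0 <= q' ->
  (1 + (q + q'))^-1 * (q + q') = 1 - (1 + (q + q'))^-1.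
Proof. by move=> q0 q'0; field; rewrite gt_eqF// ltr_pwDl// addr_ge0. Qed.

(** The conformal factor s makes the density small enough for the speed of the linear
    path, which is controlled by q + q', to be paid for by 1 - s. *)
Lemma line_speed n (P Q : 'M[R]_n) (t q q' s : R) : metric_mx P -> metric_mx Q ->
  0 <= t <= 1 -> q = gnorm2 P (Q - P) -> q' = gnorm2 Q (Q - P) ->
  s = (1 + (q + q'))^-1 ->
  gnorm2 (s ^+ 4 *: ((1 - t) *: P + t *: Q)) (s ^+ 4 *: (Q - P)) *
    Num.sqrt (\det (s ^+ 4 *: ((1 - t) *: P + t *: Q))) <=
  4 * n`!%:R * 2 ^+ n * (1 - s) * Num.sqrt (\det P).
Proof.
move=> mP mQ t01 qE q'E sE; have mL := metric_mx_convex t01 mP mQ.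
have sPQ : symmetric_mx (Q - P) by apply: symmetric_mxB; [case: mQ|case: mP].
have q0 : 0 <= q by rewrite qE; exact: gnorm2_ge0.
have q'0 : 0 <= q' by rewrite q'E; exact: gnorm2_ge0.
have k0 : 0 < 1 + (q + q') by rewrite ltr_pwDl// addr_ge0.
have s0 : 0 < s by rewrite sE invr_gt0.
have s4 : s ^+ 4 != 0 by rewrite expf_neq0// gt_eqF.
have s1 : s <= 1 by rewrite sE invf_le1// lerDl addr_ge0.
rewrite gnorm2Z (gnorm2Zl _ s4 (metric_mx_unit mL)) mulrA mulfV ?expf_neq0 ?gt_eqF//.
rewrite mul1r (sqrt_det_scale _ (ltW s0)).
have LE : (1 - t) *: P + t *: Q = P + t *: (Q - P).
  by rewrite scalerBl scale1r scalerBr addrAC addrA.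
have dL : Num.sqrt (\det ((1 - t) *: P + t *: Q)) <=
    n`!%:R * (2 + q) ^+ n * Num.sqrt (\det P).
  by rewrite LE qE; apply: sqrt_det_line => //; rewrite -LE.
have gL := gnorm2_line t01 mP mQ; rewrite -qE -q'E in gL.
have g0 : 0 <= gnorm2 ((1 - t) *: P + t *: Q) (Q - P) by exact: gnorm2_ge0.
apply: (@le_trans _ _ (4 * (q + q') * (s ^+ (2 * n) *
    (n`!%:R * (2 + q) ^+ n * Num.sqrt (\det P))))).
  apply: ler_pM => //; first by rewrite mulr_ge0 ?sqrtr_ge0// exprn_ge0// ltW.
  by rewrite ler_wpM2l// exprn_ge0// ltW.
have sq : s * (2 + q) <= 2 by rewrite sE mulrC ler_pdivrMr//; lra.
have sqn : (s * (2 + q)) ^+ n <= 2 ^+ n.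
  by rewrite lerXn2r ?nnegrE// mulr_ge0 ?addr_ge0// ltW.
have sn : (q + q') * s ^+ n <= 1 - s.
  rewrite sE -(shrink_ratio q0 q'0) -sE mulrC.
  have [n0|n0] := posnP n.
    have z (X Y : 'M[R]_n) : gnorm2 X Y = 0.
      by rewrite /gnorm2 /mxtrace big1// => -[i ni]; exfalso; move: ni; rewrite n0.
    by rewrite qE q'E !z addr0 !mulr0.
  rewrite ler_wpM2r ?addr_ge0//; case: (n) n0 => // m _.
  by rewrite exprS ler_piMr ?(ltW s0)// exprn_ile1// ltW.
have -> : 4 * (q + q') * (s ^+ (2 * n) * (n`!%:R * (2 + q) ^+ n * Num.sqrt (\det P))) =
    4 * n`!%:R * (((s * (2 + q)) ^+ n) * ((q + q') * s ^+ n)) * Num.sqrt (\det P).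
  by rewrite mul2n -addnn exprD exprMn; ring.
rewrite ler_wpM2r ?sqrtr_ge0// -[leRHS]mulrA ler_wpM2l ?mulr_ge0//.
apply: ler_pM => //; first by rewrite exprn_ge0// mulr_ge0 ?addr_ge0// ltW.
by rewrite mulr_ge0 ?addr_ge0// exprn_ge0// ltW.
Qed.

End speed_estimates.

Lemma integral01_le_cst {R : realType} (v : R -> R) (B : R) : continuous v ->
  (forall r, v r <= B) -> \int[lebesgue_measure]_(r in `[0, 1]) v r <= B.
Proof.
move=> cv vB.
have cst01 : \int[lebesgue_measure]_(r in `[0, 1]) (cst B r) = B.
  rewrite Rintegral_cst// /= lebesgue_measure_itv /= lte_fin ltr01 oppr0 adde0.
  by rewrite mulr1.
rewrite -[X in _ <= X]cst01; apply: le_Rintegral => //.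
- apply: continuous_compact_integrable; first exact: segment_compact.
  exact: continuous_subspaceT.
- apply: continuous_compact_integrable; first exact: segment_compact.
  by apply: continuous_subspaceT => r; exact: cst_continuous.
Qed.

Section upper_bound.
Context {R : realType} {n : nat} {M : ptopologicalType} (A : smooth_atlas R n M).
Hypothesis M_compact : compact [set: M].
Local Notation nu := (base_measure A).
Implicit Types (a b t h : tensor_field R n M) (f u : M -> R).

Definition smooth_fun f := forall i, smooth_on (codom A i) (fun y => f (psi A i y)).

Lemma smooth_fun_cst (k : R) : smooth_fun (fun=> k).
Proof. by move=> i; apply: smooth_cst; exact: codom_open. Qed.

Lemma smooth_funD f u : smooth_fun f -> smooth_fun u -> smooth_fun (fun x => f x + u x).
Proof. by move=> sf su i; apply: (smoothD (@codom_open _ _ _ A i) (sf i) (su i)). Qed.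

Lemma smooth_funM f u : smooth_fun f -> smooth_fun u -> smooth_fun (fun x => f x * u x).
Proof. by move=> sf su i; apply: (smoothM (@codom_open _ _ _ A i) (sf i) (su i)). Qed.

Lemma smooth_funB f u : smooth_fun f -> smooth_fun u -> smooth_fun (fun x => f x - u x).
Proof.
move=> sf su; have -> : (fun x => f x - u x) = (fun x => f x + (-1) * u x).
  by apply/funext => x; rewrite mulN1r.
exact: (smooth_funD sf (smooth_funM (smooth_fun_cst (-1)) su)).
Qed.

Lemma smooth_funX f m : smooth_fun f -> smooth_fun (fun x => f x ^+ m).
Proof. by move=> sf i; apply: (smoothX (@codom_open _ _ _ A i) m (sf i)). Qed.

Lemma smooth_funV f : (forall x, f x != 0) -> smooth_fun f -> smooth_fun (fun x => (f x)^-1).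
Proof. by move=> f0 sf i; apply: (smoothV (@codom_open _ _ _ A i) _ (sf i)) => y _. Qed.

Lemma smooth_fun_gnorm2 t h : riem_metric A t -> smooth_section A h ->
  smooth_fun (fun x => gnorm2 (t x) (h x)).
Proof.
move=> mt sh i; have oU := @codom_open _ _ _ A i.
have st := @smooth_in_chart _ _ _ A t i (riem_metric_smooth mt).
have sh' := @smooth_in_chart _ _ _ A h i sh.
apply: (smooth_on_eq oU _ (smooth_gnorm2 oU _ st sh')) => y iy.
  exact: gnorm2_in_chart.
exact: metric_mx_unit (riem_metric_in_chart mt iy).
Qed.

Lemma smooth_sym_scale f t : smooth_fun f -> smooth_sym_tensor A t ->
  smooth_sym_tensor A (fun x => f x *: t x).
Proof.
move=> sf [symt st]; split=> [x|i]; first exact: symmetric_mxZ.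
have oU := @codom_open _ _ _ A i.
have H := smooth_mxZ oU (sf i) (@smooth_in_chart _ _ _ A t i st).
by apply: (smooth_mx_eq oU _ H) => y _; rewrite in_chartZ.
Qed.

Lemma smooth_symB t h : smooth_sym_tensor A t -> smooth_sym_tensor A h ->
  smooth_sym_tensor A (fun x => t x - h x).
Proof.
move=> [symt st] [symh sh]; split=> [x|i]; first exact: symmetric_mxB.
have oU := @codom_open _ _ _ A i.
have sc : smooth_on (codom A i) (fun=> -1) by exact: smooth_cst.
have H := smooth_mxD oU (@smooth_in_chart _ _ _ A t i st)
  (smooth_mxZ oU sc (@smooth_in_chart _ _ _ A h i sh)).
by apply: (smooth_mx_eq oU _ H) => y _; rewrite in_chartB scaleN1r.
Qed.

Lemma riem_metric_scale f t : smooth_fun f -> (forall x, 0 < f x) -> riem_metric A t ->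
  riem_metric A (fun x => f x *: t x).
Proof.
move=> sf f0 mt; split; first by apply: smooth_sym_scale => //; case: mt.
by move=> x; case: (metric_mxZ (f0 x) (riem_metric_mx x mt)).
Qed.

(** Integrating the pointwise bound over M bounds the speed by sqrt (K I) at all times. *)
Lemma path_length_le (c dc : R -> tensor_field R n M) (D : borel M -> R) (K I : R) :
  C1_path A c dc -> measurable_fun setT D -> (forall x, 0 <= D x) -> 0 <= K ->
  (\int[nu]_x (D x)%:E = I%:E)%E ->
  (forall r x, 0 <= r <= 1 -> gnorm2 (c r x) (dc r x) * voldens (c r) x <= K * D x) ->
  exists2 l, path_length A (c 0) (c 1) l & l <= Num.sqrt (K * I).
Proof.
move=> Hc mD D0 K0 ID H.
have speed r : 0 <= r <= 1 -> L2_norm A (c r) (dc r) <= Num.sqrt (K * I).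
  move=> r01; have mr := C1_path_metric Hc r01; have dr := C1_path_deriv Hc r01.
  rewrite (L2_normE mr dr) ler_wsqrtr// -lee_fin fineK; last first.
    rewrite ge0_fin_numE; first exact: integral_gnorm2_finite.
    by apply: integral_ge0 => x _; rewrite lee_fin; exact: gnorm2_voldens_ge0 mr dr.
  rewrite EFinM -ID -ge0_integralZl_EFin//; last 2 first.
  - by move=> x _; rewrite lee_fin.
  - exact/measurable_EFinP.
  apply: ge0_le_integral => //.
  - by move=> x _; rewrite lee_fin; exact: gnorm2_voldens_ge0 mr dr.
  - by apply/measurable_EFinP; exact: (measurable_gnorm2_voldens mr dr.2).
  - by apply: measurable_funeM; exact/measurable_EFinP.
  - by move=> x _; rewrite -EFinM lee_fin; exact: H.
eexists; first exact: (path_length_C1 Hc).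
have -> : \int[lebesgue_measure]_(r in `[0, 1]) L2_norm A (c r) (dc r) =
    \int[lebesgue_measure]_(r in `[0, 1]) L2_norm A (c (clamp r)) (dc (clamp r)).
  by apply: eq_Rintegral => r; rewrite inE /= in_itv /= => r01; rewrite clamp_id.
apply: (integral01_le_cst (speed_continuous M_compact Hc)) => r.
exact: speed (clamp01 r).
Qed.

Lemma derive_monomial (r : R) j :
  derivable (fun t : R => t ^+ j) r 1 /\ derive1 (fun t : R => t ^+ j) r = j%:R * r ^+ j.-1.
Proof. by split; [exact: exprn_derivable|rewrite exp_derive1]. Qed.

Lemma C1_path_polynomial (B : nat -> tensor_field R n M) (m : nat) :
  (forall j, smooth_sym_tensor A (B j)) ->
  (forall r : R, 0 <= r <= 1 ->
    riem_metric A (fun x => \sum_(0 <= j < m) r ^+ j *: B j x)) ->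
  C1_path A (fun r x => \sum_(0 <= j < m) r ^+ j *: B j x)
            (fun r x => \sum_(0 <= j < m) (j%:R * r ^+ j.-1) *: B j x).
Proof.
move=> sB mB; apply: (@C1_path_combination _ _ _ A _ (index_iota 0 m) B sB
  (fun r j => r ^+ j) (fun r j => j%:R * r ^+ j.-1)) => //.
- by move=> r j; exact: derive_monomial.
- move=> j r; apply: cvgM; first exact: cvg_cst.
  exact: exprn_continuous.
Qed.

(** The binomial theorem makes this path polynomial in the time. *)
Lemma C1_path_scale a (u v : M -> R) : riem_metric A a -> smooth_fun u -> smooth_fun v ->
  (forall (r : R) x, 0 <= r <= 1 -> 0 < u x + r * v x) ->
  C1_path A (fun r x => (u x + r * v x) ^+ 4 *: a x)
            (fun r x => (4 * (u x + r * v x) ^+ 3 * v x) *: a x).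
Proof.
move=> ma su sv uv0; have sa : smooth_sym_tensor A a by case: ma.
pose B j : tensor_field R n M := fun x => ('C(4, j)%:R * u x ^+ (4 - j) * v x ^+ j) *: a x.
have sB j : smooth_sym_tensor A (B j).
  have sc := smooth_funM (smooth_fun_cst 'C(4, j)%:R) (smooth_funX (4 - j) su).
  exact: (smooth_sym_scale (smooth_funM sc (smooth_funX j sv)) sa).
have cE : (fun (r : R) x => (u x + r * v x) ^+ 4 *: a x) =
    (fun r x => \sum_(0 <= j < 5) r ^+ j *: B j x).
  apply/funext => r; apply/funext => x.
  rewrite /B !big_nat_recr//= big_nil add0r !scalerA -!scalerDl; congr (_ *: _).
  by rewrite !binS !bin0 ?bin0n /=; ring.
have dcE : (fun (r : R) x => (4 * (u x + r * v x) ^+ 3 * v x) *: a x) =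
    (fun r x => \sum_(0 <= j < 5) (j%:R * r ^+ j.-1) *: B j x).
  apply/funext => r; apply/funext => x.
  rewrite /B !big_nat_recr//= big_nil add0r !scalerA -!scalerDl; congr (_ *: _).
  by rewrite !binS !bin0 ?bin0n /=; ring.
rewrite dcE cE; apply: (C1_path_polynomial sB) => r r01.
have -> : (fun x => \sum_(0 <= j < 5) r ^+ j *: B j x) =
    (fun x => (u x + r * v x) ^+ 4 *: a x) by have /(congr1 (fun F => F r)) := cE.
have suv := smooth_funX 4 (smooth_funD su (smooth_funM (smooth_fun_cst r) sv)).
apply: (riem_metric_scale suv _ ma) => x; exact: exprn_gt0 (uv0 _ _ r01).
Qed.

Lemma C1_path_line a b (s : M -> R) : riem_metric A a -> riem_metric A b -> smooth_fun s ->
  (forall x, 0 < s x) ->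
  C1_path A (fun r x => s x ^+ 4 *: ((1 - r) *: a x + r *: b x))
            (fun r x => s x ^+ 4 *: (b x - a x)).
Proof.
move=> ma mb ss s0; have sa : smooth_sym_tensor A a by case: ma.
have sb : smooth_sym_tensor A b by case: mb.
have ss4 := smooth_funX 4 ss.
pose B j : tensor_field R n M := match j with
  0 => fun x => s x ^+ 4 *: a x | _ => fun x => s x ^+ 4 *: (b x - a x) end.
have sB j : smooth_sym_tensor A (B j).
  case: j => [|j]; first exact: (smooth_sym_scale ss4 sa).
  exact: (smooth_sym_scale ss4 (smooth_symB sb sa)).
have cE : (fun (r : R) x => s x ^+ 4 *: ((1 - r) *: a x + r *: b x)) =
    (fun r x => \sum_(0 <= j < 2) r ^+ j *: B j x).
  apply/funext => r; apply/funext => x.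
  rewrite !big_nat_recr//= big_nil add0r expr0 expr1 scale1r.
  have -> : r *: (s x ^+ 4 *: (b x - a x)) = s x ^+ 4 *: (r *: (b x - a x)).
    by rewrite !scalerA mulrC.
  rewrite -scalerDr; congr (_ *: _).
  by rewrite scalerBr scalerBl scale1r addrAC addrA.
have dcE : (fun (r : R) x => s x ^+ 4 *: (b x - a x)) =
    (fun r x => \sum_(0 <= j < 2) (j%:R * r ^+ j.-1) *: B j x).
  apply/funext => r; apply/funext => x.
  by rewrite !big_nat_recr//= big_nil add0r mul0r scale0r add0r expr0 mulr1 scale1r.
rewrite dcE cE; apply: (C1_path_polynomial sB) => r r01.
have E : (fun x => \sum_(0 <= j < 2) r ^+ j *: B j x) =
    (fun x => s x ^+ 4 *: ((1 - r) *: a x + r *: b x)).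
  by have /(congr1 (fun F => F r)) := cE.
split; first exact: (smooth_sym_combination (index_iota 0 2) sB (fun j => r ^+ j)).
move=> x; have -> : \sum_(0 <= j < 2) r ^+ j *: B j x =
  s x ^+ 4 *: ((1 - r) *: a x + r *: b x) := congr1 (fun F => F x) E.
have mx := metric_mx_convex r01 (riem_metric_mx x ma) (riem_metric_mx x mb).
have s4 : 0 < s x ^+ 4 by rewrite exprn_gt0.
by case: (metric_mxZ s4 mx).
Qed.

(** The sum of the squared distances between a x and b x, seen from either of them: it is
    finite, smooth, symmetric, and tends to 0 when both metrics tend to the same one. *)
Definition relgap a b x : R := gnorm2 (a x) (b x - a x) + gnorm2 (b x) (b x - a x).

(** A smooth conformal factor, close to 1 where a and b are close to each other and close
    to 0 where they are far apart. *)
Definition shrink a b x : R := (1 + relgap a b x)^-1.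

(** The integral of this density is, up to [upper_const], an upper bound for the squared
    length of each of the three paths in [dist_upper_bound]. *)
Definition gap_density a b : borel M -> R :=
  fun x => (1 - shrink a b x) * (voldens a x + voldens b x).

Definition upper_const : R := 16 * n%:R + 4 * n`!%:R * 2 ^+ n.

Lemma upper_const_ge0 : 0 <= upper_const.
Proof. by rewrite addr_ge0 ?mulr_ge0// exprn_ge0. Qed.

Section two_metrics.
Variables a b : tensor_field R n M.
Hypotheses (ma : riem_metric A a) (mb : riem_metric A b).

Lemma riem_metric_symB x : symmetric_mx (b x - a x).
Proof.
by apply: symmetric_mxB; [case: (riem_metric_mx x mb)|case: (riem_metric_mx x ma)].
Qed.

Lemma relgap_ge0 x : 0 <= relgap a b x.
Proof.
have sx := riem_metric_symB x; apply: addr_ge0.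
  exact: gnorm2_ge0 (riem_metric_mx x ma) sx.
exact: gnorm2_ge0 (riem_metric_mx x mb) sx.
Qed.

Lemma shrink_gt0 x : 0 < shrink a b x.
Proof. by rewrite invr_gt0 ltr_pwDl// relgap_ge0. Qed.

Lemma shrink_le1 x : shrink a b x <= 1.
Proof. by rewrite invf_le1 ?lerDl ?relgap_ge0// ltr_pwDl// relgap_ge0. Qed.

Lemma smooth_fun_shrink : smooth_fun (shrink a b).
Proof.
have sab := (smooth_symB mb.1 ma.1).2.
have sq := smooth_funD (smooth_fun_gnorm2 ma sab) (smooth_fun_gnorm2 mb sab).
apply: (smooth_funV _ (smooth_funD (smooth_fun_cst 1) sq)) => x.
by rewrite gt_eqF// ltr_pwDl//; exact: relgap_ge0.
Qed.

Lemma gap_density_ge0 x : 0 <= gap_density a b x.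
Proof. by rewrite mulr_ge0 ?subr_ge0 ?shrink_le1// addr_ge0 ?voldens_ge0. Qed.

Lemma measurable_gap_density : measurable_fun setT (gap_density a b).
Proof.
have ms : measurable_fun setT (shrink a b : borel M -> R).
  apply: measurable_smooth_chartwise => i.
  exists (fun y => shrink a b (psi A i y)); first exact: smooth_fun_shrink.
  by move=> x ix; rewrite phiK//; exact: dom_chart_piece ix.
apply: measurable_funM; first by apply: measurable_funB.
by apply: measurable_funD;
  [exact: (measurable_voldens (riem_metric_smooth ma))
  |exact: (measurable_voldens (riem_metric_smooth mb))].
Qed.

Lemma integral_gap_density :
  (\int[nu]_x (gap_density a b x)%:E)%E = (fine (\int[nu]_x (gap_density a b x)%:E)%E)%:E.
Proof.
rewrite fineK// ge0_fin_numE; last first.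
  by apply: integral_ge0 => x _; rewrite lee_fin gap_density_ge0.
have mva := measurable_voldens (riem_metric_smooth ma).
have mvb := measurable_voldens (riem_metric_smooth mb).
apply: (@le_lt_trans _ _ (\int[nu]_x ((voldens a x)%:E + (voldens b x)%:E))%E).
  apply: ge0_le_integral => //.
  - by move=> x _; rewrite lee_fin gap_density_ge0.
  - by apply/measurable_EFinP; exact: measurable_gap_density.
  - by apply: emeasurable_funD; apply/measurable_EFinP.
  - move=> x _; rewrite -EFinD lee_fin /gap_density ler_piMl ?addr_ge0 ?voldens_ge0//.
    by rewrite gerBl ltW// shrink_gt0.
rewrite ge0_integralD//.
- by rewrite (integral_voldens M_compact ma) (integral_voldens M_compact mb) -EFinD ltry.
- by move=> x _; rewrite lee_fin voldens_ge0.
- by apply/measurable_EFinP.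
- by move=> x _; rewrite lee_fin voldens_ge0.
- by apply/measurable_EFinP.
Qed.

Lemma shrink_segment (r s : R) : 0 < s -> s <= 1 -> 0 <= r <= 1 ->
  (0 < 1 + r * (s - 1) /\ 1 + r * (s - 1) <= 1) /\
  (0 < s + r * (1 - s) /\ s + r * (1 - s) <= 1).
Proof.
move=> s0 s1 /andP[r0 r1].
have h1 : 0 <= r * (1 - s) by rewrite mulr_ge0// subr_ge0.
have h2 : 0 <= (1 - r) * (1 - s) by rewrite mulr_ge0// subr_ge0.
by split; split; lra.
Qed.

Lemma scale_speed_gap (v d d' s : R) : 0 < s -> s <= 1 -> 0 <= d -> 0 <= d' ->
  v ^+ 2 = (1 - s) ^+ 2 -> 16 * n%:R * v ^+ 2 * d <= upper_const * ((1 - s) * (d + d')).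
Proof.
move=> s0 s1 d0 d'0 ->; have s2 : 0 <= 1 - s by rewrite subr_ge0.
have s3 : (1 - s) ^+ 2 <= 1 - s by rewrite expr2 ler_piMl// gerBl ltW.
rewrite -[leLHS]mulrA; apply: ler_pM.
- by rewrite mulr_ge0.
- by rewrite mulr_ge0// sqr_ge0.
- by rewrite lerDl !mulr_ge0// exprn_ge0.
- by apply: ler_pM; rewrite ?sqr_ge0// lerDl.
Qed.

(** Shrink a and b by the factor s ^ 4, which costs little where s is close to 1 and where
    the volume is small, and join the results by a segment. *)
Lemma dist_upper_bound : (exists l, path_length A a b l) /\
  dist A a b <= 3 * Num.sqrt (upper_const * fine (\int[nu]_x (gap_density a b x)%:E)%E).
Proof.
pose s := shrink a b; have ss : smooth_fun s := smooth_fun_shrink.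
have s0 x : 0 < s x := shrink_gt0 x; have s1 x : s x <= 1 := shrink_le1 x.
have mD := measurable_gap_density; have D0 := gap_density_ge0.
have ID := integral_gap_density; have K0 := upper_const_ge0.
set L := Num.sqrt _.
have va x : 0 <= voldens a x := voldens_ge0 a x.
have vb x : 0 <= voldens b x := voldens_ge0 b x.
have sc1 := smooth_fun_cst 1.
have P1 := C1_path_scale ma sc1 (smooth_funB ss sc1)
  (fun r x r01 => (shrink_segment (s0 x) (s1 x) r01).1.1).
have P3 := C1_path_scale mb ss (smooth_funB sc1 ss)
  (fun r x r01 => (shrink_segment (s0 x) (s1 x) r01).2.1).
have P2 := C1_path_line ma mb ss s0.
have [|l1 p1 h1] := path_length_le P1 mD D0 K0 ID.
  move=> r x r01; have [[h1 h2] _] := shrink_segment (s0 x) (s1 x) r01.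
  apply: le_trans (scale_speed _ (riem_metric_mx x ma) h1 h2) _.
  have vE : (s x - 1) ^+ 2 = (1 - s x) ^+ 2 by ring.
  exact: (scale_speed_gap (s0 x) (s1 x) (va x) (vb x) vE).
have [|l3 p3 h3] := path_length_le P3 mD D0 K0 ID.
  move=> r x r01; have [_ [h1' h2]] := shrink_segment (s0 x) (s1 x) r01.
  apply: le_trans (scale_speed _ (riem_metric_mx x mb) h1' h2) _.
  rewrite /gap_density [voldens a x + _]addrC.
  exact: (scale_speed_gap (s0 x) (s1 x) (vb x) (va x) erefl).
have [|l2 p2 h2] := path_length_le P2 mD D0 K0 ID.
  move=> r x r01.
  apply: le_trans (line_speed (riem_metric_mx x ma) (riem_metric_mx x mb) r01
    erefl erefl erefl) _.
  have g0 : 0 <= 1 - s x by rewrite subr_ge0.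
  rewrite -mulrA; apply: ler_pM.
  - by rewrite mulr_ge0 ?exprn_ge0// mulr_ge0.
  - by rewrite mulr_ge0// sqrtr_ge0.
  - by rewrite lerDr mulr_ge0.
  - by apply: ler_wpM2l => //; rewrite lerDl.
have E1 : (fun x => (1 + 0 * (s x - 1)) ^+ 4 *: a x) = a.
  by apply/funext => x; rewrite mul0r addr0 expr1n scale1r.
have E2 : (fun x => (1 + 1 * (s x - 1)) ^+ 4 *: a x) = (fun x => s x ^+ 4 *: a x).
  by apply/funext => x; congr (_ ^+ 4 *: _); ring.
have E3 : (fun x => s x ^+ 4 *: ((1 - 0) *: a x + 0 *: b x)) = (fun x => s x ^+ 4 *: a x).
  by apply/funext => x; rewrite subr0 scale1r scale0r addr0.
have E4 : (fun x => s x ^+ 4 *: ((1 - 1) *: a x + 1 *: b x)) = (fun x => s x ^+ 4 *: b x).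
  by apply/funext => x; rewrite subrr scale1r scale0r add0r.
have E5 : (fun x => (s x + 0 * (1 - s x)) ^+ 4 *: b x) = (fun x => s x ^+ 4 *: b x).
  by apply/funext => x; rewrite mul0r addr0.
have E6 : (fun x => (s x + 1 * (1 - s x)) ^+ 4 *: b x) = b.
  by apply/funext => x; rewrite mul1r addrC subrK expr1n scale1r.
rewrite E1 E2 in p1; rewrite E3 E4 in p2; rewrite E5 E6 in p3.
have p := path_length_cat (path_length_cat p1 p2) p3.
split; first by exists (l1 + l2 + l3).
by apply: le_trans (dist_le_length M_compact p) _; rewrite -/L in h1 h2 h3; lra.
Qed.

End two_metrics.

End upper_bound.

(** * Sequences of bounded variation in the space of square integrable functions *)

Section bounded_variation.
Context d (T : measurableType d) (R : realType).
Variable nu : {measure set T -> \bar R}.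
Variables (f : nat -> T -> R) (B : R).
Hypothesis fL : forall k, sqr_integrable nu (f k).
Hypothesis f0 : forall k x, 0 <= f k x.
Hypothesis fB : forall N,
  \sum_(0 <= k < N) nrm2 nu (fun x => f k.+1 x - f k x) <= B.

Definition variation N x : R := f 0%N x + \sum_(0 <= k < N) `|f k.+1 x - f k x|.

Lemma variationS N x : variation N.+1 x = variation N x + `|f N.+1 x - f N x|.
Proof. by rewrite /variation big_nat_recr//= addrA. Qed.

Lemma variation_ge N x : f N x <= variation N x.
Proof.
elim: N => [|N IHN]; first by rewrite /variation big_geq// addr0.
rewrite variationS; have := ler_norm (f N.+1 x - f N x); lra.
Qed.

Lemma variation_ge0 N x : 0 <= variation N x.
Proof. exact: le_trans (f0 N x) (variation_ge N x). Qed.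

Lemma variation_le N m x : (N <= m)%N -> variation N x <= variation m x.
Proof.
move=> Nm; rewrite -(subnK Nm) addnC; elim: (m - N)%N => [|j IHj]; first by rewrite addn0.
by rewrite addnS variationS (le_trans IHj)// lerDl.
Qed.

Lemma sqr_integrable_norm (h : T -> R) : sqr_integrable nu h ->
  sqr_integrable nu (fun x => `|h x|).
Proof.
move=> [mh fh]; split; first exact: measurableT_comp.
by under eq_integral do rewrite real_normK ?num_real//.
Qed.

Lemma nrm2_norm (h : T -> R) : nrm2 nu (fun x => `|h x|) = nrm2 nu h.
Proof.
by congr (Num.sqrt (fine _)); apply: eq_integral => x _; rewrite real_normK ?num_real.
Qed.

Lemma variation_nrm2 N : sqr_integrable nu (variation N) /\
  nrm2 nu (variation N) <=
  nrm2 nu (f 0%N) + \sum_(0 <= k < N) nrm2 nu (fun x => f k.+1 x - f k x).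
Proof.
elim: N => [|N [IHL IHN]].
  have -> : variation 0 = f 0%N by apply/funext => x; rewrite /variation big_geq// addr0.
  by rewrite big_geq// addr0.
have -> : variation N.+1 = (fun x => variation N x + `|f N.+1 x - f N x|).
  by apply/funext => x; exact: variationS.
have Ld := sqr_integrable_norm (sqr_integrableB (fL N.+1) (fL N)).
split; first exact: sqr_integrableD.
rewrite big_nat_recr//= addrA (le_trans (nrm2D_le IHL Ld))//.
by rewrite nrm2_norm lerD2r.
Qed.

(** The increasing limit of the squared variations is integrable by monotone
    convergence, and f converges wherever it is finite. *)
Lemma bounded_variation_dominated : exists H : T -> \bar R,
  [/\ nu.-integrable setT H, forall k x, ((f k x ^+ 2)%:E <= H x)%E &
      forall x, H x \is a fin_num -> cvgn (f ^~ x)].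
Proof.
pose S N x := (variation N x ^+ 2)%:E; pose H x := limn (S ^~ x).
have S0 N x : (0 <= S N x)%E by rewrite lee_fin sqr_ge0.
have SS x : {homo S ^~ x : N m / (N <= m)%N >-> (N <= m)%E}.
  move=> N m Nm; rewrite lee_fin lerXn2r ?nnegrE ?variation_ge0//.
  exact: variation_le.
have mS N : measurable_fun setT (S N).
  by apply: measurable_sqr; case: (variation_nrm2 N) => -[].
have cS x : S N x @[N --> \oo] --> H x by exact: (ereal_nondecreasing_is_cvgn (SS x)).
have SH N x : (S N x <= H x)%E.
  apply: lime_ge; first exact: (ereal_nondecreasing_is_cvgn (SS x)).
  by near=> m; apply: SS; near: m; exact: nbhs_infty_ge.
have H0 x : (0 <= H x)%E by exact: le_trans (S0 0%N x) (SH 0%N x).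
have mH : measurable_fun setT H.
  exact: (emeasurable_fun_cvg _ _ mS (fun x _ => cS x)).
exists H; split.
- apply/integrableP; split=> //.
  under eq_integral do rewrite (gee0_abs (H0 _)).
  have -> : (\int[nu]_x H x)%E = limn (fun N => (\int[nu]_x S N x)%E).
    by apply: monotone_convergence => // x _; exact: SS.
  apply: (@le_lt_trans _ _ ((nrm2 nu (f 0%N) + B) ^+ 2)%:E); last by rewrite ltry.
  apply: lime_le.
    apply: ereal_nondecreasing_is_cvgn => N m Nm.
    by apply: ge0_le_integral => // x _; exact: SS.
  apply: nearW => N; have [LS hS] := variation_nrm2 N.
  rewrite /S (nrm2K LS) lee_fin lerXn2r ?nnegrE ?nrm2_ge0//.
    rewrite addr_ge0 ?nrm2_ge0//; have := fB 0; rewrite big_geq//.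
  by apply: le_trans hS _; rewrite lerD2l.
- move=> k x; apply: le_trans (SH k x); rewrite lee_fin lerXn2r ?nnegrE ?variation_ge0//.
  exact: variation_ge.
- move=> x Hx; pose h := fine (H x).
  have bound N : variation N x <= Num.sqrt h.
    rewrite -[leLHS]ger0_norm ?variation_ge0// -sqrtr_sqr ler_wsqrtr//.
    by rewrite -lee_fin fineK//; exact: SH.
  have c1 : cvgn [normed series (telescope (f ^~ x))].
    apply: nondecreasing_is_cvgn.
      move=> N m Nm; have := variation_le x Nm.
      by rewrite /variation lerD2l.
    exists (Num.sqrt h) => _ [N _ <-]; apply: le_trans (bound N).
    by rewrite /variation lerDr.
  have c2 := normed_cvg c1.
  have -> : f ^~ x = (fun N => f 0%N x + series (telescope (f ^~ x)) N).
    by apply/funext => N; exact: (eq_sum_telescope (f ^~ x)).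
  by apply: is_cvgD => //; exact: is_cvg_cst.
Unshelve. all: by end_near. Qed.

End bounded_variation.

(** * Convergence of the distances *)

Section convergence.
Context {R : realType} {n : nat} {M : ptopologicalType} (A : smooth_atlas R n M).
Hypothesis M_compact : compact [set: M].
Local Notation nu := (base_measure A).

(** By [nrm2_qdet_le_dist], summable distances bound the total variation of the sequence of
    the [qdet (gs k)] in the L2 norm. *)
Lemma summable_dist_dominated (gs : nat -> tensor_field R n M) :
  (forall k, riem_metric A (gs k)) ->
  cvgn (series (fun k => dist A (gs k) (gs k.+1))) ->
  exists H : borel M -> \bar R,
  [/\ nu.-integrable setT H, forall k x, ((voldens (gs k) x)%:E <= H x)%E &
      forall x, H x \is a fin_num -> cvgn (fun k => qdet (gs k x))].
Proof.
move=> mgs sd; pose f k : borel M -> R := fun x => qdet (gs k x).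
pose K : R := 2 * det_lip n + 1.
have K0 : 0 <= K by rewrite addr_ge0// mulr_ge0// det_lip_ge0.
have fB N : \sum_(0 <= k < N) nrm2 nu (fun x => f k.+1 x - f k x) <=
    K * limn (series (fun k => dist A (gs k) (gs k.+1))).
  have hs : series (fun k => dist A (gs k) (gs k.+1)) N <=
      limn (series (fun k => dist A (gs k) (gs k.+1))).
    apply: nondecreasing_cvgn_le => //; apply: nondecreasing_series => k _ _.
    exact: (dist_ge0 A M_compact).
  apply: le_trans (ler_wpM2l K0 hs); rewrite /series /= mulr_sumr.
  apply: ler_sum => k _; rewrite (nrm2_distC nu (f k.+1) (f k)).
  by apply: (nrm2_qdet_le_dist M_compact); case: (dist_upper_bound M_compact (mgs k) (mgs k.+1)).
have [H [iH Hf Hc]] := bounded_variation_dominated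
  (fun k => sqr_integrable_qdet M_compact (mgs k)) (fun k x => qdet_ge0 (gs k x)) fB.
by exists H; split=> // k x; have := Hf k x; rewrite qdetK.
Qed.

Lemma qdet_gt0 (P : 'M[R]_n) : metric_mx P -> 0 < qdet P.
Proof. by move=> mP; rewrite !sqrtr_gt0; exact: metric_mx_det. Qed.

Lemma det_qdet (P : 'M[R]_n) : metric_mx P -> \det P = qdet P ^+ 4.
Proof.
move=> mP; rewrite (exprM _ 2 2) qdetK sqr_sqrtr// ltW//; exact: metric_mx_det.
Qed.

Lemma cvg_pos_bounded_below (u : nat -> R) (l : R) : (forall k, 0 < u k) -> 0 < l ->
  u k @[k --> \oo] --> l -> exists2 m, 0 < m & forall k, m <= u k.
Proof.
move=> u0 l0 ul.
have l2 : 0 < l / 2 by rewrite divr_gt0.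
have /cvgrPdist_lt/(_ _ l2)[N _ HN] := ul.
exists (\big[Order.min/(l / 2)]_(k < N) u k).
  by elim/big_ind : _ => // x y x0 y0; rewrite lt_min x0.
move=> k; have [kN|Nk] := ltnP k N; first exact: (bigmin_le _ (Ordinal kN)).
apply: (@le_trans _ _ (l / 2)); first exact: bigmin_le_id.
have := HN k Nk; rewrite /= ltr_norml => /andP[_ h]; lra.
Qed.

(** On the deflated set the determinants come arbitrarily close to 0, so 0 is the only
    possible limit. *)
Lemma deflated_qdet_cvg0 g (gs : nat -> tensor_field R n M) x : riem_metric A g ->
  (forall k, riem_metric A (gs k)) -> deflated_seq g gs x ->
  cvgn (fun k => qdet (gs k x)) -> qdet (gs k x) @[k --> \oo] --> 0.
Proof.
move=> mg mgs dx /cvg_ex[l fl].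
have mgx := riem_metric_mx x mg; have mgsx k := riem_metric_mx x (mgs k).
have l0 : 0 <= l.
  rewrite -(cvg_lim _ fl)//; apply: limr_ge; first by apply/cvg_ex; exists l.
  by apply: nearW => k; exact: qdet_ge0.
move: l0; rewrite le_eqVlt => /predU1P[->//|l0]; exfalso.
have [m m0 Hm] := cvg_pos_bounded_below (fun k => qdet_gt0 (mgsx k)) l0 fl.
have dg := metric_mx_det mgx.
have [k] := dx (m ^+ 4 / \det (g x)) (divr_gt0 (exprn_gt0 4 m0) dg).
rewrite det_mulmx det_inv (det_qdet (mgsx k)) mulrC ltr_pM2r ?invr_gt0//.
by rewrite ltNge lerXn2r ?nnegrE ?qdet_ge0 ?(ltW m0).
Qed.

(** The deflated sets of t and of the sequence agree up to a nullset, and on the latter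
    [deflated_qdet_cvg0] applies wherever the dominating function H is finite. *)
Lemma limit_ae g (gs : nat -> tensor_field R n M) (t : tensor_field R n M)
    (H : borel M -> \bar R) : riem_metric A g -> (forall k, riem_metric A (gs k)) ->
  eq_mod_null A g (deflated t) (deflated_seq g gs) ->
  nullset A g [set x | ~ deflated_seq g gs x /\ ~ ((fun k : nat => gs k x) @ \oo --> t x)] ->
  nu.-integrable setT H -> (forall x, H x \is a fin_num -> cvgn (fun k => qdet (gs k x))) ->
  {ae nu, forall x, (deflated t x -> qdet (gs k x) @[k --> \oo] --> (0 : R)) /\
    (~ deflated t x -> gs k x @[k --> \oo] --> t x)}.
Proof.
move=> mg mgs E0 C0 iH Hc.
have N1 := nullset_base_measure mg E0; have N2 := nullset_base_measure mg C0.
have N3 := integrable_ae measurableT iH.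
apply: negligibleS (negligibleU (negligibleU N1 N2) N3) => x /= nP.
apply: contrapT => nx; apply: nP.
have fx : H x \is a fin_num by apply: contrapT => nf; apply: nx; right=> /(_ I).
split=> [dx|ndx].
  apply: (deflated_qdet_cvg0 mg mgs _ (Hc x fx)).
  by apply: contrapT => nds; apply: nx; left; left; left.
have nds : ~ deflated_seq g gs x by move=> ds; apply: nx; left; left; right.
by apply: contrapT => nc; apply: nx; left; right.
Qed.

Lemma gap_density_le a b x : riem_metric A a -> riem_metric A b ->
  gap_density a b x <= voldens a x + voldens b x.
Proof.
move=> ma mb; rewrite /gap_density ler_piMl ?addr_ge0 ?voldens_ge0//.
by rewrite gerBl ltW//; exact: (shrink_gt0 ma mb).
Qed.

Section two_sequences.
Variables (g0 g1 : nat -> tensor_field R n M).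
Hypothesis g0_metric : forall k, riem_metric A (g0 k).
Hypothesis g1_metric : forall k, riem_metric A (g1 k).

(** The gap density is at most the sum of both volume densities. *)
Lemma gap_density_cvg0_deflated x : qdet (g0 k x) @[k --> \oo] --> 0 ->
  qdet (g1 k x) @[k --> \oo] --> 0 -> gap_density (g0 k) (g1 k) x @[k --> \oo] --> 0.
Proof.
move=> h0 h1.
have h : qdet (g0 k x) ^+ 2 + qdet (g1 k x) ^+ 2 @[k --> \oo] --> (0 : R).
  rewrite -[X in _ --> X](_ : 0 * 0 + 0 * 0 = 0); last by rewrite mulr0 addr0.
  by apply: cvgD; rewrite /GRing.exp /=; apply: cvgM.
apply: (squeeze_cvgr _ (cvg_cst 0) h); apply: nearW => k.
rewrite (gap_density_ge0 (g0_metric k) (g1_metric k)) !qdetK.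
exact: gap_density_le (g0_metric k) (g1_metric k).
Qed.

(** Here the gap between the two metrics tends to 0 and the densities converge. *)
Lemma gap_density_cvg0_regular x (P : 'M[R]_n) : metric_mx P ->
  g0 k x @[k --> \oo] --> P -> g1 k x @[k --> \oo] --> P ->
  gap_density (g0 k) (g1 k) x @[k --> \oo] --> 0.
Proof.
move=> mP c0 c1; have uP := metric_mx_unit mP.
have e0 i j : g0 k x i j @[k --> \oo] --> P i j by apply: cvg_entry c0.
have e1 i j : g1 k x i j @[k --> \oo] --> P i j by apply: cvg_entry c1.
have ed i j : (g1 k x - g0 k x) i j @[k --> \oo] --> (0 : 'M[R]_n) i j.
  rewrite -(subrr P) entryD entryN; under eq_fun do rewrite entryD entryN.
  by apply: cvgB; [exact: e1|exact: e0].
have u0 k : g0 k x \in unitmx := metric_mx_unit (riem_metric_mx x (g0_metric k)).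
have u1 k : g1 k x \in unitmx := metric_mx_unit (riem_metric_mx x (g1_metric k)).
have q : relgap (g0 k) (g1 k) x @[k --> \oo] --> gnorm2 P 0 + gnorm2 P 0.
  apply: cvgD; first exact: cvg_gnorm2 uP u0 e0 ed.
  exact: cvg_gnorm2 uP u1 e1 ed.
rewrite gnorm20 addr0 in q.
have s : shrink (g0 k) (g1 k) x @[k --> \oo] --> (1 : R).
  have z : (1 + 0)^-1 = 1 :> R by rewrite addr0 invr1.
  rewrite -[X in _ --> X]z.
  apply: cvgV; first by rewrite addr0 oner_neq0.
  by apply: cvgD => //; exact: cvg_cst.
rewrite -[X in _ --> X](mul0r (Num.sqrt (\det P) + Num.sqrt (\det P))).
apply: cvgM; first by rewrite -(subrr 1); apply: cvgB => //; exact: cvg_cst.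
by apply: cvgD; apply: cvg_sqrtr; exact: cvg_det.
Qed.

Lemma dist_cvg0 g (t : tensor_field R n M) : riem_metric A g -> semimetric t ->
  eq_mod_null A g (deflated t) (deflated_seq g g0) ->
  eq_mod_null A g (deflated t) (deflated_seq g g1) ->
  nullset A g [set x | ~ deflated_seq g g0 x /\ ~ ((fun k : nat => g0 k x) @ \oo --> t x)] ->
  nullset A g [set x | ~ deflated_seq g g1 x /\ ~ ((fun k : nat => g1 k x) @ \oo --> t x)] ->
  cvgn (series (fun k : nat => dist A (g0 k) (g0 k.+1))) ->
  cvgn (series (fun k : nat => dist A (g1 k) (g1 k.+1))) ->
  dist A (g0 k) (g1 k) @[k --> \oo] --> (0 : R).
Proof.
move=> mg st E0 E1 C0 C1 S0 S1.
have [H0 [iH0 Hf0 Hc0]] := summable_dist_dominated g0_metric S0.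
have [H1 [iH1 Hf1 Hc1]] := summable_dist_dominated g1_metric S1.
have iH := integrableD measurableT iH0 iH1.
pose I k := (\int[nu]_x (gap_density (g0 k) (g1 k) x)%:E)%E.
have cv : {ae nu, forall x, setT x ->
    (gap_density (g0 k) (g1 k) x)%:E @[k --> \oo] --> (0 : R)%:E}.
  have L0 := limit_ae mg g0_metric E0 C0 iH0 Hc0.
  have L1 := limit_ae mg g1_metric E1 C1 iH1 Hc1.
  have FF := ae_filter_ringOfSetsType nu.
  apply: filterS (filterI L0 L1) => x [[d0 r0] [d1 r1]] _; apply: cvg_EFin; first exact: nearW.
  have [dx|ndx] := pselect (deflated t x).
    by apply: gap_density_cvg0_deflated; [exact: d0|exact: d1].
  apply: (gap_density_cvg0_regular _ (r0 ndx) (r1 ndx)).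
  by split; [case: (st x)|exact: contrapT ndx].
have mg01 k : measurable_fun setT (fun x => (gap_density (g0 k) (g1 k) x)%:E).
  by apply/measurable_EFinP; exact: (measurable_gap_density (g0_metric k) (g1_metric k)).
have dom : {ae nu, forall x, forall k, setT x ->
    (`|(gap_density (g0 k) (g1 k) x)%:E| <= (H0 \+ H1) x)%E}.
  apply: aeW => x k _; rewrite gee0_abs; last first.
    by rewrite lee_fin (gap_density_ge0 (g0_metric k) (g1_metric k)).
  apply: (@le_trans _ _ ((voldens (g0 k) x)%:E + (voldens (g1 k) x)%:E)%E).
    by rewrite -EFinD lee_fin; exact: gap_density_le (g0_metric k) (g1_metric k).
  exact: leeD.
have [_ _ cI] := dominated_convergence measurableT mg01 (measurable_cst (0 : R)%:E) cv iH dom.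
rewrite integral0 in cI.
have cfine : fine (I k) @[k --> \oo] --> (0 : R) by apply: fine_cvg cI.
have cbound : 3 * Num.sqrt (@upper_const R n * fine (I k)) @[k --> \oo] --> (0 : R).
  have z : 3 * Num.sqrt (@upper_const R n * 0) = 0 by rewrite mulr0 sqrtr0 mulr0.
  rewrite -[X in _ --> X]z.
  apply: cvgM; first exact: cvg_cst.
  by apply: cvg_sqrtr; apply: cvgM => //; exact: cvg_cst.
apply: (squeeze_cvgr _ (cvg_cst 0) cbound); apply: nearW => k.
rewrite (dist_ge0 A M_compact) /=.
by case: (dist_upper_bound M_compact (g0_metric k) (g1_metric k)).
Qed.

End two_sequences.
End convergence.

Theorem theorem4p39 (R : realType) (n : nat) (M : ptopologicalType)
  (A : smooth_atlas R n M)
  (M_hausdorff : hausdorff_space M)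
  (M_compact : compact [set: M])
  (M_orientable : orientable A)
  (g : tensor_field R n M) (g_metric : riem_metric A g)
  (C : set (tensor_field R n M)) (C_Mf_hat : Mf_hat A g C)
  (g0 g1 : nat -> tensor_field R n M)
  (g0_metric : forall k, riem_metric A (g0 k))
  (g1_metric : forall k, riem_metric A (g1 k))
  (g0_omega : omega_cvg A g g0 C)
  (g1_omega : omega_cvg A g g1 C) :
  (fun k => dist A (g0 k) (g1 k)) @ \oo --> (0 : R).
Proof.
case: C_Mf_hat => t Mt CE.
have Ct : C t.
  have null0 : nullset A g set0.
    have [m mE] := vol_measure_exists (riem_metric_smooth g_metric).
    by rewrite /nullset -mE; exact: negligible_set0.
  rewrite CE; split=> //; split; first by rewrite /eq_mod_null setYK.
  rewrite (_ : [set x | _] = set0)//.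
  by apply/seteqP; split=> // x [_]; apply.
have [_ E0 C0 S0] := g0_omega t Ct; have [_ E1 C1 S1] := g1_omega t Ct.
case: Mt => -[st _] _.
exact: dist_cvg0 g_metric st E0 E1 C0 C1 S0 S1.
Qed.
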